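(* Let $m\in\mathbb{N}$, let $a\in S\oplus V\cong\mathbb{R}^{2m+2}$, let $B\subset S\oplus V$ be an open ball centered at $a$, and let $f:B\setminus\{a\}\to\mathbb{R}_{0,2m+1}$ be a (left) holomorphic Cliffordian function. Then there exist coefficients $C_\alpha,D_\beta\in\mathbb{R}_{0,2m+1}$ (indexed by multi-indices $\alpha,\beta\in\mathbb{N}^{2m+2}$, $|\alpha|\ge1$, $|\beta|\geq 0$) such that for every $x\in B\setminus\{a\}$, $$f(x)=\sum_{|\beta|=0}^\infty S_\beta(x-a)\,D_\beta+\sum_{|\alpha|=1}^\infty P_\alpha(x-a)\,C_\alpha,$$ where the series are understood as $\sum_{k}\sum_{|\beta|=k}S_\beta(x-a)D_\beta$ and $\sum_k\sum_{|\alpha|=k}P_\alpha(x-a)C_\alpha$.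
   Context: $\mathbb{R}_{0,2m+1}$ is the Clifford algebra of a real vector space $V$ of dimension $2m+1$ with a negative definite quadratic form; $e_1,\dots,e_{2m+1}$ is an orthonormal basis of $V$ (so $e_i^2=-1$, $e_ie_j=-e_je_i$ for $i\ne j$, $i,j\geq 1$) and $e_0=1$. $S=\mathbb{R}$ is the space of scalars. A point $(x_0,\dots,x_{2m+1})\in\mathbb{R}^{2m+2}$ is identified with $x=\sum_{i=0}^{2m+1}e_ix_i\in S\oplus V\subset\mathbb{R}_{0,2m+1}$; with $x^*=x_0-\sum_{i=1}^{2m+1}e_ix_i$ one has $x^{-1}=x^*/|x|^2$ for $x\ne0$. $D=\sum_{i=0}^{2m+1}e_i\frac{\partial}{\partial x_i}$ (acting from the left) and $\Delta=\sum_{i=0}^{2m+1}\frac{\partial^2}{\partial x_i^2}$. A function $f:\Omega\to\mathbb{R}_{0,2m+1}$ (of class $\mathcal{C}^{2m+1}$), $\Omega\subset S\oplus V$ open, is (left) holomorphic Cliffordian in $\Omega$ if $D\Delta^mf=0$ on $\Omega$, where $\Delta^m$ is the $m$-times iterated Laplacian. For a multi-index $\alpha\in\mathbb{N}^{2m+2}$ put $|\alpha|=\sum_{i=0}^{2m+1}\alpha_i$. For $|\alpha|=k\ge1$, $P_\alpha(x)=\sum e_{i_1}x\,e_{i_2}x\cdots e_{i_{k-1}}x\,e_{i_k}$, and for $|\beta|=k\ge0$, $S_\beta(x)=\sum x^{-1}e_{i_1}x^{-1}e_{i_2}\cdots x^{-1}e_{i_k}x^{-1}$ (so $S_0(x)=x^{-1}$),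 each sum being over all distinct sequences $(i_1,\dots,i_k)$ in which each index $j\in\{0,\dots,2m+1\}$ occurs exactly $\alpha_j$ (respectively $\beta_j$) times (distinguishable permutations). *)

(* Defs.v *)
From HB Require Import structures.
From mathcomp Require Import all_boot all_order all_algebra all_field.
From mathcomp Require Import all_classical all_reals all_analysis.
From mathcomp Require Import ring.
Import Order.TTheory GRing.Theory Num.Theory.
Import numFieldNormedType.Exports.

Set Implicit Arguments.
Unset Strict Implicit.
Unset Printing Implicit Defensive.

Local Open Scope classical_set_scope.
Local Open Scope ring_scope.

(** * The Clifford algebra R_{0,n} of a negative definite form of rank n *)

(* An element is the row of its coordinates in the basis (e_A), A a subset of
   'I_n, where e_A is the product of the e_j, j in A, in increasing order. *)
Definition clifford (R : realType) (n : nat) : Type := 'rV[R]_#|{set 'I_n}|.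

HB.instance Definition _ (R : realType) n :=
  NormedModule.copy (clifford R n) 'rV[R]_#|{set 'I_n}|.
HB.instance Definition _ (R : realType) n :=
  Complete.copy (clifford R n) 'rV[R]_#|{set 'I_n}|.
HB.instance Definition _ (R : realType) n :=
  Vector.copy (clifford R n) 'rV[R]_#|{set 'I_n}|.

Definition symdiff n (A B : {set 'I_n}) : {set 'I_n} :=
  [set i | (i \in A) (+) (i \in B)].

(* e_A e_B = cl_sign A B *: e_(A symdiff B): moving the factors of e_B into
   place costs one sign per pair j < i with i in A and j in B, and each common
   index contributes a further sign since e_i ^+ 2 = -1. *)
Definition cl_sign (R : realType) n (A B : {set 'I_n}) : R :=
  (-1) ^+ (\sum_(i in A) \sum_(j in B) (j <= i))%N.

Section CliffordRing.
Variables (R : realType) (n : nat).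
Implicit Types (a b c : clifford R n) (A B C : {set 'I_n}).

Definition cl_coef a A : R := a ord0 (enum_rank A).

Definition blade A : clifford R n := delta_mx ord0 (enum_rank A).

Definition cl_mul a b : clifford R n :=
  \sum_A \sum_B
    (cl_coef a A * cl_coef b B * cl_sign R A B) *: blade (symdiff A B).

Lemma symdiffA : associative (@symdiff n).
Proof. by move=> A B C; apply/setP => i; rewrite !inE addbA. Qed.

Lemma symdiffC : commutative (@symdiff n).
Proof. by move=> A B; apply/setP => i; rewrite !inE addbC. Qed.

Lemma symdiffK A : involutive (symdiff A).
Proof. by move=> B; apply/setP => i; rewrite !inE addKb. Qed.

Lemma symdiff0 : left_id finset.set0 (@symdiff n).
Proof. by move=> A; apply/setP => i; rewrite !inE. Qed.

Lemma cl_signE A B : cl_sign R A B =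
  \prod_i \prod_j (-1) ^+ ((i \in A) && (j \in B) && (j <= i)%N).
Proof.
rewrite /cl_sign big_mkcond expr_sum; apply: eq_bigr => i _.
case: (i \in A) => /=; last by rewrite big1.
rewrite big_mkcond expr_sum; apply: eq_bigr => j _.
by case: (j \in B).
Qed.

Lemma cl_signDl A A' B :
  cl_sign R (symdiff A A') B = cl_sign R A B * cl_sign R A' B.
Proof.
rewrite !cl_signE -big_split; apply: eq_bigr => i _ /=.
rewrite -big_split; apply: eq_bigr => j _ /=; rewrite !inE.
by case: (i \in A); case: (i \in A'); case: (j \in B); case: (j <= i)%N;
  rewrite /= ?expr1 ?expr0 ?mulrNN ?mulr1 ?mul1r.
Qed.

Lemma cl_signDr A B B' :
  cl_sign R A (symdiff B B') = cl_sign R A B * cl_sign R A B'.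
Proof.
rewrite !cl_signE -big_split; apply: eq_bigr => i _ /=.
rewrite -big_split; apply: eq_bigr => j _ /=; rewrite !inE.
by case: (i \in A); case: (j \in B); case: (j \in B'); case: (j <= i)%N;
  rewrite /= ?expr1 ?expr0 ?mulrNN ?mulr1 ?mul1r.
Qed.

Lemma cl_sign_sqr A B : cl_sign R A B * cl_sign R A B = 1.
Proof. by rewrite -expr2 /cl_sign sqrr_sign. Qed.

Lemma cl_sign0l B : cl_sign R finset.set0 B = 1.
Proof. by rewrite /cl_sign big_set0. Qed.

Lemma cl_sign0r A : cl_sign R A finset.set0 = 1.
Proof. by rewrite /cl_sign big1 // => i _; rewrite big_set0. Qed.

Lemma clP a b : (forall A, cl_coef a A = cl_coef b A) -> a = b.
Proof.
move=> ab; apply/rowP => k; have := ab (enum_val k).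
by rewrite /cl_coef enum_valK.
Qed.

Lemma cl_coefD a b A : cl_coef (a + b) A = cl_coef a A + cl_coef b A.
Proof. by rewrite /cl_coef mxE. Qed.

Lemma cl_coefZ k a A : cl_coef (k *: a) A = k * cl_coef a A.
Proof. by rewrite /cl_coef mxE. Qed.

Lemma cl_coef_blade A B : cl_coef (blade A) B = (A == B)%:R.
Proof.
by rewrite /cl_coef mxE eqxx (inj_eq enum_rank_inj) eq_sym.
Qed.

Lemma cl_coef_mul a b C : cl_coef (cl_mul a b) C =
  \sum_A cl_coef a A * cl_coef b (symdiff A C) * cl_sign R A (symdiff A C).
Proof.
rewrite {1}/cl_coef summxE; apply: eq_bigr => A _; rewrite summxE.
rewrite (bigD1 (symdiff A C)) //= big1 ?addr0 => [|B nB].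
  by rewrite mxE -/(cl_coef _ _) cl_coef_blade symdiffK eqxx mulr1.
rewrite mxE -/(cl_coef _ _) cl_coef_blade.
case: eqP => [E|_]; last by rewrite mulr0.
by rewrite -E symdiffK eqxx in nB.
Qed.

Lemma cl_mulA : associative cl_mul.
Proof.
move=> a b c; apply: clP => D; rewrite !cl_coef_mul.
transitivity (\sum_A \sum_B cl_coef a A * cl_coef b B *
   cl_coef c (symdiff B (symdiff A D)) *
   (cl_sign R A (symdiff A D) * cl_sign R B (symdiff B (symdiff A D)))).
  apply: eq_bigr => A _; rewrite cl_coef_mul mulr_sumr mulr_suml.
  by apply: eq_bigr => B _; ring.
rewrite exchange_big [RHS](eq_bigr (fun C => \sum_A cl_coef a A *
   cl_coef b (symdiff A C) * cl_coef c (symdiff C D) *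
   (cl_sign R A (symdiff A C) * cl_sign R C (symdiff C D)))); last first.
  move=> C _; rewrite cl_coef_mul mulr_suml mulr_suml.
  by apply: eq_bigr => A _; ring.
rewrite [RHS]exchange_big exchange_big /=; apply: eq_bigr => A _.
rewrite (reindex_inj (inv_inj (symdiffK A))) /=; apply: eq_bigr => C _.
have -> : symdiff (symdiff A C) (symdiff A D) = symdiff C D.
  by apply/setP => i; rewrite !inE; case: (i \in A); case: (i \in C);
     case: (i \in D).
congr (_ * _); rewrite !cl_signDr !cl_signDl.
rewrite -[RHS]mul1r -(cl_sign_sqr A D); ring.
Qed.

Lemma cl_mul1 : left_id (blade finset.set0) cl_mul.
Proof.
move=> a; apply: clP => C; rewrite cl_coef_mul (bigD1 finset.set0) //= big1.
  by rewrite cl_coef_blade eqxx symdiff0 cl_sign0l mulr1 mul1r addr0.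
by move=> A nA; rewrite cl_coef_blade eq_sym (negbTE nA) !mul0r.
Qed.

Lemma cl_mulr1 : right_id (blade finset.set0) cl_mul.
Proof.
move=> a; apply: clP => C; rewrite cl_coef_mul (bigD1 C) //= big1.
  have -> : symdiff C C = finset.set0.
    by apply/setP => i; rewrite !inE addbb.
  by rewrite cl_coef_blade eqxx cl_sign0r !mulr1 addr0.
move=> A nA; rewrite cl_coef_blade; case: eqP => [E|]; last first.
  by rewrite mulr0 mul0r.
by rewrite -(symdiffK A C) -E symdiffC symdiff0 eqxx in nA.
Qed.

Lemma cl_mulDl : left_distributive cl_mul +%R.
Proof.
move=> a b c; apply: clP => C; rewrite cl_coefD !cl_coef_mul -big_split /=.
by apply: eq_bigr => A _; rewrite cl_coefD !mulrDl.
Qed.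

Lemma cl_mulDr : right_distributive cl_mul +%R.
Proof.
move=> a b c; apply: clP => C; rewrite cl_coefD !cl_coef_mul -big_split /=.
by apply: eq_bigr => A _; rewrite cl_coefD !(mulrDl, mulrDr).
Qed.

Lemma cl_one_neq0 : blade finset.set0 != 0.
Proof.
apply/eqP => /(congr1 (cl_coef ^~ finset.set0)) /eqP.
by rewrite cl_coef_blade eqxx /cl_coef mxE oner_eq0.
Qed.

HB.instance Definition _ := GRing.Zmodule_isNzRing.Build (clifford R n)
  cl_mulA cl_mul1 cl_mulr1 cl_mulDl cl_mulDr cl_one_neq0.

Lemma cl_scaleAl (k : R) a b : k *: (a * b) = k *: a * b.
Proof.
apply: clP => C; rewrite cl_coefZ !cl_coef_mul mulr_sumr.
by apply: eq_bigr => A _; rewrite cl_coefZ !mulrA.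
Qed.

Lemma cl_scaleAr (k : R) a b : k *: (a * b) = a * (k *: b).
Proof.
apply: clP => C; rewrite cl_coefZ !cl_coef_mul mulr_sumr.
by apply: eq_bigr => A _; rewrite cl_coefZ; ring.
Qed.

HB.instance Definition _ :=
  GRing.Lmodule_isLalgebra.Build R (clifford R n) cl_scaleAl.
HB.instance Definition _ :=
  GRing.Lalgebra_isAlgebra.Build R (clifford R n) cl_scaleAr.
(* The algebra being finite-dimensional, this makes [a^-1] the two-sided inverse
   of an invertible element a. *)
HB.instance Definition _ := Algebra_isFalgebra.Build R (clifford R n).

Definition cl_gen (j : 'I_n) : clifford R n := blade [set j].

Lemma bladeM A B :
  blade A * blade B = cl_sign R A B *: blade (symdiff A B).
Proof.
apply: clP => C; rewrite cl_coefZ cl_coef_mul (bigD1 A) //= big1 => [|D nD].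
  rewrite !cl_coef_blade eqxx mul1r addr0.
  have -> : (B == symdiff A C) = (symdiff A B == C).
    by apply/eqP/eqP => [->|<-]; rewrite symdiffK.
  by case: eqP => [<-|]; rewrite ?symdiffK ?mul0r ?mulr0 // mulrC.
by rewrite cl_coef_blade eq_sym (negbTE nD) !mul0r.
Qed.

Lemma cl_gen_sqr j : cl_gen j * cl_gen j = -1.
Proof.
rewrite bladeM.
have -> : symdiff [set j] [set j] = finset.set0 :> {set 'I_n}.
  by apply/setP => i; rewrite !inE addbb.
by rewrite /cl_sign !big_set1 leqnn expr1 scaleN1r.
Qed.

Lemma cl_gen_anticomm i j :
  i != j -> cl_gen i * cl_gen j = - (cl_gen j * cl_gen i).
Proof.
move=> ij; rewrite !bladeM symdiffC -scaleNr; congr (_ *: _).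
rewrite /cl_sign !big_set1.
by case: (ltngtP i j) => [||/val_inj E]; rewrite ?expr0 ?expr1 ?opprK //;
  rewrite E eqxx in ij.
Qed.

End CliffordRing.

(** * Paravectors *)

Section Paravectors.
Variables (R : realType) (n : nat).
Implicit Types x : 'rV[R]_n.+1.

(* e_0 = 1 and e_1, ..., e_n are the generators. *)
Definition cl_e (i : 'I_n.+1) : clifford R n :=
  if unlift ord0 i is Some j then cl_gen R j else 1.

Definition paravector x : clifford R n := \sum_i x ord0 i *: cl_e i.

(* The norm provided by the library on row vectors is the sup norm. *)
Definition sqnorm x : R := \sum_i x ord0 i ^+ 2.

Definition para_conj x : 'rV[R]_n.+1 :=
  \row_i if i == ord0 then x ord0 i else - x ord0 i.

Definition euclid_ball (a : 'rV[R]_n.+1) (r : R) : set 'rV[R]_n.+1 :=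
  [set x | Num.sqrt (sqnorm (x - a)) < r].

Lemma cl_e0 : cl_e ord0 = 1.
Proof. by rewrite /cl_e unlift_none. Qed.

Lemma cl_eS j : cl_e (lift ord0 j) = cl_gen R j.
Proof. by rewrite /cl_e liftK. Qed.

Lemma vector_sqr (v : 'I_n -> R) :
  (\sum_j v j *: cl_gen R j) * (\sum_j v j *: cl_gen R j) =
  - (\sum_j v j ^+ 2)%:A.
Proof.
set g := @cl_gen R n; set w := \sum_j _.
have E : w * w = \sum_i \sum_j (v i * v j) *: (g i * g j).
  rewrite /w mulr_suml; apply: eq_bigr => i _; rewrite mulr_sumr.
  by apply: eq_bigr => j _; rewrite -scalerAl -scalerAr scalerA.
have E2 : 2%:R *: (w * w) = 2%:R *: - (\sum_j v j ^+ 2)%:A.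
  rewrite scaler_nat mulr2n {1}E E [X in X + _]exchange_big -big_split /=.
  rewrite scaler_suml -sumrN scaler_sumr; apply: eq_bigr => i _.
  rewrite -big_split (bigD1 i) //= big1 => [|j ji].
    rewrite cl_gen_sqr addr0 -expr2 scalerN -mulr2n.
    by rewrite -scaler_nat.
  by rewrite (cl_gen_anticomm R ji) scalerN (mulrC (v j)) ?addNr ?subrr.
by apply: (@scalerI _ _ (2%:R : R)) => //; rewrite lreg_ne0 // pnatr_eq0.
Qed.

Lemma paravectorV x : x != 0 ->
  (paravector x)^-1 = (sqnorm x)^-1 *: paravector (para_conj x).
Proof.
move=> x0; set w := \sum_j x ord0 (lift ord0 j) *: cl_gen R j.
set c : clifford R n := (x ord0 ord0)%:A.
have Ex : paravector x = c + w.
  rewrite /paravector big_ord_recl cl_e0; congr (_ + _).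
  by apply: eq_bigr => j _; rewrite cl_eS.
have Ec : paravector (para_conj x) = c - w.
  rewrite /paravector big_ord_recl cl_e0 mxE eqxx -sumrN; congr (_ + _).
  by apply: eq_bigr => j _; rewrite mxE cl_eS scaleNr.
have cw : c * w = w * c by rewrite -scalerAl -scalerAr mul1r mulr1.
have En : c * c - w * w = (sqnorm x)%:A.
  rewrite vector_sqr opprK /sqnorm big_ord_recl scalerDl; congr (_ + _).
  by rewrite -scalerAl mul1r scalerA expr2.
have s0 : sqnorm x != 0.
  apply: contra_neq x0 => /eqP; rewrite psumr_eq0 => [/allP s0|i _]; last first.
    exact: sqr_ge0.
  apply/rowP => i; rewrite mxE; apply/eqP; rewrite -sqrf_eq0.
  exact: (s0 i (mem_index_enum i)).
have sA : (sqnorm x)^-1 *: (sqnorm x)%:A = 1 :> clifford R n.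
  by rewrite scalerA mulVf // scale1r.
have l1 : (sqnorm x)^-1 *: paravector (para_conj x) * paravector x = 1.
  rewrite -scalerAl Ex Ec mulrBl !mulrDr cw opprD addrA addrK.
  by rewrite En sA.
have r1 : paravector x * ((sqnorm x)^-1 *: paravector (para_conj x)) = 1.
  rewrite -scalerAr Ex Ec mulrDl !mulrBr cw addrA subrK.
  by rewrite En sA.
have ux : paravector x \is a GRing.unit.
  by apply/unitrP; exists ((sqnorm x)^-1 *: paravector (para_conj x)).
by rewrite -[RHS]mulr1 -(divrr ux) mulrA l1 mul1r.
Qed.

End Paravectors.

(** * Holomorphic Cliffordian functions *)

Section HolomorphicCliffordian.
Variables (R : realType) (n : nat).
Local Notation pt := 'rV[R]_n.+1.
Implicit Types (f : pt -> clifford R n) (Om : set pt).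

Definition partial (i : 'I_n.+1) f : pt -> clifford R n :=
  fun x => 'D_(delta_mx ord0 i : pt) f x.

Definition dirac_op f : pt -> clifford R n :=
  fun x => \sum_i cl_e R i * partial i f x.

Definition laplacian f : pt -> clifford R n :=
  fun x => \sum_i partial i (partial i f) x.

(* f is of class C^k on Om; only the values of f on the open set Om matter. *)
Fixpoint class_C (k : nat) Om f : Prop :=
  (forall x, Om x -> {for x, continuous f}) /\
  (if k is k'.+1 then
     forall i, (forall x, Om x -> derivable f x (delta_mx ord0 i : pt)) /\
               class_C k' Om (partial i f)
   else True).

End HolomorphicCliffordian.

(* S + V in R_{0,2m+1} is identified with R^{2m+2}, as rows; Om is meant to be
   open. *)
Definition holomorphic_cliffordian (R : realType) (m : nat)
    (Om : set 'rV[R]_m.*2.+2) (f : 'rV[R]_m.*2.+2 -> clifford R m.*2.+1) :=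
  class_C m.*2.+1 Om f /\
  (forall x, Om x -> dirac_op (iter m (@laplacian R m.*2.+1) f) x = 0).

(** * The functions P_alpha and S_beta *)

Definition multiindex n := {ffun 'I_n.+1 -> nat}.

Section Words.
Variables (R : realType) (n : nat).
Implicit Types (x : 'rV[R]_n.+1) (al : multiindex n) (s : seq 'I_n.+1).

Definition mi_deg al : nat := (\sum_i al i)%N.

(* e_{i_1} x e_{i_2} x ... x e_{i_k}; the value at the empty word, which only
   occurs for the unused P_0, is irrelevant. *)
Definition P_word x s : clifford R n :=
  if s is i :: s' then cl_e R i * \prod_(j <- s') (paravector x * cl_e R j)
  else 0.

(* x^-1 e_{i_1} x^-1 e_{i_2} ... x^-1 e_{i_k} x^-1 *)
Definition S_word x s : clifford R n :=
  (paravector x)^-1 * \prod_(j <- s) (cl_e R j * (paravector x)^-1).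

Definition has_multitype al s : bool := [forall j, count_mem j s == al j].

Definition P_ al x : clifford R n :=
  \sum_(s : (mi_deg al).-tuple 'I_n.+1 | has_multitype al s) P_word x s.

Definition S_ al x : clifford R n :=
  \sum_(s : (mi_deg al).-tuple 'I_n.+1 | has_multitype al s) S_word x s.

(* The sum of F over the multi-indices of degree k, the entries of which are
   all at most k. *)
Definition sum_deg (k : nat) (F : multiindex n -> clifford R n) :
    clifford R n :=
  \sum_(g : {ffun 'I_n.+1 -> 'I_k.+1} | mi_deg [ffun i => val (g i)] == k)
    F [ffun i => val (g i)].

End Words.

(* Main.v *)
Require Import Defs.
From mathcomp Require Import all_boot all_order all_algebra.
From mathcomp Require Import all_classical all_reals all_analysis.
From mathcomp Require Import ring lra zify.
Import Order.TTheory GRing.Theory Num.Theory.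
Import numFieldNormedType.Exports.

Set Implicit Arguments.
Unset Strict Implicit.
Unset Printing Implicit Defensive.

Local Open Scope classical_set_scope.
Local Open Scope ring_scope.

(** In dimension 2m+2 the fundamental solution of [D Delta^m] is a multiple of
    [z^-1 = conj z / |z|^2].  Regularize it to [conj z / (|z|^2 + e)]: moving
    [D Delta^m] onto it by parts gives a constant times the bubble
    [e^(m+1) / (|z|^2 + e)^(2m+2)], an approximate identity.  Hence a compactly
    supported [u] of class C^(2m+1) satisfies, up to a nonzero factor,
    [u x = int (x - y)^-1 (D Delta^m u) y dy] wherever [D Delta^m u] vanishes near [x].

    Apply this to the difference of two radial truncations of [f], equal to [f]
    around [x] and to 0 near the singularity and near the sphere.  Then
    [D Delta^m u] lives in two shells, outside and inside [|x|], where [(x - y)^-1]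
    is expanded in geometric series whose terms are sums of [P_al x] and [S_be x]
    with monomials in [y^-1] and in [y].  The coefficients do not depend on the
    chosen shells: the integrals against the difference of two shells are the
    coefficients of a power series that vanishes near 0.

    Integrals are limits of Riemann sums along an ultrafilter on the mesh; only
    linearity, positivity, translation and a volume bound are needed. *)

(** Regularizing makes the kernel smooth everywhere, so the operator is moved onto it by integrating
    compactly supported functions over a cube: no ball is excised and no boundary term arises. The
    first step differentiates the kernel from the right; since [conj e_i e_i = 1] and
    [conj z z = |z|^2], its result is scalar, and noncommutativity is gone before the Laplacians
    act.

    The Laplacian sends [(|z|^2 + e)^-j] to a combination of the powers [j+1] and [j+2]. In
    dimension 2m+2 the coefficient of the former carries the factor [j - m], which is why m
    Laplacians leave a single bubble.

    The mass of the bubble is never evaluated. The same identity, applied to a cutoff that is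
    constant near the pole, shows that the mass converges at rate O(e), and a crude lower bound
    shows that the limit is nonzero.

    The singular kernel is integrated only against functions vanishing near its pole, so no improper
    integral occurs. *)

Section Bounded.
Variables (R : realType) (T : Type).

Definition bounded_on (V : normedModType R) (g : T -> V) : Prop :=
  exists B, forall y, `|g y| <= B.

Lemma bounded_onD (V : normedModType R) (g h : T -> V) :
  bounded_on g -> bounded_on h -> bounded_on (fun y => g y + h y).
Proof.
move=> [B gB] [C hC]; exists (B + C) => y.
by rewrite (le_trans (ler_normD _ _))// lerD.
Qed.

Lemma bounded_onN (V : normedModType R) (g : T -> V) :
  bounded_on g -> bounded_on (fun y => - g y).
Proof. by move=> [B gB]; exists B => y; rewrite normrN. Qed.

Lemma bounded_onB (V : normedModType R) (g h : T -> V) :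
  bounded_on g -> bounded_on h -> bounded_on (fun y => g y - h y).
Proof. by move=> gb hb; apply: bounded_onD => //; exact: bounded_onN. Qed.

Lemma bounded_on_scale (V : normedModType R) (k : T -> R) (g : T -> V) :
  bounded_on k -> bounded_on g -> bounded_on (fun y => k y *: g y).
Proof.
move=> [B kB] [C gC]; exists (B * C) => y.
by rewrite normrZ ler_pM.
Qed.

Lemma bounded_on_cst (V : normedModType R) (v : V) :
  bounded_on (fun _ => v).
Proof. by exists `|v|. Qed.

Lemma bounded_on_sum (V : normedModType R) (I : Type) (s : seq I)
    (P : pred I) (g : I -> T -> V) :
  (forall i, P i -> bounded_on (g i)) ->
  bounded_on (fun y => \sum_(i <- s | P i) g i y).
Proof.
move=> gb; elim: s => [|i s IH].
  by exists 0 => y; rewrite big_nil normr0.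
case Pi: (P i); last first.
  by case: IH => B HB; exists B => y; rewrite big_cons Pi.
have [B HB] := bounded_onD (gb i Pi) IH; exists B => y.
by rewrite big_cons Pi.
Qed.

End Bounded.

Lemma norm_rV_coord (R : realType) m (v : 'rV[R]_m) k : `|v ord0 k| <= `|v|.
Proof.
rewrite [leRHS]/Num.Def.normr/= mx_normrE.
exact: (le_bigmax _ (fun ij : 'I_1 * 'I_m => `|v ij.1 ij.2|) (ord0, k)).
Qed.

Lemma norm_rV_le (R : realType) m (v : 'rV[R]_m) B :
  0 <= B -> (forall j, `|v ord0 j| <= B) -> `|v| <= B.
Proof.
move=> B0 vB; rewrite [leLHS]/Num.Def.normr/= mx_normrE.
by apply/bigmax_leP; split => // -[i j] _ /=; rewrite ord1.
Qed.

(** * Riemann sums along an ultrafilter *)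

Section BoxSums.
Variables (R : realType) (n : nat) (L : R).
Local Notation pt := 'rV[R]_n.+1.
Implicit Types (g h : pt -> R).

Definition mesh (M : nat) : R := 2 * L / M.+1%:R.

Definition grid_pt M (k : {ffun 'I_n.+1 -> 'I_M.+1}) : pt :=
  \row_j (- L + mesh M * (k j)%:R).

Definition box_sum g (M : nat) : R :=
  mesh M ^+ n.+1 * \sum_(k : {ffun 'I_n.+1 -> 'I_M.+1}) g (grid_pt k).

(* A limit of [box_sum g] exists along an ultrafilter for every bounded [g];
   this spares a proof that the sums converge. *)
Definition mesh_filter : set_system nat :=
  projT1 (cid (ultraFilterLemma (@eventually_filter : ProperFilter \oo))).

Lemma mesh_filterP : UltraFilter mesh_filter /\ \oo `<=` mesh_filter.
Proof. by rewrite /mesh_filter; case: cid. Qed.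

Lemma mesh_filter_ultra : UltraFilter mesh_filter.
Proof. by case: mesh_filterP. Qed.
#[local] Existing Instance mesh_filter_ultra.

Definition box_int g : R := lim (box_sum g @ mesh_filter).

Hypothesis L_gt0 : 0 < L.

Lemma mesh_gt0 M : 0 < mesh M.
Proof. by rewrite divr_gt0 ?mulr_gt0. Qed.

Lemma mesh_volume M : mesh M ^+ n.+1 * (#|{ffun 'I_n.+1 -> 'I_M.+1}|)%:R =
  (2 * L) ^+ n.+1.
Proof.
by rewrite card_ffun !card_ord natrX -exprMn /mesh mulfVK.
Qed.

Lemma box_sum_le g B M : (forall y, `|g y| <= B) ->
  `|box_sum g M| <= (2 * L) ^+ n.+1 * B.
Proof.
move=> gB; rewrite normrM -(mesh_volume M) -mulrA ger0_norm ?exprn_ge0 ?(ltW (mesh_gt0 _))//.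
rewrite ler_pM2l ?exprn_gt0 ?mesh_gt0//.
rewrite (le_trans (ler_norm_sum _ _ _))//.
rewrite (le_trans (ler_sum _ (fun k _ => gB (grid_pt k))))//.
by rewrite sumr_const mulr_natl.
Qed.

(** The sums of a bounded function stay in a segment. The image of an ultrafilter is an ultrafilter,
    and on a compact set it converges. *)
Lemma box_int_cvg g : bounded_on g -> box_sum g @ mesh_filter --> box_int g.
Proof.
move=> [B gB]; set C := (2 * L) ^+ n.+1 * B.
have := @segment_compact R (- C) C; rewrite compact_ultra.
move=> /(_ (box_sum g @ mesh_filter)) [].
- have [PF maxF] := mesh_filter_ultra.
  split; first exact: fmap_proper_filter.
  move=> G PG sG; apply/seteqP; split => // A GA; rewrite /fmap /=.
  have [//|nA] := in_ultra_setVsetC (box_sum g @^-1` A) mesh_filter_ultra.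
  have /sG GnA : (box_sum g @ mesh_filter) (~` A) by [].
  by have /filter_ex [? []] : G (A `&` ~` A) by exact: filterI.
- rewrite /fmap /=; apply: filterE => M /=.
  by rewrite in_itv /= -ler_norml; exact: box_sum_le.
- move=> l [_ /= cl]; rewrite /box_int.
  by apply: cvgP cl.
Qed.

Lemma box_int_near g (l : R) : bounded_on g ->
  (forall e, 0 < e -> \forall M \near \oo, `|box_sum g M - l| <= e) ->
  box_int g = l.
Proof.
move=> gb gl; have cg := box_int_cvg gb.
have cl : box_sum g @ mesh_filter --> l.
  apply/cvgrPdist_le => e e0; apply: (mesh_filterP.2).
  by apply: filterS (gl e e0) => M; rewrite distrC.
exact: cvg_unique cg cl.
Qed.

Lemma box_intD g h : bounded_on g -> bounded_on h ->
  box_int (fun y => g y + h y) = box_int g + box_int h.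
Proof.
move=> gb hb; apply: (cvg_unique _ (box_int_cvg (bounded_onD gb hb))) => //.
rewrite (_ : box_sum _ = fun M => box_sum g M + box_sum h M).
  by apply: cvgD; exact: box_int_cvg.
by apply/funext => M; rewrite /box_sum big_split mulrDr.
Qed.

Lemma bounded_onZ (k : R) g : bounded_on g -> bounded_on (fun y => k * g y).
Proof.
by move=> [B gB]; exists (`|k| * B) => y; rewrite normrM ler_wpM2l.
Qed.

Lemma box_intZ (k : R) g : bounded_on g ->
  box_int (fun y => k * g y) = k * box_int g.
Proof.
move=> gb; apply: (cvg_unique _ (box_int_cvg (bounded_onZ k gb))) => //.
rewrite (_ : box_sum _ = fun M => k * box_sum g M).
  by apply: cvgMr; exact: box_int_cvg.
by apply/funext => M; rewrite /box_sum -mulr_sumr mulrCA.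
Qed.

Lemma box_intB g h : bounded_on g -> bounded_on h ->
  box_int (fun y => g y - h y) = box_int g - box_int h.
Proof.
move=> gb hb.
rewrite (_ : (fun y => _) = (fun y => g y + (-1) * h y)); last first.
  by apply/funext => y; rewrite mulN1r.
by rewrite box_intD ?box_intZ ?mulN1r//; exact: bounded_onZ.
Qed.

Lemma le_box_int g h : bounded_on g -> bounded_on h ->
  (forall y, g y <= h y) -> box_int g <= box_int h.
Proof.
move=> gb hb gh; apply: ler_cvg_to (box_int_cvg gb) (box_int_cvg hb) _.
apply: filterE => M; rewrite ler_pM2l ?exprn_gt0 ?mesh_gt0//.
exact: ler_sum.
Qed.

Lemma box_int_cst c : box_int (fun _ => c) = (2 * L) ^+ n.+1 * c.
Proof.
apply: box_int_near; first exact: bounded_on_cst.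
move=> e e0; apply: filterE => M.
by rewrite /box_sum sumr_const -[c *+ _]mulr_natl mulrA mesh_volume subrr normr0 ltW.
Qed.

Lemma norm_box_int_le g h : (forall y, `|g y| <= h y) -> bounded_on h ->
  `|box_int g| <= box_int h.
Proof.
move=> gh hb; have gb : bounded_on g.
  by case: hb => B hB; exists B => y; rewrite (le_trans (gh y))// (le_trans (ler_norm _)).
rewrite ler_norml -mulN1r -box_intZ//; apply/andP; split; apply: le_box_int => //.
- exact: bounded_onZ.
- by move=> y; rewrite mulN1r; have := gh y; rewrite ler_norml => /andP[].
- by move=> y; have := gh y; rewrite ler_norml => /andP[].
Qed.

Definition supp_in (V : zmodType) (l : R) (g : pt -> V) : Prop :=
  forall y, l <= `|y| -> g y = 0.

Lemma compact_norm_le l : compact [set y : pt | `|y| <= l].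
Proof.
apply: bounded_closed_compact.
  exists l; split; first exact: num_real.
  by move=> B lB y /= /le_trans; apply; exact: ltW.
apply: (@closed_comp _ _ (fun y : pt => `|y|) [set t | t <= l]).
  by move=> y _; exact: norm_continuous.
exact: closed_le.
Qed.

Lemma supp_in_bounded (V : normedModType R) l (g : pt -> V) :
  continuous g -> supp_in l g -> bounded_on g.
Proof.
move=> cg sg; have := @continuous_compact _ _ g _ _ (@compact_norm_le l).
move=> /(_ (continuous_subspaceT cg)) /compact_bounded [B [_ gB]].
exists (Num.max 0 (B + 1)) => y; rewrite le_max.
have [ly|yl] := lerP l `|y|; first by rewrite sg ?normr0 ?lexx.
by rewrite (gB (B + 1)) ?ltrDl ?orbT//; exists y => //=; exact: ltW.
Qed.

(** Compactness is used on the ball of radius [l + 1]: if [x] lies outside it and [y] is within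
    distance 1 of [x], both are beyond [l], where [g] vanishes. *)
Lemma supp_in_unif (V : normedModType R) l (g : pt -> V) :
  continuous g -> supp_in l g -> forall e, 0 < e ->
  exists2 d, 0 < d & forall x y, `|x - y| < d -> `|g x - g y| <= e.
Proof.
move=> cg sg e e0.
have /compact_near_coveringP := @compact_norm_le (l + 1).
move=> /(_ R 0^'+ (fun d x => forall y, `|x - y| < d -> `|g x - g y| <= e)).
move=> /(_ _) [].
- move=> x _.
  have /cvgrPdist_lt /(_ (e / 2)) := cg x.
  rewrite divr_gt0// => /(_ isT) /nbhs_normP [r /= r0 gr].
  exists (ball x (r / 2), [set d | d < r / 2]); first split => /=.
  + by apply: nbhsx_ballx; rewrite divr_gt0.
  + by apply: nbhs_right_lt; rewrite divr_gt0.
  + move=> [x' d] [/=]; rewrite -ball_normE /= => xx' dr y x'y.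
    rewrite (splitr e) -(subrKA (g x)) (le_trans (ler_normD _ _))// lerD//.
      rewrite distrC ltW//; apply: gr; rewrite /=; apply: lt_trans xx' _.
      by rewrite ltr_pdivrMr// ltr_pMr// ltr1n.
    rewrite ltW//; apply: gr; rewrite /= (splitr r) -(subrKA x').
    by rewrite (le_lt_trans (ler_normD _ _))// ltrD// (lt_trans x'y).
- move=> d0 /= d00 gd; exists (Num.min (d0 / 2) 1).
    by rewrite lt_min ltr01 divr_gt0.
  move=> x y; rewrite lt_min => /andP[xyd xy1].
  have [xl|lx] := lerP `|x| (l + 1).
    apply: (gd (d0 / 2)) => //=; last by rewrite divr_gt0.
    rewrite sub0r normrN gtr0_norm ?divr_gt0//.
    by rewrite ltr_pdivrMr// ltr_pMr// ltr1n.
  rewrite !sg ?subrr ?normr0 ?(ltW e0)//.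
    rewrite -(lerD2r 1) (le_trans (ltW lx))//.
    rewrite -lerBlDl (le_trans (lerB_dist _ _))// ltW//.
  by rewrite (le_trans _ (ltW lx))// lerDl.
Qed.

(** Addition in ['I_M.+1] is cyclic, so shifting the indices by [q] permutes the grid. It agrees
    with the translation of points except where an index wraps around. *)
Lemma box_sum_shift l g M (q : {ffun 'I_n.+1 -> 'I_M.+1}) :
  supp_in l g -> (forall j, mesh M * (q j)%:R <= L - l) ->
  box_sum (fun y => g (y + \row_j (mesh M * (q j)%:R))) M = box_sum g M.
Proof.
move=> sg ql; congr (_ * _).
pose sh (k : {ffun 'I_n.+1 -> 'I_M.+1}) := [ffun j => k j + q j].
have shI : injective sh.
  move=> k k' /ffunP E; apply/ffunP => j; have := E j.
  by rewrite !ffunE => /addIr.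
rewrite [RHS](reindex_inj shI) /=; apply: eq_bigr => k _.
have mM : mesh M * M.+1%:R = 2 * L by rewrite mulfVK.
have mp := mesh_gt0 M.
have [/forallP kq|/forallPn [j]] := boolP [forall j, (k j + q j < M.+1)%N].
  congr g; apply/rowP => j; rewrite !mxE ffunE /= modn_small//.
  by rewrite natrD mulrDr addrA.
(* On a wrap-around the translated point has a coordinate at least [L] and the wrapped one a
   coordinate at most [- l], so [g] vanishes at both. *)
rewrite -leqNgt => kq; rewrite !sg//.
- rewrite (le_trans _ (norm_rV_coord _ j))// !mxE ffunE /=.
  have -> : ((k j + q j) %% M.+1)%N = (k j + q j - M.+1)%N.
    rewrite -{1}(subnK kq) modnDr modn_small//.
    by have := ltn_ord (k j); have := ltn_ord (q j); lia.
  rewrite natrB// natrD; have := ql j.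
  have : mesh M * (k j)%:R <= mesh M * M.+1%:R.
    by rewrite ler_pM2l// ler_nat ltnW.
  rewrite mM => kL qL; rewrite ler_normr mulrBr mulrDr mM.
  by apply/orP; right; lra.
- rewrite (le_trans _ (norm_rV_coord _ j))// !mxE.
  have : mesh M * M.+1%:R <= mesh M * (k j + q j)%:R by rewrite ler_pM2l// ler_nat.
  rewrite natrD mM => kL; have := ql j => qL.
  have : 0 <= mesh M * (q j)%:R by rewrite mulr_ge0// ltW.
  move=> q0; rewrite ler_normr; apply/orP; left; lra.
Qed.

Lemma box_sumB g h M :
  box_sum (fun y => g y - h y) M = box_sum g M - box_sum h M.
Proof. by rewrite /box_sum sumrB mulrBr. Qed.

Lemma mesh_small e : 0 < e -> \forall M \near \oo, mesh M <= e.
Proof.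
move=> e0; near=> M; rewrite /mesh ler_pdivrMr// -ler_pdivrMl//.
have : 2 * L / e <= M%:R by near: M; exact: nbhs_infty_ger.
by rewrite mulrC => /le_trans; apply; rewrite ler_nat.
Unshelve. all: by end_near. Qed.

(** Round [v] down to a grid vector. Sums are exactly invariant under the latter, and the rest,
    shorter than a mesh, is absorbed by uniform continuity. Coordinates of [v] are nonnegative
    because the grid shifts are indexed by natural numbers. *)
Lemma box_int_translate l g (v : pt) : continuous g -> supp_in l g -> 0 <= l ->
  (forall j, 0 <= v ord0 j <= L - l) ->
  box_int (fun y => g (y + v)) = box_int g.
Proof.
move=> cg sg l0 vl; have gb := supp_in_bounded cg sg.
have gvb : bounded_on (fun y => g (y + v)) by case: gb => B gB; exists B.
apply/eqP; rewrite -subr_eq0 -box_intB//; apply/eqP.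
apply: box_int_near; first exact: bounded_onB.
move=> e e0; pose c := (2 * L) ^+ n.+1.
have c0 : 0 < c by rewrite exprn_gt0// mulr_gt0.
have [d d0 gd] := supp_in_unif cg sg (divr_gt0 e0 c0).
near=> M; have mp := mesh_gt0 M.
pose t j := Num.truncn (v ord0 j / mesh M).
have tv j : mesh M * (t j)%:R <= v ord0 j.
  rewrite mulrC -ler_pdivlMr// truncn_le// divr_ge0// ?(ltW mp)//.
  by case/andP: (vl j).
have vt j : v ord0 j < mesh M * (t j)%:R + mesh M.
  have := truncnS_gt (v ord0 j / mesh M).
  by rewrite ltr_pdivrMr// -natr1 mulrDl mul1r (mulrC _ (mesh M)).
have tM j : (t j < M.+1)%N.
  rewrite -(ltr_nat R) -(ltr_pM2l mp) (le_lt_trans (tv j))//.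
  rewrite mulfVK//; have /andP[_ vj] := vl j; rewrite (le_lt_trans vj)//.
  by move: l0 L_gt0; lra.
pose q : {ffun 'I_n.+1 -> 'I_M.+1} := [ffun j => Ordinal (tM j)].
have qE j : mesh M * (q j)%:R = mesh M * (t j)%:R by rewrite ffunE.
rewrite subr0.
have -> : box_sum (fun y => g (y + v) - g y) M =
    box_sum (fun y => g (y + v) - g (y + \row_j (mesh M * (q j)%:R))) M.
  have E := @box_sum_shift l g M q sg.
  rewrite !box_sumB E//.
  by move=> j; rewrite qE (le_trans (tv j))//; case/andP: (vl j).
have -> : e = c * (e / c) by rewrite mulrCA divff ?mulr1 ?gt_eqF.
apply: box_sum_le => y; apply: gd.
rewrite opprD addrACA subrr add0r.
apply: (@le_lt_trans _ _ (mesh M)).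
  apply: norm_rV_le => [|j]; first exact: ltW.
  rewrite !mxE qE ger0_norm ?subr_ge0// lerBlDl; exact: ltW.
apply: le_lt_trans (_ : d / 2 < d); last by rewrite ltr_pdivrMr// ltr_pMr// ltr1n.
by near: M; apply: mesh_small; rewrite divr_gt0.
Unshelve. all: by end_near. Qed.

Lemma delta_coord (i j : 'I_n.+1) :
  (delta_mx ord0 i : pt) ord0 j = (j == i)%:R.
Proof. by rewrite mxE eqxx. Qed.

Lemma norm_delta (i : 'I_n.+1) : `|delta_mx ord0 i : pt| <= 1.
Proof.
apply: norm_rV_le => // j; rewrite delta_coord.
by case: eqP; rewrite ?normr1 ?normr0.
Qed.

Lemma derive_along (V : normedModType R) (g : pt -> V) (y v : pt) (t : R) :
  derivable g (y + t *: v) v ->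
  is_derive t (1 : R) (fun s => g (y + s *: v)) ('D_v g (y + t *: v)).
Proof.
move=> gd; rewrite /derivable /derive.
have E : (fun h : R => h^-1 *: (((fun s => g (y + s *: v)) \o shift t) (h *: 1) - g (y + t *: v)))
   = (fun h : R => h^-1 *: ((g \o shift (y + t *: v)) (h *: v) - g (y + t *: v))).
  apply/funext => h /=; congr (_ *: (g _ - _)).
  by rewrite scalerDl addrCA -[h *: 1]/(h * 1) mulr1.
by split; rewrite /derivable /derive E.
Qed.

(** The difference quotient whose step is one mesh sums exactly to 0 by shift invariance. By the
    mean value theorem and uniform continuity it is uniformly close to the derivative. *)
Lemma box_int_partial l g (i : 'I_n.+1) : l < L ->
  (forall y, derivable g y (delta_mx ord0 i)) ->
  continuous (fun y => 'D_(delta_mx ord0 i) g y) ->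
  continuous g -> supp_in l g ->
  supp_in l (fun y => 'D_(delta_mx ord0 i) g y) ->
  box_int (fun y => 'D_(delta_mx ord0 i) g y) = 0.
Proof.
move=> lL dg cdg cg sg sdg; set ei : pt := delta_mx ord0 i.
apply: box_int_near; first exact: supp_in_bounded cdg sdg.
move=> e e0; pose c := (2 * L) ^+ n.+1.
have c0 : 0 < c by rewrite exprn_gt0// mulr_gt0.
have [d d0 gd] := supp_in_unif cdg sdg (divr_gt0 e0 c0).
near=> M; have mp := mesh_gt0 M.
have M1 : (1 < M.+1)%N by rewrite ltnS; near: M; exact: nbhs_infty_gt.
pose q : {ffun 'I_n.+1 -> 'I_M.+1} := [ffun j => if j == i then Ordinal M1 else ord0].
have qE : \row_j (mesh M * (q j)%:R) = mesh M *: ei.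
  by apply/rowP => j; rewrite !mxE ffunE eqxx; case: eqP.
have S : box_sum (fun y => g (y + mesh M *: ei)) M = box_sum g M.
  rewrite -qE; apply: (@box_sum_shift l) => // j; rewrite ffunE.
  case: eqP => _ /=; last by rewrite mulr0 subr_ge0 ltW.
  rewrite mulr1; near: M; apply: mesh_small; by rewrite subr_gt0.
rewrite subr0.
have -> : box_sum (fun y => 'D_ei g y) M =
   box_sum (fun y => 'D_ei g y - (mesh M)^-1 * (g (y + mesh M *: ei) - g y)) M.
  rewrite [RHS]/box_sum sumrB -mulr_sumr sumrB.
  move: S; rewrite /box_sum => /(mulfI (lt0r_neq0 (exprn_gt0 _ mp))) ->.
  by rewrite subrr mulr0 subr0.
have -> : e = c * (e / c) by rewrite mulrCA divff ?mulr1 ?gt_eqF.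
apply: box_sum_le => y.
have [||t] := @MVT R (fun s => g (y + s *: ei)) (fun s => 'D_ei g (y + s *: ei)) 0 (mesh M) mp.
- by move=> t _; exact: derive_along.
- apply: continuous_subspaceT => t.
  apply: (@continuous_comp _ _ _ (fun s : R => y + s *: ei) g); last exact: cg.
  by apply: cvgD; [exact: cvg_cst|apply: cvgZl; exact: cvg_id].
rewrite in_itv /= => /andP[t0 tm]; rewrite scale0r addr0 subr0 => ->.
rewrite mulrC mulfK ?gt_eqF//; apply: gd.
rewrite opprD addrA subrr add0r normrN normrZ gtr0_norm//.
apply: (@le_lt_trans _ _ (mesh M)).
  by rewrite -[leRHS]mulr1 ler_pM ?(ltW t0) ?(ltW tm) ?norm_delta.
apply: le_lt_trans (_ : d / 2 < d); last by rewrite ltr_pdivrMr// ltr_pMr// ltr1n.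
by near: M; apply: mesh_small; rewrite divr_gt0.
Unshelve. all: by end_near. Qed.

(** Rounding costs an interval of length [2 * d] less than one mesh, and a mesh is at most [d]. The
    points counted are those of index [t + 1, ..., t + q]. *)
Lemma count_grid_pts M (x d : R) : `|x| + d < L -> 0 < d -> mesh M <= d ->
  d <= mesh M * (#|[pred k : 'I_M.+1 | `|- L + mesh M * k%:R - x| <= d]|)%:R.
Proof.
move=> xL d0 md; have mp := mesh_gt0 M.
have mM : mesh M * M.+1%:R = 2 * L by rewrite mulfVK.
have := xL; rewrite -ltrBrDr ltr_norml => /andP[xl1 xl2].
set t := Num.truncn ((x - d + L) / mesh M).
set q := Num.truncn (2 * d / mesh M).
have tle : mesh M * t%:R <= x - d + L.
  rewrite mulrC -ler_pdivlMr// truncn_le// divr_ge0// ?(ltW mp)//.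
  by move: xl1; lra.
have tlt : x - d + L < mesh M * t%:R + mesh M.
  have := truncnS_gt ((x - d + L) / mesh M).
  by rewrite ltr_pdivrMr// -natr1 mulrDl mul1r (mulrC _ (mesh M)).
have qle : mesh M * q%:R <= 2 * d.
  by rewrite mulrC -ler_pdivlMr// truncn_le// divr_ge0// ?(ltW mp)// mulr_ge0// ltW.
have qlt : 2 * d < mesh M * q%:R + mesh M.
  have := truncnS_gt (2 * d / mesh M).
  by rewrite ltr_pdivrMr// -/q -[q.+1%:R]natr1 (mulrDl q%:R) mul1r (mulrC _ (mesh M)).
have bnd (i : 'I_q) : mesh M * (t + i.+1)%:R <= x + d + L.
  have : mesh M * i.+1%:R <= mesh M * q%:R by rewrite ler_pM2l// ler_nat.
  by rewrite natrD mulrDr; move: tle qle; lra.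
have kM (i : 'I_q) : (t + i.+1 < M.+1)%N.
  rewrite -(ltr_nat R) -(ltr_pM2l mp) mM (le_lt_trans (bnd i))//.
  by move: xl2; lra.
pose f (i : 'I_q) := Ordinal (kM i).
have fI : injective f by move=> i j [] /addnI [] /val_inj.
suff qc : leq q #|[pred k : 'I_M.+1 | `|- L + mesh M * k%:R - x| <= d]|.
  apply: (@le_trans _ _ (mesh M * q%:R)); last by rewrite ler_pM2l// ler_nat.
  by move: qlt md; lra.
rewrite -[leqLHS]card_ord -(fintype.card_image fI); apply: subset_leq_card.
apply/fintype.subsetP => _ /fintype.imageP[i _ ->]; rewrite inE ler_norml /=.
have := bnd i; have : mesh M * 1%:R <= mesh M * i.+1%:R by rewrite ler_pM2l// ler_nat.
rewrite mulr1 natrD mulrDr => i1 i2; apply/andP; split.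
  by move: tlt i1; lra.
by move: i2; lra.
Qed.

(** The grid points of a cube form a product set, so their number is the product of the
    one-dimensional counts. The bound serves to show that the limit mass of the bubbles is nonzero;
    the true volume [(2 * d) ^+ n.+1] is not aimed at. *)
Lemma box_int_lower g (x : pt) (c d : R) : bounded_on g -> (forall y, 0 <= g y) ->
  0 < d -> 0 <= c -> `|x| + d < L -> (forall y, `|y - x| <= d -> c <= g y) ->
  c * d ^+ n.+1 <= box_int g.
Proof.
move=> gb g0 d0 c0 xL gc.
apply: limr_ge; first by apply: cvgP; exact: box_int_cvg.
apply: (mesh_filterP.2); near=> M; have mp := mesh_gt0 M.
have md : mesh M <= d by near: M; exact: mesh_small.
pose F (j : 'I_n.+1) := [pred k : 'I_M.+1 | `|- L + mesh M * k%:R - x ord0 j| <= d].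
pose A := [pred k : {ffun 'I_n.+1 -> 'I_M.+1} | k \in family F].
apply: (@le_trans _ _ (mesh M ^+ n.+1 * \sum_(k in A) c)); last first.
  rewrite ler_pM2l ?exprn_gt0// [leRHS](bigID (fun k => k \in A)) /=.
  rewrite ler_wpDr ?sumr_ge0// ler_sum// => k /familyP kF; apply: gc.
  apply: norm_rV_le => [|j]; first exact: ltW.
  by rewrite !mxE; have := kF j; rewrite inE.
rewrite sumr_const -[c *+ _]mulr_natl mulrCA mulrA mulrC ler_wpM2r//.
rewrite card_family foldrE big_map big_enum /= natr_prod mulrC.
have -> : mesh M ^+ n.+1 = \prod_(j < n.+1) mesh M by rewrite prodr_const card_ord.
have -> : d ^+ n.+1 = \prod_(j < n.+1) d by rewrite prodr_const card_ord.
rewrite -big_split /=; apply: ler_prod => j _; rewrite ltW//=.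
apply: count_grid_pts => //; apply: le_lt_trans xL.
by rewrite lerD2r norm_rV_coord.
Unshelve. all: by end_near. Qed.

End BoxSums.

(** * Norms on the Clifford algebra *)

Section CliffordNorm.
Variables (R : realType) (n : nat).
Implicit Types (a b : clifford R n) (x : 'rV[R]_n.+1).

(** The Euclidean inner product for which the blades are orthonormal; the norm of the normed module
    is the sup norm of the coordinates. *)
Definition cl_dot a b : R := \sum_A cl_coef a A * cl_coef b A.

Definition cl_sqn a : R := cl_dot a a.

Lemma cl_dotC a b : cl_dot a b = cl_dot b a.
Proof. by apply: eq_bigr => A _; rewrite mulrC. Qed.

Lemma cl_dotDl a a' b : cl_dot (a + a') b = cl_dot a b + cl_dot a' b.
Proof.
by rewrite -big_split; apply: eq_bigr => A _; rewrite cl_coefD mulrDl.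
Qed.

Lemma cl_dotZl k a b : cl_dot (k *: a) b = k * cl_dot a b.
Proof. by rewrite mulr_sumr; apply: eq_bigr => A _; rewrite cl_coefZ mulrA. Qed.

Lemma cl_dotNl a b : cl_dot (- a) b = - cl_dot a b.
Proof. by rewrite -scaleN1r cl_dotZl mulN1r. Qed.

Lemma cl_dotNr a b : cl_dot a (- b) = - cl_dot a b.
Proof. by rewrite cl_dotC cl_dotNl cl_dotC. Qed.

Lemma cl_dot_suml (I : finType) (F : I -> clifford R n) b :
  cl_dot (\sum_i F i) b = \sum_i cl_dot (F i) b.
Proof.
elim/big_ind2: _ => [|c s d t <- <-|//]; last by rewrite cl_dotDl.
by rewrite -[0 in LHS](scale0r 0) cl_dotZl mul0r.
Qed.

Lemma cl_dot_sumr (I : finType) (F : I -> clifford R n) a :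
  cl_dot a (\sum_i F i) = \sum_i cl_dot a (F i).
Proof. by rewrite cl_dotC cl_dot_suml; apply: eq_bigr => i _; rewrite cl_dotC. Qed.

Lemma cl_coef_genM j a C : cl_coef (cl_gen R j * a) C =
  cl_coef a (symdiff [set j]%SET C) * cl_sign R [set j]%SET (symdiff [set j]%SET C).
Proof.
rewrite cl_coef_mul (bigD1 [set j]%SET) //= big1 ?addr0 => [|A nA].
  by rewrite cl_coef_blade eqxx mul1r.
by rewrite cl_coef_blade eq_sym (negbTE nA) !mul0r.
Qed.

Lemma cl_dot_gen j a b : cl_dot (cl_gen R j * a) (cl_gen R j * b) = cl_dot a b.
Proof.
rewrite [RHS](reindex_inj (inv_inj (@symdiffK n [set j]%SET))) /=.
apply: eq_bigr => C _; rewrite !cl_coef_genM mulrACA cl_sign_sqr mulr1.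
by [].
Qed.

(** Left multiplication by a generator is an isometry of square -1, hence skew-adjoint. *)
Lemma cl_dot_genN j a b : cl_dot (cl_gen R j * a) b = - cl_dot a (cl_gen R j * b).
Proof.
by rewrite -(cl_dot_gen j) mulrA cl_gen_sqr mulN1r cl_dotNl.
Qed.

Lemma cl_dot_e i a : cl_dot (cl_e R i * a) (cl_e R i * a) = cl_sqn a.
Proof.
by case: (unliftP ord0 i) => [j|] ->; rewrite ?cl_e0 ?mul1r// cl_eS cl_dot_gen.
Qed.

Lemma eq_oppr0 (t : R) : t = - t -> t = 0.
Proof. by move=> E; lra. Qed.

(** In each case skew-adjointness, with anticommutation when both are generators, shows that the
    product equals its own opposite. *)
Lemma cl_dot_e_orth i j a : i != j -> cl_dot (cl_e R i * a) (cl_e R j * a) = 0.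
Proof.
case: (unliftP ord0 i) => [i'|] ->; case: (unliftP ord0 j) => [j'|] ->.
- rewrite (inj_eq lift_inj) !cl_eS => ij; apply: eq_oppr0.
  rewrite [LHS]cl_dot_genN mulrA (cl_gen_anticomm R ij) mulNr cl_dotNr opprK.
  by rewrite -mulrA -[LHS]opprK -cl_dot_genN cl_dotC.
- move=> _; rewrite cl_e0 cl_eS mul1r; apply: eq_oppr0.
  by rewrite [LHS]cl_dot_genN cl_dotC.
- move=> _; rewrite cl_e0 cl_eS mul1r; apply: eq_oppr0.
  by rewrite [LHS]cl_dotC [LHS]cl_dot_genN.
- by rewrite eqxx.
Qed.

(** The [cl_e R i * a] are pairwise orthogonal and as long as [a], so a paravector acts by a
    similarity. Being exact, this gives the geometric series the ratio [|q| / |p|], hence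
    convergence as soon as [|q| < |p|]; a submultiplicative bound with a constant would not. *)
Lemma cl_sqn_paraM x a : cl_sqn (paravector x * a) = sqnorm x * cl_sqn a.
Proof.
rewrite /cl_sqn /paravector mulr_suml cl_dot_suml mulr_suml.
apply: eq_bigr => i _; rewrite cl_dot_sumr (bigD1 i) //= big1 => [|j ji].
  by rewrite addr0 -scalerAl cl_dotZl cl_dotC cl_dotZl mulrA -expr2 cl_dot_e.
rewrite -!scalerAl cl_dotZl cl_dotC cl_dotZl cl_dot_e_orth// ?mulr0//.
Qed.

Lemma cl_sqn_ge0 a : 0 <= cl_sqn a.
Proof. by apply: sumr_ge0 => A _; rewrite -expr2 sqr_ge0. Qed.

Lemma cl_normE_le a B : 0 <= B -> (forall A, `|cl_coef a A| <= B) -> `|a| <= B.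
Proof.
move=> B0 aB; apply: norm_rV_le => // k.
by have := aB (enum_val k); rewrite /cl_coef enum_valK.
Qed.

Lemma cl_coef_le_norm a A : `|cl_coef a A| <= `|a|.
Proof. exact: norm_rV_coord. Qed.

Lemma norm_le_sqn a : `|a| <= Num.sqrt (cl_sqn a).
Proof.
apply: cl_normE_le => [|A]; first exact: sqrtr_ge0.
rewrite -sqrtr_sqr ler_sqrt ?cl_sqn_ge0//.
rewrite /cl_sqn /cl_dot (bigD1 A) //= -expr2 lerDl.
by apply: sumr_ge0 => B _; rewrite -expr2 sqr_ge0.
Qed.

Lemma sqn_le_norm a : Num.sqrt (cl_sqn a) <= (#|{set 'I_n}|)%:R * `|a|.
Proof.
have c0 : 0 <= (#|{set 'I_n}|)%:R * `|a| by rewrite mulr_ge0.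
rewrite -[leRHS]ger0_norm// -sqrtr_sqr ler_sqrt ?sqr_ge0// exprMn.
apply: (@le_trans _ _ ((#|{set 'I_n}|)%:R * `|a| ^+ 2)).
  rewrite mulr_natl -sumr_const; apply: ler_sum => A _.
  by rewrite -expr2 -real_normK ?num_real// ler_pXn2r ?nnegrE// cl_coef_le_norm.
rewrite ler_wpM2r ?sqr_ge0// expr2 -natrM ler_nat leq_pmulr//.
by apply/card_gt0P; exists finset.set0.
Qed.

Lemma cl_norm_mul a b : `|a * b| <= (#|{set 'I_n}|)%:R * (`|a| * `|b|).
Proof.
have c0 : 0 <= (#|{set 'I_n}|)%:R * (`|a| * `|b|) by rewrite !mulr_ge0.
apply: cl_normE_le => // C; rewrite cl_coef_mul (le_trans (ler_norm_sum _ _ _))//.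
rewrite mulr_natl -sumr_const; apply: ler_sum => A _; rewrite !normrM.
have -> : `|cl_sign R A (symdiff A C)| = 1 by rewrite /cl_sign normrX normrN1 expr1n.
by rewrite mulr1 ler_pM// cl_coef_le_norm.
Qed.

Lemma sqnorm_ge0 x : 0 <= sqnorm x.
Proof. by apply: sumr_ge0 => i _; rewrite sqr_ge0. Qed.

Lemma sqnorm_eq0 x : (sqnorm x == 0) = (x == 0).
Proof.
apply/eqP/eqP => [|->]; last by rewrite /sqnorm big1// => i _; rewrite mxE expr0n.
move=> /eqP; rewrite psumr_eq0 => [/allP s0|i _]; last exact: sqr_ge0.
apply/rowP => i; rewrite mxE; apply/eqP; rewrite -sqrf_eq0.
exact: (s0 i (mem_index_enum i)).
Qed.

Lemma norm_sqr_le_sqnorm x : `|x| ^+ 2 <= sqnorm x.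
Proof.
have [->|x0] := eqVneq x 0; first by rewrite normr0 expr0n sqnorm_ge0.
rewrite -ler_sqrt ?sqr_ge0 ?sqnorm_ge0// sqrtr_sqr normr_id.
apply: norm_rV_le => [|i]; first exact: sqrtr_ge0.
rewrite -sqrtr_sqr ler_sqrt ?sqnorm_ge0// /sqnorm (bigD1 i)//= lerDl.
by apply: sumr_ge0 => j _; rewrite sqr_ge0.
Qed.

Lemma sqnorm_le_norm x : sqnorm x <= n.+1%:R * `|x| ^+ 2.
Proof.
rewrite -[X in X%:R](card_ord n.+1) mulr_natl -sumr_const.
apply: ler_sum => i _; rewrite -real_normK ?num_real//.
by rewrite ler_pXn2r ?nnegrE// norm_rV_coord.
Qed.

Lemma sqnormZ (k : R) x : sqnorm (k *: x) = k ^+ 2 * sqnorm x.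
Proof. by rewrite mulr_sumr; apply: eq_bigr => i _; rewrite mxE exprMn. Qed.

Lemma paravectorZ (k : R) x : paravector (k *: x) = k *: paravector x.
Proof.
by rewrite scaler_sumr; apply: eq_bigr => i _; rewrite mxE scalerA.
Qed.

Lemma paravectorD x y : paravector (x + y) = paravector x + paravector y.
Proof.
by rewrite -big_split; apply: eq_bigr => i _; rewrite mxE scalerDl.
Qed.

Lemma paravectorN x : paravector (- x) = - paravector x.
Proof. by rewrite -scaleN1r paravectorZ scaleN1r. Qed.

(** The Clifford inverse as a point of the space, so that monomials in its coordinates can be
    formed. *)
Definition para_inv x : 'rV[R]_n.+1 := (sqnorm x)^-1 *: para_conj x.

Lemma para_invE x : x != 0 -> paravector (para_inv x) = (paravector x)^-1.
Proof. by move=> x0; rewrite paravectorZ paravectorV. Qed.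

Lemma sqnorm_conj x : sqnorm (para_conj x) = sqnorm x.
Proof.
by apply: eq_bigr => i _; rewrite mxE; case: eqP => // _; rewrite sqrrN.
Qed.

Lemma sqnorm_para_inv x : sqnorm (para_inv x) = (sqnorm x)^-1.
Proof.
rewrite sqnormZ sqnorm_conj expr2 -mulrA; have [->|s0] := eqVneq (sqnorm x) 0.
  by rewrite mulr0 invr0 mulr0.
by rewrite mulVf ?mulr1.
Qed.

Lemma paravector_conj x :
  paravector x * paravector (para_conj x) = (sqnorm x)%:A /\
  paravector (para_conj x) * paravector x = (sqnorm x)%:A.
Proof.
set w := \sum_j x ord0 (lift ord0 j) *: cl_gen R j.
set c : clifford R n := (x ord0 ord0)%:A.
have Ex : paravector x = c + w.
  rewrite /paravector big_ord_recl cl_e0; congr (_ + _).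
  by apply: eq_bigr => j _; rewrite cl_eS.
have Ec : paravector (para_conj x) = c - w.
  rewrite /paravector big_ord_recl cl_e0 mxE eqxx -sumrN; congr (_ + _).
  by apply: eq_bigr => j _; rewrite mxE cl_eS scaleNr.
have cw : c * w = w * c by rewrite -scalerAl -scalerAr mul1r mulr1.
have En : c * c - w * w = (sqnorm x)%:A.
  rewrite vector_sqr opprK /sqnorm big_ord_recl scalerDl; congr (_ + _).
  by rewrite -scalerAl mul1r scalerA expr2.
rewrite Ex Ec -En !(mulrDl, mulrDr, mulrN, mulNr) cw.
by split; rewrite ?addrA ?subrK ?addrK// -addrA addrA subrK.
Qed.

Lemma paravector_unit x : x != 0 -> paravector x \is a GRing.unit.
Proof.
move=> x0; have s0 : sqnorm x != 0 by rewrite sqnorm_eq0.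
have [E1 E2] := paravector_conj x.
apply/unitrP; exists ((sqnorm x)^-1 *: paravector (para_conj x)).
by rewrite -scalerAl -scalerAr E1 E2 scalerA mulVf// scale1r.
Qed.

Lemma cl_sqn_invM x a : x != 0 ->
  cl_sqn ((paravector x)^-1 * a) = (sqnorm x)^-1 * cl_sqn a.
Proof. by move=> x0; rewrite -para_invE// cl_sqn_paraM sqnorm_para_inv. Qed.

End CliffordNorm.

(** * Functions of class C^k *)

Section Ck.
Variables (R : realType) (n : nat).
Local Notation pt := 'rV[R]_n.+1.
Local Notation ei i := (delta_mx ord0 i : pt).
Implicit Types (V : normedModType R) (Om : set pt).

Lemma scale_diff (W : lmodType R) (h a b : R) (u w : W) :
  h *: (a *: u - b *: w) = (h * (a - b)) *: u + b *: (h *: (u - w)).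
Proof.
by rewrite !scalerBr !scalerA mulrBr scalerBl (mulrC b) addrA subrK.
Qed.

Lemma is_derive_scale (U : normedModType R) V (k : U -> R) (f : U -> V) x v dk df :
  is_derive x v k dk -> is_derive x v f df ->
  is_derive x v (fun y => k y *: f y) (dk *: f x + k x *: df).
Proof.
move=> [kd <-] [fd <-].
suff H : (fun h => h^-1 *: (((fun y => k y *: f y) \o shift x) (h *: v) - k x *: f x)) @
    0^' --> 'D_v k x *: f x + k x *: 'D_v f x.
  by split; [apply/cvg_ex; eexists; exact: H|exact: cvg_lim H].
rewrite [X in X @ _](_ : _ = fun h => (h^-1 *: (k (h *: v + x) - k x)) *: f (h *: v + x)
    + k x *: (h^-1 *: (f (h *: v + x) - f x))); last first.
  by apply/funext => h; exact: scale_diff.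
apply: cvgD; last exact: cvgZl_tmp fd.
apply: cvg_comp2 (@scale_continuous _ _ (_, _)) => /=; first exact: kd.
suff : {for 0, continuous (fun h : R => f (h *: v + x))}.
  by move=> /continuous_withinNx; rewrite scale0r add0r.
exact/differentiable_continuous/derivable1_diffP/(derivable1P _ _ _).1.
Qed.

(** [class_C] for values in an arbitrary normed module, so that it covers scalar cutoffs as well. *)
Fixpoint Ck V (k : nat) Om (f : pt -> V) : Prop :=
  (forall x, Om x -> {for x, continuous f}) /\
  (if k is k'.+1 then
     forall i, (forall x, Om x -> derivable f x (ei i)) /\
               Ck k' Om (fun x => 'D_(ei i) f x)
   else True).

Lemma class_C_Ck k Om (f : pt -> clifford R n) : class_C k Om f <-> Ck k Om f.
Proof.
elim: k f => [|k IH] f //=; split=> -[cf df]; split => // i;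
  have [d /IH] := df i; by split.
Qed.

Lemma Ck_continuous V k Om (f : pt -> V) x : Ck k Om f -> Om x -> {for x, continuous f}.
Proof. by case: k => [|k] [cf _]; exact: cf. Qed.

Lemma Ck_derivable V k Om (f : pt -> V) x i : Ck k.+1 Om f -> Om x -> derivable f x (ei i).
Proof. by move=> [_ /(_ i) [d _]]; exact: d. Qed.

Lemma Ck_partial V k Om (f : pt -> V) i :
  Ck k.+1 Om f -> Ck k Om (fun x => 'D_(ei i) f x).
Proof. by move=> [_ /(_ i) [_]]. Qed.

Lemma Ck_pred V k Om (f : pt -> V) : Ck k.+1 Om f -> Ck k Om f.
Proof.
elim: k f => [|k IH] f; first by case=> cf _; split.
move=> [cf df]; split => // i; have [d dd] := df i; split => //; exact: IH.
Qed.

Lemma Ck_le V k k' Om (f : pt -> V) : (k <= k')%N -> Ck k' Om f -> Ck k Om f.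
Proof.
move=> /subnK <-; elim: (k' - k)%N => // d IH.
by rewrite addSn => /Ck_pred.
Qed.

Lemma Ck_subset V k Om Om' (f : pt -> V) : Om `<=` Om' -> Ck k Om' f -> Ck k Om f.
Proof.
move=> s; elim: k f => [|k IH] f [cf df].
  by split=> // x /s; exact: cf.
split=> [x /s|i]; first exact: cf.
by have [d dd] := df i; split => [x /s|]; [exact: d|exact: IH].
Qed.

Lemma Ck_setU V k Om Om' (f : pt -> V) : Ck k Om f -> Ck k Om' f -> Ck k (Om `|` Om') f.
Proof.
elim: k f => [|k IH] f [cf df] [cf' df'].
  by split=> // x []; [exact: cf|exact: cf'].
split=> [x []|i]; [exact: cf|exact: cf'|].
have [d dd] := df i; have [d' dd'] := df' i.
by split=> [x []|]; [exact: d|exact: d'|exact: IH].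
Qed.

Lemma open_near_eq V Om (f g : pt -> V) x : open Om -> {in Om, f =1 g} -> Om x ->
  {near x, f =1 g}.
Proof.
move=> oO fg Ox; near=> y; apply: fg; rewrite inE; near: y.
exact: open_nbhs_nbhs.
Unshelve. all: by end_near. Qed.

Lemma derive_eq_on V Om (f g : pt -> V) x v : open Om -> {in Om, f =1 g} -> Om x ->
  'D_v f x = 'D_v g x.
Proof. by move=> oO fg Ox; apply: near_eq_derive; exact: open_near_eq oO fg Ox. Qed.

Lemma continuous_eq_on V Om (f g : pt -> V) x : open Om -> {in Om, f =1 g} -> Om x ->
  {for x, continuous f} -> {for x, continuous g}.
Proof.
move=> oO fg Ox cf; have E : g x = f x by rewrite fg ?inE.
change (g y @[y --> x] --> g x); rewrite E.
exact: (cvg_trans (near_eq_cvg (open_near_eq oO fg Ox)) cf).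
Qed.

Lemma Ck_eq V k Om (f g : pt -> V) : open Om -> {in Om, f =1 g} -> Ck k Om f -> Ck k Om g.
Proof.
move=> oO; elim: k f g => [|k IH] f g fg [cf df].
  by split=> // x Ox; exact: continuous_eq_on oO fg Ox (cf x Ox).
split => [x Ox|i]; first exact: continuous_eq_on oO fg Ox (cf x Ox).
have [d dd] := df i; split => [x Ox|].
  by apply: near_eq_derivable (d x Ox); exact: open_near_eq oO fg Ox.
apply: IH dd => x; rewrite inE => Ox; exact: derive_eq_on oO fg Ox.
Qed.

Lemma Ck_cst V k Om (v : V) : Ck k Om (fun _ : pt => v).
Proof.
elim: k v => [|k IH] v; first by split=> // x _; exact: (@cst_continuous _ _ v x).
split=> [x _|i]; first exact: (@cst_continuous _ _ v x).
split=> [x _|]; first exact: derivable_cst.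
have -> : 'D_(ei i) (fun _ : pt => v) = fun _ => 0.
  by apply/funext => x; exact: derive_cst.
exact: IH.
Qed.

Lemma Ck_add V k Om (f g : pt -> V) : open Om -> Ck k Om f -> Ck k Om g ->
  Ck k Om (fun y => f y + g y).
Proof.
move=> oO; elim: k f g => [|k IH] f g [cf df] [cg dg].
  by split=> // x Ox; exact: (cvgD (cf x Ox) (cg x Ox)).
split => [x Ox|i]; first exact: (cvgD (cf x Ox) (cg x Ox)).
have [d dd] := df i; have [e ee] := dg i; split => [x Ox|].
  exact: (derivableD (d x Ox) (e x Ox)).
apply: Ck_eq (IH _ _ dd ee) => // x; rewrite inE => Ox.
by rewrite -[RHS]/('D_(ei i) (f + g) x) deriveD; [| exact: d|exact: e].
Qed.

Lemma Ck_scale V k Om (s : pt -> R) (f : pt -> V) : open Om ->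
  Ck k Om (s : pt -> R^o) -> Ck k Om f -> Ck k Om (fun y => s y *: f y).
Proof.
move=> oO; elim: k s f => [|k IH] s f cs cf.
  by split=> // x Ox; exact: (cvgZ (cs.1 x Ox) (cf.1 x Ox)).
have [s0 ds] := cs; have [f0 df] := cf.
split=> [x Ox|i]; first exact: (cvgZ (s0 x Ox) (f0 x Ox)).
have D x : Om x -> is_derive x (ei i) (fun y => s y *: f y)
    ('D_(ei i) s x *: f x + s x *: 'D_(ei i) f x).
  move=> Ox; apply: is_derive_scale; apply/derivableP.
    exact: (ds i).1.
  exact: (df i).1.
split=> [x /D []//|].
apply: (@Ck_eq _ _ _ (fun x => 'D_(ei i) s x *: f x + s x *: 'D_(ei i) f x)) => //.
  by move=> x; rewrite inE => /D [_ ->].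
apply: Ck_add => //; apply: IH.
- exact: (ds i).2.
- exact: Ck_pred.
- exact: Ck_pred.
- exact: (df i).2.
Qed.

Lemma Ck_sum V k Om (I : Type) (r : seq I) (f : I -> pt -> V) : open Om ->
  (forall i, Ck k Om (f i)) -> Ck k Om (fun y => \sum_(i <- r) f i y).
Proof.
move=> oO fC; elim: r => [|i r IH].
  by under [X in Ck _ _ X]eq_fun do rewrite big_nil; exact: Ck_cst.
by under [X in Ck _ _ X]eq_fun do rewrite big_cons; exact: Ck_add.
Qed.

Lemma Ck_opp V k Om (f : pt -> V) : open Om -> Ck k Om f -> Ck k Om (fun y => - f y).
Proof.
move=> oO fC; under [X in Ck _ _ X]eq_fun do rewrite -scaleN1r.
by apply: Ck_scale => //; exact: (@Ck_cst R^o).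
Qed.

Lemma is_derive_coord (x v : pt) j :
  is_derive x v (fun y : pt => y ord0 j : R^o) (v ord0 j).
Proof.
have [d E] := is_derive_id x v; have := derive_mx d; rewrite E.
move=> /matrixP /(_ ord0 j); rewrite mxE => ->.
by apply/derivableP; have /derivable_mxP := d; exact.
Qed.

Lemma coord_continuous_pt j : continuous (fun y : pt => y ord0 j : R^o).
Proof. by move=> y; exact: coord_continuous. Qed.

Lemma Ck_coord k Om j : Ck k Om (fun y : pt => y ord0 j : R^o).
Proof.
case: k => [|k]; first by split=> // x _; exact: coord_continuous_pt.
split=> [x _|i]; first exact: coord_continuous_pt.
split=> [x _|]; first by have [] := is_derive_coord x (ei i) j.
have -> : 'D_(ei i) (fun y : pt => y ord0 j : R^o) = fun _ => (ei i) ord0 j.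
  by apply/funext => x; have [_ ->] := is_derive_coord x (ei i) j.
exact: Ck_cst.
Qed.

Lemma Ck_sqnorm k Om : open Om -> Ck k Om (@sqnorm R n : pt -> R^o).
Proof.
move=> oO; apply: (Ck_sum (V := R^o)) => // i.
by apply: (@Ck_scale R^o) => //; exact: Ck_coord.
Qed.

Lemma is_derive_line V (f : pt -> V) x v df :
  is_derive x v f df <-> is_derive (0 : R) (1 : R) (fun h => f (h *: v + x)) df.
Proof.
have E : 'D_1 (fun h : R => f (h *: v + x)) 0 = 'D_v f x.
  rewrite /derive; congr (lim (_ @ 0^')); apply/funext => h /=.
  by rewrite addr0 scale0r add0r [_%:A]mulr1.
split=> -[d <-].
  by split=> //; exact: (derivable1P f x v).1 d.
by split=> //; exact: (derivable1P f x v).2 d.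
Qed.

(** The family [psi] is stable under differentiation up to constants, each derivative lowering the
    index by one. Starting above [k], the index stays positive, where continuity is known. The
    instance is the family of truncated powers. *)
Lemma Ck_comp (psi : nat -> R -> R) (c : nat -> R) k Om (g : pt -> R) K :
  open Om -> (forall j, (0 < j)%N -> continuous (psi j)) ->
  (forall j t, (1 < j)%N -> is_derive t (1 : R) (psi j) (c j * psi j.-1 t)) ->
  Ck k Om (g : pt -> R^o) -> (k < K)%N -> Ck k Om ((fun y => psi K (g y)) : pt -> R^o).
Proof.
move=> oO cpsi dpsi; elim: k K g => [|k IH] K g gC kK.
  split=> // x Ox; apply: (@continuous_comp _ _ _ g (psi K)); first exact: gC.1.
  exact: cpsi.
have gc := gC.1; have gd := gC.2; split=> [x Ox|i].
  by apply: (@continuous_comp _ _ _ g (psi K)); [exact: gc|apply: cpsi; lia].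
have D x : Om x -> is_derive x (ei i) ((fun y => psi K (g y)) : pt -> R^o)
    ((c K * psi K.-1 (g x)) * 'D_(ei i) g x).
  move=> Ox; have /derivableP /is_derive_line gd1 := (gd i).1 x Ox.
  apply/is_derive_line; apply: is_derive_eq.
    apply: (@is_derive1_comp _ (psi K) (fun h => g (h *: ei i + x))).
    by apply: dpsi; lia.
  by rewrite scale0r add0r.
split=> [x /D []//|].
apply: (@Ck_eq R^o _ _ (fun x => (c K *: psi K.-1 (g x)) *: 'D_(ei i) g x)) => //.
  by move=> x; rewrite inE => /D [_ ->].
apply: (@Ck_scale R^o) => //; last exact: (gd i).2.
apply: (@Ck_scale R^o) => //; first exact: Ck_cst.
by apply: IH; [exact: (Ck_pred gC)|lia].
Qed.

End Ck.

Lemma cvg_bigsum (R : realType) (V : normedModType R) (T : Type) (F : set_system T)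
    {FF : Filter F} (I : Type) (r : seq I) (f : I -> T -> V) (l : I -> V) :
  (forall i, f i @ F --> l i) ->
  (fun x => \sum_(i <- r) f i x) @ F --> \sum_(i <- r) l i.
Proof.
move=> fl; elim: r => [|i r IH].
  rewrite big_nil (_ : (fun x => _) = fun _ => 0); first exact: cvg_cst.
  by apply/funext => x; rewrite big_nil.
rewrite big_cons (_ : (fun x => _) = fun x => f i x + \sum_(i <- r) f i x).
  by apply: cvgD.
by apply/funext => x; rewrite big_cons.
Qed.

(** * Integration of Clifford-valued functions and the divergence theorem *)

Section CliffordIntegral.
Variables (R : realType) (n : nat) (L : R).
Local Notation pt := 'rV[R]_n.+1.
Local Notation cl := (clifford R n).
Local Notation ei i := (delta_mx ord0 i : pt).
Implicit Types (u v : pt -> cl) (s : pt -> R).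

(** Reduces left multiplication by a constant to finitely many scalar functions with constant vector
    coefficients; continuity and the passage through the integral follow from this. *)
Lemma cl_mulEsum (a b : cl) :
  a * b = \sum_j b ord0 j *: (a * (delta_mx ord0 j : 'rV[R]_#|{set 'I_n}|)).
Proof.
rewrite {1}(row_sum_delta b) mulr_sumr; apply: eq_bigr => j _.
by rewrite -scalerAr.
Qed.

Lemma cl_mull_continuous (a : cl) : continuous (fun b : cl => a * b).
Proof.
have -> : (fun b : cl => a * b) =
    fun b => \sum_j b ord0 j *: (a * (delta_mx ord0 j : 'rV[R]_#|{set 'I_n}|)).
  by apply/funext => b; exact: cl_mulEsum.
move=> b; apply: (@cvg_bigsum _ _ _ (nbhs b)) => j; apply: cvgZr_tmp; exact: coord_continuous.
Qed.

Lemma is_derive_mull (a : cl) u x w du :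
  is_derive x w u du -> is_derive x w (fun y => a * u y) (a * du).
Proof.
move=> [ud <-].
suff H : (fun h => h^-1 *: (((fun y => a * u y) \o shift x) (h *: w) - a * u x)) @
    0^' --> a * 'D_w u x.
  by split; [apply/cvg_ex; eexists; exact: H|exact: cvg_lim H].
rewrite [X in X @ _](_ : _ = (fun b => a * b) \o
   (fun h => h^-1 *: (u (h *: w + x) - u x))); last first.
  by apply/funext => h /=; rewrite -scalerAr mulrBr.
exact: (cvg_comp _ _ ud (@cl_mull_continuous a _)).
Qed.

Lemma Ck_mull k Om (a : cl) u : open Om -> Ck k Om u -> Ck k Om (fun y => a * u y).
Proof.
move=> oO; elim: k u => [|k IH] u [cu du].
  split; last by [].
  move=> x Ox; apply: (@continuous_comp _ _ _ u (fun b => a * b));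
    [exact: cu|exact: cl_mull_continuous].
split=> [x Ox|i].
  by apply: (@continuous_comp _ _ _ u (fun b => a * b));
    [exact: cu|exact: cl_mull_continuous].
have D x : Om x -> is_derive x (ei i) (fun y => a * u y) (a * 'D_(ei i) u x).
  by move=> Ox; apply/is_derive_mull/derivableP/(du i).1.
split=> [x /D []//|].
apply: (@Ck_eq _ _ _ _ _ (fun x => a * 'D_(ei i) u x)) => //.
  by move=> x; rewrite inE => /D [_ ->].
exact: IH (du i).2.
Qed.

Hypothesis L_gt0 : 0 < L.

Definition cl_int u : cl := \row_k box_int L (fun y => u y ord0 k).

Lemma bounded_on_coord u k : bounded_on u -> bounded_on (fun y => u y ord0 k : R^o).
Proof. by move=> [B uB]; exists B => y; rewrite (le_trans (norm_rV_coord _ _)). Qed.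

Lemma cl_intD u v : bounded_on u -> bounded_on v ->
  cl_int (fun y => u y + v y) = cl_int u + cl_int v.
Proof.
move=> ub vb; apply/rowP => k; rewrite !mxE -box_intD//; try exact: bounded_on_coord.
by congr box_int; apply/funext => y; rewrite mxE.
Qed.

Lemma cl_intZ (c : R) u : bounded_on u ->
  cl_int (fun y => c *: u y) = c *: cl_int u.
Proof.
move=> ub; apply/rowP => k; rewrite !mxE -box_intZ//; try exact: bounded_on_coord.
by congr box_int; apply/funext => y; rewrite mxE.
Qed.

Lemma bounded_on_Zcst (c : R) u : bounded_on u -> bounded_on (fun y => c *: u y).
Proof. by apply: bounded_on_scale; exact: bounded_on_cst. Qed.

Lemma cl_intN u : bounded_on u -> cl_int (fun y => - u y) = - cl_int u.
Proof.
move=> ub; rewrite -scaleN1r -cl_intZ//; congr cl_int.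
by apply/funext => y; rewrite scaleN1r.
Qed.

Lemma cl_intB u v : bounded_on u -> bounded_on v ->
  cl_int (fun y => u y - v y) = cl_int u - cl_int v.
Proof. by move=> ub vb; rewrite cl_intD ?cl_intN//; exact: bounded_onN. Qed.

Lemma cl_int0 : cl_int (fun _ => 0) = 0.
Proof.
apply/rowP => k; rewrite !mxE -[RHS](mulr0 ((2 * L) ^+ n.+1)) -(@box_int_cst R n L L_gt0).
by congr box_int; apply/funext => y; rewrite mxE.
Qed.

Lemma cl_int_sum (I : Type) (r : seq I) (P : pred I) (F : I -> pt -> cl) :
  (forall i, bounded_on (F i)) ->
  cl_int (fun y => \sum_(i <- r | P i) F i y) = \sum_(i <- r | P i) cl_int (F i).
Proof.
move=> Fb; elim: r => [|i r IH].
  by rewrite big_nil; under eq_fun do rewrite big_nil; exact: cl_int0.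
rewrite big_cons -IH; case Pi: (P i); last first.
  by congr cl_int; apply/funext => y; rewrite big_cons Pi.
rewrite -cl_intD//; last exact: bounded_on_sum.
by congr cl_int; apply/funext => y; rewrite big_cons Pi.
Qed.

Lemma cl_int_mull (a : cl) u : bounded_on u ->
  cl_int (fun y => a * u y) = a * cl_int u.
Proof.
move=> ub; under eq_fun do rewrite cl_mulEsum.
rewrite cl_int_sum => [|j]; last first.
  by apply: bounded_on_scale; [exact: bounded_on_coord|exact: bounded_on_cst].
rewrite [RHS]cl_mulEsum; apply: eq_bigr => j _; set b := a * _.
apply/rowP => k; rewrite !mxE mulrC -box_intZ//; last exact: bounded_on_coord.
by congr box_int; apply/funext => y; rewrite mxE mulrC.
Qed.

Lemma norm_cl_int_le u (g : pt -> R) : (forall y, `|u y| <= g y) ->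
  bounded_on (g : pt -> R^o) -> `|cl_int u| <= box_int L g.
Proof.
move=> ug gb; have g0 : 0 <= box_int L g.
  rewrite -[leLHS](mulr0 ((2 * L) ^+ n.+1)) -(@box_int_cst R n L L_gt0).
  apply: le_box_int => //; first exact: bounded_on_cst.
  by move=> y; exact: le_trans (ug y).
apply: norm_rV_le => // k; rewrite mxE; apply: norm_box_int_le => // y.
exact: le_trans (norm_rV_coord _ _) (ug y).
Qed.

Lemma norm_cl_int_le_cst u B : (forall y, `|u y| <= B) ->
  `|cl_int u| <= (2 * L) ^+ n.+1 * B.
Proof.
move=> uB; rewrite -box_int_cst//; apply: norm_cl_int_le => //.
exact: bounded_on_cst.
Qed.

Lemma supp_in_derive (V : normedModType R) l l' (g : pt -> V) (w : pt) :
  l < l' -> supp_in l g -> supp_in l' (fun y => 'D_w g y).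
Proof.
move=> ll sg y ly.
have -> : 'D_w g y = 'D_w (fun _ : pt => 0 : V) y; last exact: derive_cst.
apply: (@derive_eq_on _ _ _ [set z : pt | l < `|z|]) => /=.
- apply: (@open_comp _ _ (fun z : pt => `|z|) [set t | l < t]); last exact: open_gt.
  by move=> z _; exact: norm_continuous.
- by move=> z; rewrite inE /= => /ltW; exact: sg.
- exact: lt_le_trans ll ly.
Qed.

Lemma Ck_setT_continuous (V : normedModType R) k (g : pt -> V) :
  Ck k setT g -> continuous g.
Proof. by move=> gC x; exact: Ck_continuous gC I. Qed.

Lemma Ck_supp_bounded (V : normedModType R) k l (g : pt -> V) :
  Ck k setT g -> supp_in l g -> bounded_on g.
Proof. by move=> /Ck_setT_continuous; exact: supp_in_bounded. Qed.

Lemma cl_int_partial l i u : l < L -> Ck 1 setT u -> supp_in l u ->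
  cl_int (fun y => 'D_(ei i) u y) = 0.
Proof.
move=> lL uC su; apply/rowP => k; rewrite !mxE.
(* Differentiating enlarges the radius in [supp_in]; the midpoint leaves room on both sides. *)
have lL' : l < (l + L) / 2 /\ (l + L) / 2 < L by split; move: lL; lra.
have du y : derivable u y (ei i) by exact: Ck_derivable uC _.
have E y : 'D_(ei i) (fun z => u z ord0 k : R^o) y = 'D_(ei i) u y ord0 k.
  by rewrite (derive_mx (du y)) mxE.
rewrite -[RHS](_ : box_int L (fun y => 'D_(ei i) (fun z => u z ord0 k : R^o) y) = 0).
  by congr box_int; apply/funext => y; rewrite E.
apply: (@box_int_partial _ _ _ L_gt0 ((l + L) / 2)) => //; first exact: lL'.2.
- by move=> y; have /derivable_mxP := du y; exact.
- rewrite (funext E) => y.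
  apply: (@continuous_comp _ _ _ (fun y => 'D_(ei i) u y) (fun b : 'rV[R]_#|{set 'I_n}| => b ord0 k)).
    exact: (Ck_setT_continuous (Ck_partial i uC)).
  exact: coord_continuous.
- move=> y; apply: (@continuous_comp _ _ _ u (fun b : 'rV[R]_#|{set 'I_n}| => b ord0 k)).
    exact: Ck_setT_continuous uC y.
  exact: coord_continuous.
- by move=> y ly; rewrite su ?mxE// (le_trans (ltW lL'.1)).
- move=> y ly; rewrite E (supp_in_derive _ lL'.1 su)// mxE//.
Qed.

Lemma cl_int_div l (F : 'I_n.+1 -> pt -> cl) : l < L ->
  (forall i, Ck 1 setT (F i)) -> (forall i, supp_in l (F i)) ->
  cl_int (fun y => \sum_i 'D_(ei i) (F i) y) = 0.
Proof.
move=> lL FC sF; rewrite cl_int_sum => [|i].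
  by apply: big1 => i _; exact: cl_int_partial (FC i) (sF i).
apply: (Ck_supp_bounded (Ck_partial i (FC i))).
by apply: supp_in_derive (sF i); exact: lL.
Qed.

End CliffordIntegral.

Lemma scale_regE (R : realType) (a b : R) : a *: (b : R^o) = a * b.
Proof. by []. Qed.

(** * The regularized kernel *)

Section Kernel.
Variables (R : realType) (n : nat).
Local Notation pt := 'rV[R]_n.+1.
Local Notation cl := (clifford R n).
Local Notation ei i := (delta_mx ord0 i : pt).

(** With a strict inequality the region is open, so derivatives vanish beyond the same [l], whereas
    [supp_in] loses a little at each derivative. *)
Definition vanishes_beyond (V : zmodType) (l : R) (g : pt -> V) : Prop :=
  forall y, l < `|y| -> g y = 0.

Lemma vanishes_supp_in (V : zmodType) l l' (g : pt -> V) : l < l' ->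
  vanishes_beyond l g -> supp_in l' g.
Proof. by move=> ll g0 y ly; apply: g0; exact: lt_le_trans ly. Qed.

Lemma open_beyond l : open [set z : pt | l < `|z|].
Proof.
apply: (@open_comp _ _ (fun z : pt => `|z|) [set t | l < t]); last exact: open_gt.
by move=> z _; exact: norm_continuous.
Qed.

Lemma vanishes_beyond_derive (V : normedModType R) l (g : pt -> V) (w : pt) :
  vanishes_beyond l g -> vanishes_beyond l (fun y => 'D_w g y).
Proof.
move=> sg y ly.
have -> : 'D_w g y = 'D_w (fun _ : pt => 0 : V) y; last exact: derive_cst.
apply: (@derive_eq_on _ _ _ [set z : pt | l < `|z|]) => //=.
  exact: open_beyond.
by move=> z; rewrite inE /= => ?; exact: sg.
Qed.

Lemma vanishes_beyond_laplacian l k (u : pt -> cl) :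
  vanishes_beyond l u -> vanishes_beyond l (iter k (@laplacian R n) u).
Proof.
elim: k => //= k IH u0 y ly; apply: big1 => i _.
apply: (@vanishes_beyond_derive cl l _ _ _ y ly).
by apply: (@vanishes_beyond_derive cl l); exact: IH.
Qed.

Lemma Ck_laplacian k Om (u : pt -> cl) : open Om -> Ck k.+2 Om u ->
  Ck k Om (laplacian u).
Proof.
move=> oO uC; apply: (Ck_sum (V := cl)) => // i.
exact: (Ck_partial i (Ck_partial i uC)).
Qed.

Lemma Ck_iter_laplacian k j Om (u : pt -> cl) : open Om -> Ck (k + j.*2) Om u ->
  Ck k Om (iter j (@laplacian R n) u).
Proof.
move=> oO; elim: j k => [|j IH] k uC /=; first by rewrite addn0 in uC.
apply: (Ck_laplacian oO); apply: IH; move: uC; rewrite doubleS -!addSnnS; exact.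
Qed.

Lemma Ck_dirac k Om (u : pt -> cl) : open Om -> Ck k.+1 Om u -> Ck k Om (dirac_op u).
Proof.
move=> oO uC; apply: (Ck_sum (V := cl)) => // i.
by apply: Ck_mull => //; exact: (Ck_partial i uC).
Qed.

Lemma Ck_inv k Om (g : pt -> R) : open Om -> (forall y, Om y -> g y != 0) ->
  Ck k Om (g : pt -> R^o) -> Ck k Om ((fun y => (g y)^-1) : pt -> R^o).
Proof.
move=> oO g0; elim: k => [|k IH] gC.
  split; last by [].
  by move=> y Oy; exact: (cvgV (g0 y Oy) (gC.1 y Oy)).
have [gc gd] := gC; split.
  by move=> y Oy; exact: (cvgV (g0 y Oy) (gc y Oy)).
move=> i; split => [y Oy|]; first exact: derivableV (g0 y Oy) ((gd i).1 y Oy).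
apply: (@Ck_eq R n R^o _ _ (fun y => (- ((g y)^-1 *: (g y)^-1)) *: 'D_(ei i) g y)).
- exact: oO.
- move=> y; rewrite inE => Oy; rewrite deriveV ?g0//; last exact: (gd i).1.
  by rewrite expr2 invfM.
- apply: (@Ck_scale _ _ R^o) => //; last exact: (gd i).2.
  by apply: Ck_opp => //; apply: (@Ck_scale _ _ R^o) => //; apply: IH; exact: Ck_pred.
Qed.

Section ResolventPowers.
Variables (x : pt) (e : R).
Hypothesis e0 : 0 < e.

(** The powers of the regularized [1 / |x - y|^2]. With coefficients polynomial in [e], their span
    is stable under the Laplacian. *)
Definition sg (j : nat) (y : pt) : R := (sqnorm (x - y) + e)^-1 ^+ j.

Lemma sg_den_gt0 y : 0 < sqnorm (x - y) + e.
Proof. by rewrite ltr_wpDl ?sqnorm_ge0. Qed.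

Lemma sg_gt0 j y : 0 < sg j y.
Proof. by rewrite exprn_gt0// invr_gt0 sg_den_gt0. Qed.

(** Eliminates the factor [|x - y|^2] that differentiation produces:
    [|x - y|^2 sg_(j+1) = sg_j - e sg_(j+1)]. *)
Lemma sgS j y : (sqnorm (x - y) + e) * sg j.+1 y = sg j y.
Proof. by rewrite /sg exprS mulrA divff ?mul1r// gt_eqF// sg_den_gt0. Qed.

Lemma Ck_coord_sub k Om i : open Om -> Ck k Om ((fun y : pt => x ord0 i - y ord0 i) : pt -> R^o).
Proof.
move=> oO; apply: (@Ck_add _ _ R^o) => //; first exact: Ck_cst.
by apply: (@Ck_opp _ _ R^o) => //; exact: Ck_coord.
Qed.

Lemma Ck_sqnorm_sub k Om : open Om -> Ck k Om ((fun y : pt => sqnorm (x - y)) : pt -> R^o).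
Proof.
move=> oO; apply: (Ck_sum (V := R^o)) => // i.
under [X in Ck _ _ X]eq_fun do rewrite !mxE.
by apply: (@Ck_scale _ _ R^o) => //; exact: Ck_coord_sub.
Qed.

Lemma Ck_sg k j Om : open Om -> Ck k Om (sg j : pt -> R^o).
Proof.
move=> oO; elim: j => [|j IH].
  by rewrite /sg; under [X in Ck _ _ X]eq_fun do rewrite expr0; exact: Ck_cst.
rewrite /sg; under [X in Ck _ _ X]eq_fun do rewrite exprS.
apply: (@Ck_scale _ _ R^o) => //; apply: Ck_inv => //.
  by move=> y _; rewrite gt_eqF// sg_den_gt0.
by apply: (@Ck_add _ _ R^o) => //; [exact: Ck_sqnorm_sub|exact: Ck_cst].
Qed.

Lemma is_derive_coord_sub y (w : pt) i :
  is_derive y w ((fun y : pt => x ord0 i - y ord0 i) : pt -> R^o) (- w ord0 i).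
Proof.
have := is_deriveB (is_derive_cst (x ord0 i : R^o) y w) (is_derive_coord y w i).
by rewrite sub0r.
Qed.

Lemma is_derive_bigsum (V : normedModType R) (I : Type) (r : seq I) (h : I -> pt -> V)
    (dh : I -> V) y w : (forall i, is_derive y w (h i) (dh i)) ->
  is_derive y w (fun z => \sum_(i <- r) h i z) (\sum_(i <- r) dh i).
Proof.
move=> hd; elim: r => [|i r IH].
  by rewrite big_nil; under [X in is_derive _ _ X]eq_fun do rewrite big_nil; exact: is_derive_cst.
rewrite big_cons; under [X in is_derive _ _ X]eq_fun do rewrite big_cons.
exact: (is_deriveD (hd i) IH).
Qed.

Lemma is_derive_sqnorm_sub y i :
  is_derive y (ei i) ((fun y : pt => sqnorm (x - y)) : pt -> R^o) (- 2 * (x ord0 i - y ord0 i)).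
Proof.
have -> : (fun y : pt => sqnorm (x - y)) =
    fun y : pt => \sum_j (x ord0 j - y ord0 j) *: (x ord0 j - y ord0 j : R^o).
  by apply/funext => z; apply: eq_bigr => j _; rewrite !mxE.
have H j := is_derive_scale (is_derive_coord_sub y (ei i) j) (is_derive_coord_sub y (ei i) j).
apply: is_derive_eq (is_derive_bigsum _ H) _.
rewrite (bigD1 i)//= big1 ?addr0 => [|j ji].
  by rewrite !mxE !eqxx /= !scale_regE; ring.
by rewrite !mxE (negbTE ji) andbF oppr0 scale0r scaler0 addr0.
Qed.

Lemma is_derive_sg j y i :
  is_derive y (ei i) (sg j : pt -> R^o) (2 * j%:R * (x ord0 i - y ord0 i) * sg j.+1 y).
Proof.
elim: j => [|j IH].
  rewrite /sg mulr0 !mul0r; under [X in is_derive _ _ X]eq_fun do rewrite expr0.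
  exact: is_derive_cst.
have D0 : is_derive y (ei i) ((fun y : pt => sqnorm (x - y) + e) : pt -> R^o)
    (- 2 * (x ord0 i - y ord0 i)).
  have := is_deriveD (is_derive_sqnorm_sub y i) (is_derive_cst (e : R^o) y (ei i)).
  by rewrite addr0.
have D1 : is_derive y (ei i) ((fun y : pt => (sqnorm (x - y) + e)^-1) : pt -> R^o)
    (2 * (x ord0 i - y ord0 i) * sg 2 y).
  have n0 : sqnorm (x - y) + e != 0 by rewrite gt_eqF// sg_den_gt0.
  have [d E] := D0; split; first exact: derivableV.
  by rewrite deriveV// E /sg scale_regE expr2 invfM expr2; ring.
have -> : sg j.+1 = fun y => (sqnorm (x - y) + e)^-1 *: (sg j y : R^o).
  by apply/funext => z; rewrite /sg exprS.
apply: is_derive_eq (is_derive_scale D1 IH) _.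
rewrite /sg !scale_regE -(natr1 j) !exprS expr0; ring.
Qed.

End ResolventPowers.
End Kernel.

Lemma addr_sub_swap (V : zmodType) (a b c : V) : a + b - (c + a) = b - c.
Proof. by rewrite (addrC c) opprD addrACA subrr add0r. Qed.

(** * Integration by parts against the regularized kernel *)

Section Regularization.
Variables (R : realType) (n : nat) (L : R).
Local Notation pt := 'rV[R]_n.+1.
Local Notation cl := (clifford R n).
Local Notation ei i := (delta_mx ord0 i : pt).
Hypothesis L_gt0 : 0 < L.
Variables (x : pt) (e : R).
Hypothesis e0 : 0 < e.
Local Notation sg := (sg x e).
Local Notation cl_int := (cl_int L).
Implicit Types (u v : pt -> cl).

Lemma cl_int_divergence l (F : 'I_n.+1 -> pt -> cl) : l < L ->
  (forall i, Ck 1 setT (F i)) -> (forall i, vanishes_beyond l (F i)) ->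
  cl_int (fun y => \sum_i 'D_(ei i) (F i) y) = 0.
Proof.
move=> lL FC sF; have [l1 l2] : l < (l + L) / 2 /\ (l + L) / 2 < L.
  by split; move: lL; lra.
by apply: (cl_int_div L_gt0 l2) => // i; exact: vanishes_supp_in l1 (sF i).
Qed.

Lemma Ck_vanishes_bounded (V : normedModType R) k l (g : pt -> V) :
  Ck k setT g -> vanishes_beyond l g -> bounded_on g.
Proof.
move=> gC g0; have ll : l < l + 1 by rewrite ltrDl.
exact: (Ck_supp_bounded gC (vanishes_supp_in ll g0)).
Qed.

Lemma Ck_setT_is_derive (V : normedModType R) k (g : pt -> V) y i :
  Ck k.+1 setT g -> is_derive y (ei i) g ('D_(ei i) g y).
Proof. by move=> gC; apply: derivableP; exact: (@Ck_derivable R n V k setT g y i gC I). Qed.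

Definition conj_diff (y : pt) : cl := paravector (para_conj (x - y)).

Definition conj_sgn (l : 'I_n.+1) : R := if l == ord0 then 1 else -1.

Lemma conj_diffE y :
  conj_diff y = \sum_l (conj_sgn l * (x ord0 l - y ord0 l)) *: cl_e R l.
Proof.
apply: eq_bigr => l _; rewrite !mxE /conj_sgn.
by case: eqP => _; rewrite ?mul1r ?mulN1r.
Qed.

Lemma is_derive_conj_diffM y i u du : is_derive y (ei i) u du ->
  is_derive y (ei i) (fun y => conj_diff y * u y)
    (- (paravector (para_conj (ei i)) * u y) + conj_diff y * du).
Proof.
move=> ud.
have -> : (fun y => conj_diff y * u y) = fun y =>
    \sum_l (conj_sgn l *: (x ord0 l - y ord0 l : R^o)) *: (cl_e R l * u y).
  apply/funext => z; rewrite conj_diffE mulr_suml.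
  by apply: eq_bigr => l _; rewrite scalerAl.
have H l := is_derive_scale (is_derive_scale (is_derive_cst (conj_sgn l : R^o) y (ei i))
   (is_derive_coord_sub x y (ei i) l)) (is_derive_mull (cl_e R l) ud).
apply: is_derive_eq (is_derive_bigsum _ H) _.
rewrite big_split /=; congr (_ + _); last first.
  by rewrite conj_diffE mulr_suml; apply: eq_bigr => l _; rewrite scalerAl.
rewrite mulr_suml -sumrN; apply: eq_bigr => l _.
rewrite scale0r add0r scalerAl -mulNr -scaleNr !mxE /conj_sgn.
by case: eqP => _; rewrite !scale_regE ?mul1r ?mulN1r// opprK.
Qed.

Lemma Ck_conj_diffM k u : Ck k setT u -> Ck k setT (fun y => conj_diff y * u y).
Proof.
move=> uC.
have -> : (fun y => conj_diff y * u y) = fun y =>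
    \sum_l (conj_sgn l *: (x ord0 l - y ord0 l : R^o)) *: (cl_e R l * u y).
  apply/funext => z; rewrite conj_diffE mulr_suml.
  by apply: eq_bigr => l _; rewrite scalerAl.
apply: (Ck_sum (V := cl)) => [|l]; first exact: openT.
apply: (Ck_scale openT _ (Ck_mull _ openT uC)).
exact: (@Ck_scale _ _ R^o k _ _ _ openT (@Ck_cst _ _ R^o k _ _) (Ck_coord_sub x k l openT)).
Qed.

Lemma conj_eiM i : paravector (para_conj (ei i)) * cl_e R i = 1.
Proof.
have E : paravector (ei i) = cl_e R i.
  rewrite /paravector (bigD1 i)//= big1 => [|j ji].
    by rewrite mxE !eqxx scale1r addr0.
  by rewrite mxE (negbTE ji) andbF scale0r.
have [_] := paravector_conj (ei i); rewrite E => ->.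
rewrite /sqnorm (bigD1 i)//= big1 => [|j ji].
  by rewrite mxE !eqxx expr1n addr0 scale1r.
by rewrite mxE (negbTE ji) andbF expr0n.
Qed.

(** The Dirac derivative, taken from the right in [z = x - y], of [conj z / (|z|^2 + e)]. *)
Definition reg_potential (y : pt) : R := (n.+1%:R - 2) * sg 1 y + 2 * e * sg 2 y.

Lemma sum_e_coord (z : pt) (b : cl) :
  \sum_i z ord0 i *: (cl_e R i * b) = paravector z * b.
Proof. by rewrite mulr_suml; apply: eq_bigr => i _; rewrite scalerAl. Qed.

(** Integrate the divergence of the fields [sg 1 y *: (conj_diff y * (cl_e R i * v y))]. Placing
    [cl_e R i] between kernel and [v] makes it act on the kernel from the right and on [v] from the
    left. *)
Lemma cl_int_reg_dirac l v : l < L -> Ck 1 setT v -> vanishes_beyond l v ->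
  cl_int (fun y => sg 1 y *: (conj_diff y * dirac_op v y)) =
  cl_int (fun y => reg_potential y *: v y).
Proof.
move=> lL vC v0; have oT : open [set: pt] := openT.
have sgC j k : Ck k setT (sg j : pt -> R^o) by exact: Ck_sg.
pose F i (y : pt) : cl := sg 1 y *: (conj_diff y * (cl_e R i * v y)).
have FC i : Ck 1 setT (F i).
  exact: (Ck_scale oT (sgC 1%N 1%N) (Ck_conj_diffM (Ck_mull (cl_e R i) oT vC))).
have F0 i : vanishes_beyond l (F i).
  by move=> y ly; rewrite /F v0// !mulr0 scaler0.
have dv y i : is_derive y (ei i) v ('D_(ei i) v y).
  exact: Ck_setT_is_derive vC.
have D y : \sum_i 'D_(ei i) (F i) y =
    sg 1 y *: (conj_diff y * dirac_op v y) - reg_potential y *: v y.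
  transitivity (\sum_i ((2 * (x ord0 i - y ord0 i) * sg 2 y) *: (conj_diff y * (cl_e R i * v y))
     + sg 1 y *: (- v y + conj_diff y * (cl_e R i * 'D_(ei i) v y)))).
    apply: eq_bigr => i _.
    have H := is_derive_scale (is_derive_sg x e0 1 y i)
      (is_derive_conj_diffM (is_derive_mull (cl_e R i) (dv y i))).
    have [_ ->] := H; rewrite (mulrA (paravector (para_conj _)) (cl_e R i)) conj_eiM mul1r mulr1.
    by [].
  rewrite big_split /= -scaler_sumr big_split /= sumr_const card_ord.
  rewrite -mulr_sumr -/(dirac_op v y) scalerDr addrA [RHS]addrC; congr (_ + _).
  have -> : \sum_i (2 * (x ord0 i - y ord0 i) * sg 2 y) *: (conj_diff y * (cl_e R i * v y))
      = (2 * sg 2 y * sqnorm (x - y)) *: v y.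
    transitivity ((2 * sg 2 y) *: (conj_diff y * (paravector (x - y) * v y))).
      rewrite -sum_e_coord mulr_sumr scaler_sumr; apply: eq_bigr => i _.
      have -> : (x - y) ord0 i = x ord0 i - y ord0 i by rewrite !mxE.
      rewrite -(scalerAr (x ord0 i - y ord0 i)) scalerA; congr (_ *: _); ring.
    rewrite mulrA; have [_ ->] := paravector_conj (x - y).
    by rewrite -scalerAl mul1r scalerA.
  have -> : - v y *+ n.+1 = - (n.+1%:R : R) *: v y.
    by rewrite scaleNr scaler_nat mulNrn.
  rewrite (scalerA (sg 1 y)) -scalerDl -scaleNr; congr (_ *: _).
  rewrite /reg_potential -(sgS x e0 1 y); ring.
apply/eqP; rewrite -subr_eq0 -cl_intB//.
- apply/eqP; rewrite -(cl_int_divergence lL FC F0); congr cl_int.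
  by apply/funext => y; rewrite D.
- apply: (@Ck_vanishes_bounded cl 0 l).
    exact: (Ck_scale oT (sgC 1%N 0%N) (Ck_conj_diffM (Ck_dirac oT vC))).
  move=> y ly; rewrite /dirac_op big1 ?mulr0 ?scaler0// => i _.
  by rewrite /partial (@vanishes_beyond_derive R n cl l v (ei i) v0 y ly) mulr0.
- apply: (@Ck_vanishes_bounded cl 0 l).
    apply: (Ck_scale oT _ (Ck_pred vC)); apply: (@Ck_add _ _ R^o 0 _ _ _ oT).
      exact: (@Ck_scale _ _ R^o 0 _ _ _ oT (@Ck_cst _ _ R^o 0 _ _) (sgC 1%N 0%N)).
    exact: (@Ck_scale _ _ R^o 0 _ _ _ oT (@Ck_cst _ _ R^o 0 _ _) (sgC 2%N 0%N)).
  by move=> y ly; rewrite v0// scaler0.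
Qed.

(** Green's identity: integrate the divergence of [sg_j grad v - v grad sg_j]. The right-hand side
    is the Laplacian of [sg_j], rewritten with [sgS]. *)
Lemma cl_int_sg_laplacian l j v : l < L -> Ck 2 setT v -> vanishes_beyond l v ->
  cl_int (fun y => sg j y *: laplacian v y) =
  (2 * j%:R * (2 * (j%:R + 1) - n.+1%:R)) *: cl_int (fun y => sg j.+1 y *: v y)
  - (4 * j%:R * (j%:R + 1) * e) *: cl_int (fun y => sg j.+2 y *: v y).
Proof.
move=> lL vC v0; have oT : open [set: pt] := openT.
have sgC i k : Ck k setT (sg i : pt -> R^o) by exact: Ck_sg.
have vCi i : Ck 1 setT (fun y => 'D_(ei i) v y) := Ck_partial i vC.
(* [ds i] is the i-th partial derivative of [sg j], and [dds] below is its Laplacian. *)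
pose ds i (y : pt) : R := 2 * j%:R * (x ord0 i - y ord0 i) * sg j.+1 y.
have dsE i y : ds i y = (2 * j%:R) *: ((x ord0 i - y ord0 i) *: (sg j.+1 y : R^o)).
  by rewrite /ds !scale_regE mulrA.
have dsC i k : Ck k setT (ds i : pt -> R^o).
  rewrite (funext (dsE i)).
  apply: (@Ck_scale _ _ R^o k _ _ _ oT (@Ck_cst _ _ R^o k _ _)).
  exact: (@Ck_scale _ _ R^o k _ _ _ oT (Ck_coord_sub x k i oT) (sgC _ k)).
pose F i (y : pt) : cl := sg j y *: 'D_(ei i) v y - ds i y *: v y.
have FC i : Ck 1 setT (F i).
  apply: (Ck_add oT (Ck_scale oT (sgC j 1%N) (vCi i))).
  exact: (Ck_opp oT (Ck_scale oT (dsC i 1%N) (Ck_pred vC))).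
have v0i i : vanishes_beyond l (fun y => 'D_(ei i) v y).
  exact: (@vanishes_beyond_derive R n cl l v (ei i) v0).
have F0 i : vanishes_beyond l (F i).
  by move=> y ly; rewrite /F v0// v0i// !scaler0 subrr.
have dv y i : is_derive y (ei i) v ('D_(ei i) v y).
  exact: Ck_setT_is_derive vC.
have ddv y i : is_derive y (ei i) (fun z => 'D_(ei i) v z) (partial i (partial i v) y).
  exact: Ck_setT_is_derive (vCi i).
have dsD y i : is_derive y (ei i) (ds i : pt -> R^o)
    (2 * j%:R * (- sg j.+1 y + (x ord0 i - y ord0 i) *
       (2 * j.+1%:R * (x ord0 i - y ord0 i) * sg j.+2 y))).
  rewrite (funext (dsE i)).
  have := is_derive_scale (is_derive_cst (2 * j%:R : R^o) y (ei i))
     (is_derive_scale (is_derive_coord_sub x y (ei i) i) (is_derive_sg x e0 j.+1 y i)).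
  by rewrite scale0r add0r !scale_regE mxE !eqxx mulN1r.
pose dds (y : pt) : R := 2 * j%:R * (2 * (j%:R + 1) - n.+1%:R) * sg j.+1 y
   - 4 * j%:R * (j%:R + 1) * e * sg j.+2 y.
have D y : \sum_i 'D_(ei i) (F i) y = sg j y *: laplacian v y - dds y *: v y.
  transitivity (\sum_i (sg j y *: partial i (partial i v) y -
     (2 * j%:R * (- sg j.+1 y + (x ord0 i - y ord0 i) *
       (2 * j.+1%:R * (x ord0 i - y ord0 i) * sg j.+2 y))) *: v y)).
    apply: eq_bigr => i _.
    have H1 := is_derive_scale (is_derive_sg x e0 j y i) (ddv y i).
    have H : is_derive y (ei i) (F i) _ := is_deriveB H1 (is_derive_scale (dsD y i) (dv y i)).
    by have [_ ->] := H; exact: addr_sub_swap.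
  rewrite sumrB -scaler_sumr -scaler_suml; congr (_ - _ *: _).
  rewrite -mulr_sumr big_split /= sumr_const card_ord.
  have -> : \sum_i (x ord0 i - y ord0 i) * (2 * j.+1%:R * (x ord0 i - y ord0 i) * sg j.+2 y)
     = 2 * j.+1%:R * sg j.+2 y * sqnorm (x - y).
    by rewrite /sqnorm mulr_sumr; apply: eq_bigr => i _; rewrite !mxE; ring.
  rewrite /dds -(sgS x e0 j.+1 y) -mulr_natl -(natr1 j); ring.
have b1 i : bounded_on (fun y => sg i y *: v y).
  apply: (@Ck_vanishes_bounded cl 1 l).
    exact: (Ck_scale oT (sgC i 1%N) (Ck_pred vC)).
  by move=> y ly; rewrite v0// scaler0.
rewrite -!cl_intZ// -cl_intB//; try exact: bounded_on_Zcst.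
apply/eqP; rewrite -subr_eq0 -cl_intB//.
- apply/eqP; rewrite -(cl_int_divergence lL FC F0); congr cl_int.
  by apply/funext => y; rewrite D /dds scalerBl !scalerA.
- apply: (@Ck_vanishes_bounded cl 0 l).
    exact: (Ck_scale oT (sgC j 0%N) (Ck_laplacian oT vC)).
  have lv0 : vanishes_beyond l (laplacian v) := @vanishes_beyond_laplacian R n l 1 v v0.
  by move=> y ly; rewrite lv0// scaler0.
- by apply: bounded_onB; exact: bounded_on_Zcst.
Qed.

End Regularization.

(** * The iterated Laplacian of the potential in dimension 2m+2 *)

Section IteratedLaplacian.
Variables (R : realType) (m : nat).

(* Coefficients of [Delta^k (2 m sg_1 + 2 e sg_2)] on [e^l sg_(k+1+l)] in
   dimension 2m+2; for [k = m] the product vanishes except at [l = m+1]. *)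
Definition lap_coef (k l : nat) : R :=
  2 * (-4) ^+ k * (k + l)`!%:R * 'C(k.+1, l)%:R *
  \prod_(l <= i < k.+1) (m%:R - i%:R).

Lemma lap_coef0 k : lap_coef k.+1 0 = - 4 * k.+1%:R * (m%:R - k.+1%:R) * lap_coef k 0.
Proof.
rewrite /lap_coef !addn0 !bin0 factS natrM exprS big_nat_recr//=; ring.
Qed.

(** Besides the recurrences of the factorial and of the product, this is Pascal's rule together with
    [(l+1) C(k+1,l+1) = (k+1-l) C(k+1,l)]: the difference of the two sides is a multiple of the
    latter. For [l = k+1] the first term vanishes. *)
Lemma lap_coefS k l : (l <= k.+1)%N -> lap_coef k.+1 l.+1 =
  - 4 * (k.+2 + l)%:R * (m%:R - (k.+2 + l)%:R) * lap_coef k l.+1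
  - 4 * (k.+1 + l)%:R * (k.+2 + l)%:R * lap_coef k l.
Proof.
rewrite leq_eqVlt => /orP[/eqP->|]; rewrite /lap_coef.
  rewrite [in 'C(k.+1, k.+2)]bin_small// mulr0 mul0r mulr0 sub0r.
  rewrite !binn !big_geq// !addSn !addnS !factS !natrM exprS; ring.
rewrite ltnS => lk; rewrite (big_nat_recr k.+1)//= (big_ltn (m := l))//=.
set P := \prod_(l.+1 <= i < k.+1) _.
have B : (l.+1%:R * 'C(k.+1, l.+1)%:R : R) = (k.+1%:R - l%:R) * 'C(k.+1, l)%:R.
  by rewrite -natrB ?leqW// -!natrM mul_bin_left.
have -> : 'C(k.+2, l.+1)%:R = 'C(k.+1, l.+1)%:R + 'C(k.+1, l)%:R :> R.
  by rewrite binS natrD.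
have F1 : (k + l.+1)`!%:R = (k.+1 + l)%:R * (k + l)`!%:R :> R by rewrite addnS factS natrM addSn.
have F2 : (k.+1 + l.+1)`!%:R = (k.+2 + l)%:R * ((k.+1 + l)%:R * (k + l)`!%:R) :> R.
  by rewrite addSn addnS !factS !natrM !addSn.
rewrite F1 F2 exprS; move: B {F1 F2}.
set f := (k + l)`!%:R; set c1 := 'C(k.+1, l.+1)%:R; set c0 := 'C(k.+1, l)%:R.
set q := (-4) ^+ k => B; apply/eqP; rewrite -subr_eq0.
rewrite (_ : _ - _ = 2 * (-4 * q) * (k.+2 + l)%:R * (k.+1 + l)%:R * f * P *
   (l.+1%:R * c1 - (k.+1%:R - l%:R) * c0)); first by rewrite B subrr mulr0.
ring.
Qed.

Lemma lap_coef_top l : (l <= m)%N -> lap_coef m l = 0.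
Proof.
by move=> lm; rewrite /lap_coef big_nat_recr//= subrr !mulr0.
Qed.

Definition bubble_const : R := lap_coef m m.+1.

Lemma bubble_constE : bubble_const = 2 * (-4) ^+ m * (m + m.+1)`!%:R.
Proof. by rewrite /bubble_const /lap_coef binn big_geq// !mulr1. Qed.

Lemma bubble_const_neq0 : bubble_const != 0.
Proof.
rewrite bubble_constE !mulf_neq0 ?expf_neq0 ?oppr_eq0 ?pnatr_eq0//.
by rewrite -lt0n fact_gt0.
Qed.

Variable L : R.
Hypothesis L_gt0 : 0 < L.
Local Notation n := m.*2.+1.
Local Notation pt := 'rV[R]_n.+1.
Local Notation cl := (clifford R n).
Variables (x : pt) (e : R).
Hypothesis e0 : 0 < e.
Local Notation sg := (sg x e).
Local Notation cl_int := (cl_int L).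
Implicit Types (u v : pt -> cl).

Lemma bounded_sg_scale j l v : Ck 0 setT v -> vanishes_beyond l v ->
  bounded_on (fun y => sg j y *: v y).
Proof.
move=> vC v0; apply: (@Ck_vanishes_bounded R n cl 0 l).
  exact: (Ck_scale openT (Ck_sg x e0 0 j openT) vC).
by move=> y ly; rewrite v0// scaler0.
Qed.

(** The induction hypothesis is applied to [laplacian v], and Green's identity then moves the
    remaining Laplacian. A term of index [i] contributes to the indices [i] and [i + 1], which is
    the recurrence of [lap_coef]. *)
Lemma cl_int_reg_iter k l v : l < L -> Ck k.*2 setT v -> vanishes_beyond l v ->
  cl_int (fun y => reg_potential x e y *: iter k (@laplacian R n) v y) =
  \sum_(i < k.+2) (lap_coef k i * e ^+ i) *: cl_int (fun y => sg (k.+1 + i) y *: v y).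
Proof.
move=> lL; elim: k v => [|k IH] v vC v0.
  rewrite big_ord_recl big_ord1 /lap_coef /= !addn0 !expr0 !mulr1 expr1.
  have bs j := bounded_sg_scale j vC v0.
  rewrite -!cl_intZ// -cl_intD//; try exact: bounded_on_Zcst.
  congr cl_int; apply/funext => y; rewrite !scalerA -scalerDl; congr (_ *: _).
  have E : m.*2.+2%:R - 2 = 2 * m%:R :> R by rewrite -addnn; ring.
  by rewrite /reg_potential E /bump /= big_nat1 big_geq// addn0; ring.
have vC2 : Ck 2 setT v by apply: Ck_le vC; lia.
have lC : Ck k.*2 setT (laplacian v) by apply: Ck_laplacian => //; exact: openT.
have l0 : vanishes_beyond l (laplacian v) := @vanishes_beyond_laplacian R n l 1 v v0.
under eq_fun do rewrite iterSr; rewrite IH//.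
pose T j := cl_int (fun y => sg j y *: v y).
rewrite -/(T _).
under eq_bigr => i _.
  rewrite (cl_int_sg_laplacian L_gt0 x e0 (k.+1 + i) lL vC2 v0) -!/(T _).
  rewrite scalerBr !scalerA; over.
rewrite sumrB.
have -> : \sum_(i < k.+2) (lap_coef k i * e ^+ i *
      (2 * (k.+1 + i)%:R * (2 * ((k.+1 + i)%:R + 1) - n.+1%:R))) *: T (k.+1 + i).+1
  = \sum_(i < k.+3) (- 4 * (k.+1 + i)%:R * (m%:R - (k.+1 + i)%:R) * lap_coef k i * e ^+ i) *: T (k.+2 + i)%N.
  have top : lap_coef k k.+2 = 0 by rewrite /lap_coef bin_small// mulr0 mul0r.
  rewrite [RHS]big_ord_recr /= top mulr0 mul0r scale0r addr0.
  apply: eq_bigr => i _; rewrite addSn; congr (_ *: _).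
  rewrite -addnn; ring.
rewrite big_ord_recl [RHS]big_ord_recl -addrA; congr (_ + _).
  by rewrite /= !addn0 lap_coef0.
rewrite -sumrB; apply: eq_bigr => i _; rewrite /= /bump /= add1n.
rewrite lap_coefS; last by rewrite -ltnS ltn_ord.
rewrite !addnS !addSn -scalerBl; congr (_ *: _).
rewrite exprS; ring.
Qed.

Lemma cl_int_bubble l u : l < L -> Ck n setT u -> vanishes_beyond l u ->
  cl_int (fun y => sg 1 y *: (conj_diff x y * dirac_op (iter m (@laplacian R n) u) y)) =
  (bubble_const * e ^+ m.+1) *: cl_int (fun y => sg n.+1 y *: u y).
Proof.
move=> lL uC u0; rewrite (cl_int_reg_dirac L_gt0 x e0 lL); first last.
- exact: vanishes_beyond_laplacian.
- by apply: Ck_iter_laplacian; [exact: openT|rewrite add1n].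
rewrite (cl_int_reg_iter lL (Ck_le (leqnSn _) uC) u0).
rewrite big_ord_recr big1 /= => [|i _].
  by rewrite add0r addSn addnS addnn.
have im : leq i m by rewrite -ltnS ltn_ord.
by rewrite (lap_coef_top im) mul0r scale0r.
Qed.

End IteratedLaplacian.

(** * The reproduction formula *)

Section Cutoff.
Variables (R : realType).

(** Only finite smoothness is required of the cutoffs. Truncated powers provide it, with derivatives
    in the same family. *)
Definition pos_pow (j : nat) (t : R) : R := Num.max t 0 ^+ j.

Lemma pos_powS j t : (0 < j)%N -> pos_pow j.+1 t = t * pos_pow j t.
Proof.
move=> j0; rewrite /pos_pow exprS; case: (leP t 0) => // t0.
by rewrite expr0n gtn_eqF// !mulr0.
Qed.

Lemma pos_pow_continuous j : continuous (pos_pow j).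
Proof.
move=> t; apply: (@continuous_comp _ _ _ (fun s : R => Num.max s 0) (fun s => s ^+ j)).
  by apply: continuous_max; [exact: cvg_id|exact: cvg_cst].
exact: exprn_continuous.
Qed.

Lemma is_derive_pos_pow2 t : is_derive t (1 : R) (pos_pow 2) (2 * pos_pow 1 t).
Proof.
have [t0|t0|t0] := ltgtP t 0.
- have -> : 2 * pos_pow 1 t = 0 by rewrite /pos_pow max_r ?ltW// expr1 mulr0.
  refine (near_eq_is_derive _ (@is_derive_cst R R^o R^o 0 t 1)).
  near=> s; have s0 : s < 0 by near: s; exact: lt_nbhsl.
  by rewrite /pos_pow max_r ?expr0n// ltW.
- apply: (@near_eq_is_derive _ _ _ (fun s : R => s ^+ 2)).
    near=> s; have s0 : 0 < s by near: s; exact: lt_nbhsr.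
    by rewrite /pos_pow max_l// ltW.
  apply: is_derive_eq; rewrite /pos_pow max_l ?ltW// expr1 /GRing.scale /=.
  by ring.
- rewrite t0; suff H : (fun h => h^-1 *: ((pos_pow 2 \o shift 0) (h *: 1) - pos_pow 2 0)) @
      0^' --> 2 * pos_pow 1 0.
    by split; [apply/cvg_ex; eexists; exact: H|exact: cvg_lim H].
  have E : 2 * pos_pow 1 0 = pos_pow 1 0 by rewrite /pos_pow maxxx expr1 mulr0.
  rewrite E.
  have C : pos_pow 1 @ 0^' --> pos_pow 1 0.
    by apply: cvg_within_filter; exact: pos_pow_continuous.
  apply: cvg_trans C; apply: near_eq_cvg; near=> h.
  have h0 : h != 0 by near: h; exact: nbhs_dnbhs_neq.
  have -> : (pos_pow 2 \o shift 0) (h *: 1) = h * pos_pow 1 h.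
    by rewrite /= addr0 [h%:A]mulr1 pos_powS.
  rewrite [pos_pow 2 0]/pos_pow maxxx expr0n/= subr0.
  by rewrite scale_regE (mulKf h0).
Unshelve. all: by end_near. Qed.

(** Writing each power as [t] times the preceding one reduces the behaviour at the corner 0 to the
    exponent 2. *)
Lemma is_derive_pos_pow j t : (1 < j)%N ->
  is_derive t (1 : R) (pos_pow j) (j%:R * pos_pow j.-1 t).
Proof.
case: j => // -[//|j] _; elim: j => [|j IH] /=; first exact: is_derive_pos_pow2.
have -> : pos_pow j.+3 = (fun s => s *: (pos_pow j.+2 s : R^o)).
  by apply/funext => s; exact: pos_powS.
have H := is_derive_scale (@is_derive_id R R^o t 1) (IH : is_derive t _ (_ : R -> R^o) _).
apply: is_derive_eq H _; rewrite scale_regE mul1r scale_regE mulrCA -pos_powS//.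
by rewrite -[j.+3%:R]natr1 (mulrDl j.+2%:R) mul1r addrC.
Qed.

Variable n : nat.
Local Notation pt := 'rV[R]_n.+1.

(** The thresholds [a] and [b] are squared Euclidean distances. The inner truncated power is 0 up to
    [a] and at least 1 from [b] on; the outer one truncates its complement to 0 there. *)
Definition cutoff (k : nat) (x : pt) (a b : R) (y : pt) : R :=
  pos_pow k.+1 (1 - pos_pow k.+1 ((sqnorm (x - y) - a) / (b - a))).

Lemma pos_pow_le0 j t : t <= 0 -> pos_pow j.+1 t = 0.
Proof. by move=> t0; rewrite /pos_pow max_r// expr0n. Qed.

Lemma pos_pow_ge1 j t : 1 <= t -> 1 <= pos_pow j.+1 t.
Proof.
move=> t1; rewrite /pos_pow max_l ?(le_trans ler01 t1)//.
exact: exprn_ege1.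
Qed.

Lemma pos_pow_ge0 j t : 0 <= pos_pow j t.
Proof. by rewrite exprn_ge0// le_max lexx orbT. Qed.

Lemma cutoff_in k x a b y : a < b -> sqnorm (x - y) <= a -> cutoff k x a b y = 1.
Proof.
move=> ab ya; rewrite /cutoff (pos_pow_le0 k (t := _ / _)).
  by rewrite subr0 /pos_pow max_l// expr1n.
by rewrite pmulr_lle0 ?invr_gt0 ?subr_gt0// subr_le0.
Qed.

Lemma cutoff_out k x a b y : a < b -> b <= sqnorm (x - y) -> cutoff k x a b y = 0.
Proof.
move=> ab yb; rewrite /cutoff pos_pow_le0// subr_le0 pos_pow_ge1//.
by rewrite ler_pdivlMr ?subr_gt0// mul1r lerD2r.
Qed.

Lemma cutoff_ge0 k x a b y : 0 <= cutoff k x a b y.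
Proof. exact: pos_pow_ge0. Qed.

Lemma Ck_cutoff k x a b Om : open Om -> Ck k Om (cutoff k x a b : pt -> R^o).
Proof.
move=> oO.
have comp (g : pt -> R) : Ck k Om (g : pt -> R^o) ->
    Ck k Om ((fun y => pos_pow k.+1 (g y)) : pt -> R^o).
  move=> gC; apply: (@Ck_comp R n pos_pow (fun j => j%:R)) => //.
    by move=> j _; exact: pos_pow_continuous.
  by move=> j t; exact: is_derive_pos_pow.
have C1 : Ck k Om ((fun y => (sqnorm (x - y) - a) / (b - a)) : pt -> R^o).
  have -> : (fun y => (sqnorm (x - y) - a) / (b - a)) =
      fun y => (b - a)^-1 *: (sqnorm (x - y) - a : R^o).
    by apply/funext => y; rewrite mulrC.
  apply: (@Ck_scale _ _ R^o k _ _ _ oO (@Ck_cst _ _ R^o k _ _)).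
  exact: (@Ck_add _ _ R^o k _ _ _ oO (Ck_sqnorm_sub x k oO) (@Ck_cst _ _ R^o k _ _)).
have C2 := comp _ C1; apply: comp.
exact: (@Ck_add _ _ R^o k _ _ _ oO (@Ck_cst _ _ R^o k _ _) (@Ck_opp _ _ R^o k _ _ oO C2)).
Qed.

End Cutoff.

Lemma sub_telescope (V : zmodType) (a b p q : V) :
  a - q = a - (b + p) + b + (p - q).
Proof. by rewrite opprD !addrA (addrAC (a - b)) !subrK. Qed.

(** * Locality of the differential operators *)

Section LocalOperators.
Variables (R : realType) (n : nat).
Local Notation pt := 'rV[R]_n.+1.
Local Notation cl := (clifford R n).
Implicit Types (u v : pt -> cl) (Om : set pt).

Definition dirac_lap m u : pt -> cl := dirac_op (iter m (@laplacian R n) u).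

Lemma partial_eq_on i Om u v : open Om -> {in Om, u =1 v} ->
  {in Om, partial i u =1 partial i v}.
Proof. by move=> oO uv x /set_mem Ox; exact: (derive_eq_on _ oO uv Ox). Qed.

Lemma laplacian_eq_on k Om u v : open Om -> {in Om, u =1 v} ->
  {in Om, iter k (@laplacian R n) u =1 iter k (@laplacian R n) v}.
Proof.
move=> oO uv; elim: k => [|k IH]; first exact: uv.
move=> x Ox; rewrite !iterS; apply: eq_bigr => i _.
by apply: (partial_eq_on i oO _ Ox); exact: partial_eq_on.
Qed.

Lemma dirac_lap_eq_on m Om u v : open Om -> {in Om, u =1 v} ->
  {in Om, dirac_lap m u =1 dirac_lap m v}.
Proof.
move=> oO uv x Ox; apply: eq_bigr => i _; congr (_ * _).
by apply: (partial_eq_on i oO _ Ox); exact: laplacian_eq_on.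
Qed.

Lemma partial_cst i (w : cl) : partial i (fun _ : pt => w) = fun _ => 0.
Proof. by apply/funext => x; exact: derive_cst. Qed.

Lemma laplacian_cst (w : cl) : laplacian (fun _ : pt => w) = fun _ => 0.
Proof.
by apply/funext => x; apply: big1 => i _; rewrite !partial_cst.
Qed.

Lemma dirac_lap_cst m (w : cl) x : dirac_lap m (fun _ : pt => w) x = 0.
Proof.
have [w' E] : exists w', iter m (@laplacian R n) (fun _ : pt => w) = fun _ => w'.
  elim: m => [|m [w' IH]] /=; first by exists w.
  by exists 0; rewrite IH laplacian_cst.
by rewrite /dirac_lap E; apply: big1 => i _; rewrite partial_cst mulr0.
Qed.

Lemma vanishes_beyond_dirac_lap m l u : vanishes_beyond l u -> vanishes_beyond l (dirac_lap m u).
Proof.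
move=> u0 y ly; apply: big1 => i _.
rewrite (_ : partial i _ y = 0) ?mulr0//.
by apply: (@vanishes_beyond_derive R n cl l _ _ _ y ly); exact: vanishes_beyond_laplacian.
Qed.

Lemma Ck_dirac_lap m Om u : open Om -> Ck m.*2.+1 Om u -> Ck 0 Om (dirac_lap m u).
Proof. by move=> oO uC; exact: (Ck_dirac oO (@Ck_iter_laplacian R n 1 m Om u oO uC)). Qed.

Lemma norm_le_small (V : normedModType R) (z : V) (K : R) :
  (forall h, 0 < h -> `|z| <= h * K) -> z = 0.
Proof.
move=> zK; apply/eqP; rewrite -normr_eq0; apply/negPn/negP => z0.
have zp : 0 < `|z| by rewrite lt0r z0 normr_ge0.
have K1 : 0 < `|K| + 1 by rewrite ltr_wpDl.
have := zK (`|z| / (2 * (`|K| + 1))); rewrite divr_gt0 ?mulr_gt0// => /(_ isT).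
apply/negP; rewrite -ltNge mulrAC ltr_pdivrMr ?mulr_gt0// ltr_pM2l//.
by have := ler_norm K; lra.
Qed.

Lemma open_dist_lt (x : pt) d : open [set y : pt | `|y - x| < d].
Proof.
apply: (@open_comp _ _ (fun y : pt => `|y - x|) [set t | t < d]); last exact: open_lt.
move=> y _; apply: (@continuous_comp _ _ _ (fun y : pt => y - x) (fun z => `|z|)).
  exact: (cvgB (@cvg_id _ (nbhs y)) (cvg_cst x)).
exact: norm_continuous.
Qed.

Lemma sqnorm_ge_dist (x y : pt) d : 0 <= d -> d <= `|y - x| -> d ^+ 2 <= sqnorm (x - y).
Proof.
move=> d0 dy; apply: le_trans (norm_sqr_le_sqnorm _).
by rewrite distrC ler_pXn2r ?nnegrE.
Qed.

End LocalOperators.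

(** * Bubbles as an approximate identity *)

Section Reproduction.
Variables (R : realType) (m : nat) (r : R).
Hypothesis r0 : 0 < r.
Local Notation n := m.*2.+1.
Local Notation pt := 'rV[R]_n.+1.
Local Notation cl := (clifford R n).
Local Notation L := (8 * r).
Local Notation dl := (dirac_lap m).
Local Notation cl_int := (cl_int L).
Local Notation c0 := (bubble_const R m).
Implicit Types (u : pt -> cl) (x : pt).

Let L_gt0 : 0 < L. Proof. by rewrite mulr_gt0. Qed.

(** The exponents balance in dimension 2m+2: the substitution [z = sqrt e w] removes [e] from the
    integral over the whole space. *)
Definition bubble x e (y : pt) : R := e ^+ m.+1 * sg x e n.+1 y.

Lemma bubble_ge0 x e y : 0 < e -> 0 <= bubble x e y.
Proof. by move=> e0; exact: (mulr_ge0 (exprn_ge0 _ (ltW e0)) (ltW (sg_gt0 x e0 n.+1 y))). Qed.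

Lemma bubble_far x e d y : 0 < e <= 1 -> 0 < d -> d <= `|y - x| ->
  bubble x e y <= e * (d ^+ 2)^-1 ^+ n.+1.
Proof.
move=> /andP[e0 e1] d0 dy; rewrite /bubble ler_pM ?exprn_ge0 ?(ltW e0)//.
- by rewrite invr_ge0 ltW// sg_den_gt0.
- by rewrite exprS -[leRHS]mulr1 ler_wpM2l ?(ltW e0)// exprn_ile1 ?(ltW e0).
- rewrite /sg ler_pXn2r ?nnegrE ?invr_ge0 ?sqr_ge0//; last first.
    by rewrite addr_ge0 ?sqnorm_ge0// ltW.
  rewrite lef_pV2 ?posrE ?exprn_gt0 ?sg_den_gt0//.
  by rewrite (le_trans (sqnorm_ge_dist (ltW d0) dy))// lerDl ltW.
Qed.

Section Approximation.
Variables (l : R) (u : pt -> cl) (x : pt) (d : R).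
Hypotheses (lL : l < L) (uC : Ck n setT u) (u0 : vanishes_beyond l u).
Hypotheses (d0 : 0 < d) (dlu0 : forall y, `|y - x| < d -> dl u y = 0).

(** Where [dl u] is nonzero, [t = |x - y|^2] is at least [d^2], and [1/t - 1/(t+e) = e / (t (t+e))]
    is at most [e / d^4]. *)
Lemma reg_kernel_close :
  exists2 K, 0 <= K & forall e y, 0 < e ->
    `|(paravector (x - y))^-1 * dl u y - sg x e 1 y *: (conj_diff x y * dl u y)| <= K * e.
Proof.
have [B hB] : bounded_on (fun y => conj_diff x y * dl u y).
  apply: (@Ck_vanishes_bounded R n cl 0 l).
    by apply: Ck_conj_diffM; exact: (Ck_dirac_lap openT uC).
  by move=> y ly; rewrite (vanishes_beyond_dirac_lap m u0 ly) mulr0.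
have B0 : 0 <= B := le_trans (normr_ge0 _) (hB 0).
exists ((d ^+ 2 * d ^+ 2)^-1 * B) => [|e y e0].
  by rewrite mulr_ge0// invr_ge0 mulr_ge0// sqr_ge0.
have [yd|dy] := ltP `|y - x| d.
  rewrite dlu0// !mulr0 scaler0 subrr normr0 !mulr_ge0 ?(ltW e0)//.
  by rewrite invr_ge0 mulr_ge0// sqr_ge0.
have td := sqnorm_ge_dist (ltW d0) dy.
have d2 : 0 < d ^+ 2 by rewrite exprn_gt0.
have xy : x - y != 0 by rewrite -sqnorm_eq0 gt_eqF// (lt_le_trans d2 td).
rewrite paravectorV// -scalerAl -scalerBl normrZ -mulrA [_ * e]mulrC mulrA.
apply: ler_pM (normr_ge0 _) (normr_ge0 _) _ (hB y).
rewrite /sg expr1; set t := sqnorm (x - y) in td *.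
have t0 : 0 < t by exact: lt_le_trans d2 td.
have te : 0 < t + e by rewrite addr_gt0.
have -> : t^-1 - (t + e)^-1 = e / (t * (t + e)).
  by field; rewrite !gt_eqF.
rewrite gtr0_norm ?divr_gt0 ?mulr_gt0// mulrC ler_wpM2r ?(ltW e0)//.
rewrite lef_pV2 ?posrE ?mulr_gt0// ler_pM ?(ltW d2)//.
by rewrite (le_trans td)// lerDl ltW.
Qed.

Lemma bounded_reg e : 0 < e -> bounded_on (fun y => sg x e 1 y *: (conj_diff x y * dl u y)).
Proof.
move=> e0; apply: (@Ck_vanishes_bounded R n cl 0 l).
  apply: (Ck_scale openT (Ck_sg x e0 0 1 openT)).
  by apply: Ck_conj_diffM; exact: (Ck_dirac_lap openT uC).
by move=> y ly; rewrite (vanishes_beyond_dirac_lap m u0 ly) mulr0 scaler0.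
Qed.

(** The singular kernel inherits a bound from its regularization at [e = 1]. *)
Lemma bounded_kernel : bounded_on (fun y => (paravector (x - y))^-1 * dl u y).
Proof.
have [K K0 hK] := reg_kernel_close; have [B hB] := bounded_reg ltr01.
exists (K * 1 + B) => y.
set a := (X in `|X| <= _); set b := sg x 1 1 y *: (conj_diff x y * dl u y).
apply: (le_trans _ (lerD (hK 1 y ltr01) (hB y))).
by rewrite -{1}(subrK b a) ler_normD.
Qed.

Lemma kernel_int_close :
  exists2 K, 0 <= K & forall e, 0 < e ->
    `|cl_int (fun y => (paravector (x - y))^-1 * dl u y)
      - c0 *: cl_int (fun y => bubble x e y *: u y)| <= K * e.
Proof.
have [K K0 hK] := reg_kernel_close.
exists ((2 * L) ^+ n.+1 * K) => [|e e0].
  by rewrite mulr_ge0// exprn_ge0// ltW// mulr_gt0.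
have -> : c0 *: cl_int (fun y => bubble x e y *: u y) =
    cl_int (fun y => sg x e 1 y *: (conj_diff x y * dl u y)).
  rewrite (cl_int_bubble L_gt0 x e0 lL uC u0) -scalerA; congr (_ *: _).
  have bs := bounded_sg_scale x e0 n.+1 (Ck_le (leq0n _) uC) u0.
  rewrite -(cl_intZ L_gt0 (e ^+ m.+1) bs).
  by congr (cl_int _); apply/funext => y; rewrite scalerA.
rewrite -(cl_intB L_gt0 bounded_kernel (bounded_reg e0)).
rewrite -mulrA; apply: norm_cl_int_le_cst => // y; exact: hK.
Qed.

End Approximation.

(** Off the ball where [u] vanishes the bubble is O(e), so the integral is smaller than any positive
    number. The point [x] is not confined to the ball of radius [r]: inner shells are tested at
    arbitrarily distant points. *)
Lemma kernel_int_eq0 l u x d : l < L -> Ck n setT u -> vanishes_beyond l u ->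
  0 < d -> (forall y, `|y - x| < d -> u y = 0) ->
  cl_int (fun y => (paravector (x - y))^-1 * dl u y) = 0.
Proof.
move=> lL uC u0 d0 ux.
have dlu0 y : `|y - x| < d -> dl u y = 0.
  move=> yd; rewrite (dirac_lap_eq_on (v := fun _ => 0) m (@open_dist_lt R n x d)).
  - exact: dirac_lap_cst.
  - by move=> z; rewrite inE /=; exact: ux.
  - by rewrite inE.
have [K K0 hK] := kernel_int_close lL uC u0 d0 dlu0.
have [B hB] : bounded_on u.
  exact: (Ck_vanishes_bounded uC u0).
have B0 : 0 <= B := le_trans (normr_ge0 _) (hB 0).
set D := (d ^+ 2)^-1 ^+ n.+1.
have D0 : 0 <= D by rewrite exprn_ge0// invr_ge0 sqr_ge0.
apply: (@norm_le_small R _ _ (K + `|c0| * ((2 * L) ^+ n.+1 * (D * B)))) => h h0.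
pose e := Num.min h 1.
have e0 : 0 < e by rewrite lt_min h0 ltr01.
have e1 : e <= 1 by rewrite ge_min lexx orbT.
have eh : e <= h by rewrite ge_min lexx.
set A := cl_int _; set b := c0 *: cl_int (fun y => bubble x e y *: u y).
have L0 : 0 <= (2 * L) ^+ n.+1 by rewrite exprn_ge0// ltW// mulr_gt0.
apply: (@le_trans _ _ (e * (K + `|c0| * ((2 * L) ^+ n.+1 * (D * B))))); last first.
  apply: ler_wpM2r eh; apply: (addr_ge0 K0); apply: (mulr_ge0 (normr_ge0 _)).
  exact: (mulr_ge0 L0 (mulr_ge0 D0 B0)).
rewrite -(subrK b A) (le_trans (ler_normD _ _))// mulrDr lerD//.
  by rewrite mulrC; exact: hK.
rewrite normrZ mulrCA ler_wpM2l// mulrCA; apply: norm_cl_int_le_cst => // y.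
have [yd|dy] := ltP `|y - x| d.
  by rewrite ux// scaler0 normr0; exact: (mulr_ge0 (ltW e0) (mulr_ge0 D0 B0)).
rewrite normrZ mulrA; apply: ler_pM (normr_ge0 _) (normr_ge0 _) _ (hB y).
by rewrite ger0_norm ?bubble_ge0//; apply: bubble_far => //; rewrite e0.
Qed.

Lemma cl_int_scale_cst (g : pt -> R) (w : cl) : bounded_on (g : pt -> R^o) ->
  cl_int (fun y => g y *: w) = box_int L g *: w.
Proof.
move=> gb; apply/rowP => k; rewrite !mxE [RHS]mulrC -(box_intZ L_gt0 _ gb).
by congr (box_int _ _); apply/funext => y; rewrite mxE mulrC.
Qed.

(** A test function equal to 1 near [x], by which both the mass of the bubble and the value [u x]
    are localized inside the box. *)
Definition bump x : pt -> R := cutoff n x (r ^+ 2 / 4) (r ^+ 2).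

Let r2 : 0 < r ^+ 2. Proof. by rewrite exprn_gt0. Qed.
Let bump_ab : r ^+ 2 / 4 < r ^+ 2. Proof. by move: r2; lra. Qed.

Lemma Ck_bump x : Ck n setT (bump x : pt -> R^o).
Proof. exact: (Ck_cutoff n x _ _ openT). Qed.

Lemma bump_vanishes x : `|x| <= r -> vanishes_beyond (2 * r) (bump x : pt -> R^o).
Proof.
move=> xr y ly; apply: cutoff_out => //.
apply: (sqnorm_ge_dist (ltW r0)).
by have := lerB_dist y x; move: xr ly; lra.
Qed.

Lemma bump_near x : exists2 d, 0 < d & (d <= r) /\ forall y, `|y - x| <= d -> bump x y = 1.
Proof.
(* In dimension n+1 a sup-norm ball of radius [d] lies in the Euclidean ball of squared radius
   [(n+1) d^2], here at most [r^2 / 4]. *)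
exists (r / (2 * n.+1%:R)); first by rewrite divr_gt0// mulr_gt0.
have n1 : 1 <= n.+1%:R :> R by rewrite ler1n.
split=> [|y yd].
  by rewrite ler_pdivrMr ?mulr_gt0// ler_peMr ?(ltW r0)//; move: n1; lra.
apply: cutoff_in => //; apply: (le_trans (sqnorm_le_norm _)).
rewrite distrC; apply: (@le_trans _ _ (n.+1%:R * (r / (2 * n.+1%:R)) ^+ 2)).
  by rewrite ler_pM2l// ler_pXn2r// nnegrE// divr_ge0// ?(ltW r0)// mulr_ge0.
have -> : n.+1%:R * (r / (2 * n.+1%:R)) ^+ 2 = (r ^+ 2 / 4) / n.+1%:R.
  by field; rewrite gt_eqF.
by rewrite ler_pdivrMr// ler_peMr// divr_ge0// ltW.
Qed.

Definition bubble_mass x e : R := box_int L (fun y => bubble x e y * bump x y).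

Lemma Ck_bubble x e k : 0 < e -> Ck k setT (bubble x e : pt -> R^o).
Proof.
move=> e0; apply: (@Ck_scale _ _ R^o k _ _ _ openT (@Ck_cst _ _ R^o k _ _)).
exact: (Ck_sg x e0 k n.+1 openT).
Qed.

Lemma Ck_bubble_bump x e : 0 < e -> Ck 0 setT ((fun y => bubble x e y * bump x y) : pt -> R^o).
Proof.
move=> e0; apply: (@Ck_scale _ _ R^o 0 _ _ _ openT (Ck_bubble x 0 e0)).
exact: (Ck_le (leq0n _) (Ck_bump x)).
Qed.

Lemma bubble_bump_vanishes x e : `|x| <= r ->
  vanishes_beyond (2 * r) ((fun y => bubble x e y * bump x y) : pt -> R^o).
Proof. by move=> xr y ly; rewrite (bump_vanishes xr)// mulr0. Qed.

Lemma bounded_bubble_bump x e : 0 < e -> `|x| <= r ->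
  bounded_on ((fun y => bubble x e y * bump x y) : pt -> R^o).
Proof.
move=> e0 xr.
exact: (@Ck_vanishes_bounded R n R^o 0 _ _ (Ck_bubble_bump x e0) (bubble_bump_vanishes e xr)).
Qed.

Lemma bubble_mass_ge0 x e : 0 < e -> `|x| <= r -> 0 <= bubble_mass x e.
Proof.
move=> e0 xr; rewrite -[leLHS](mulr0 ((2 * L) ^+ n.+1)) -(@box_int_cst R n L L_gt0).
apply: le_box_int => //; [exact: bounded_on_cst|exact: bounded_bubble_bump|].
by move=> y; rewrite mulr_ge0 ?bubble_ge0// cutoff_ge0.
Qed.

(** The least point of the cube: [x - corner] has nonnegative coordinates whenever [|x| <= r], as
    [box_int_translate] demands. *)
Definition corner : pt := const_mx (- r).

Lemma norm_corner : `|corner| <= r.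
Proof.
apply: norm_rV_le => [|j]; first exact: ltW.
by rewrite mxE normrN gtr0_norm.
Qed.

(** Bubble and bump depend only on [x - y], so changing the centre is a translation. Its coordinates
    are at most [2 * r], and the box of half-side [8 * r] leaves a margin of [5 * r] around a
    support of radius [3 * r]. *)
Lemma bubble_mass_corner x e : 0 < e -> `|x| <= r ->
  bubble_mass x e = bubble_mass corner e.
Proof.
move=> e0 xr; have cg := Ck_setT_continuous (Ck_bubble_bump x e0).
have l23 : 2 * r < 3 * r by move: r0; lra.
have sg3 := vanishes_supp_in l23 (bubble_bump_vanishes e xr).
rewrite /bubble_mass -(box_int_translate L_gt0 (v := x - corner) cg sg3).
- congr (box_int _ _); apply/funext => y.
  have E : x - (y + (x - corner)) = corner - y by apply/rowP => j; rewrite !mxE; ring.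
  by rewrite /bubble /sg /bump /cutoff E.
- by rewrite mulr_ge0// ltW.
- move=> j; rewrite !mxE opprK; have := le_trans (norm_rV_coord x j) xr.
  by rewrite ler_norml => /andP[]; move: r0; lra.
Qed.

(** With [e = s^2], on the cube of radius [s] around [x] the denominator is at most [(n+2) s^2]. The
    powers of [s] cancel against the volume because [n + 1 = 2 (m + 1)]. *)
Lemma bubble_mass_lower x s d : `|x| <= r -> 0 < s -> s <= d -> d <= r ->
  (forall y, `|y - x| <= d -> bump x y = 1) ->
  (n.+2%:R^-1) ^+ n.+1 <= bubble_mass x (s ^+ 2).
Proof.
move=> xr s0 sd dr bx; have s2 : 0 < s ^+ 2 by rewrite exprn_gt0.
have nn : 0 < n.+2%:R :> R by [].
have -> : (n.+2%:R^-1) ^+ n.+1 =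
    ((s ^+ 2) ^+ m.+1 * ((n.+2%:R * s ^+ 2)^-1) ^+ n.+1) * s ^+ n.+1.
  have hs : s ^+ n.+1 = (s ^+ 2) ^+ m.+1.
    by rewrite -exprM; congr (_ ^+ _); lia.
  have hs2 : ((s ^+ 2)^-1) ^+ n.+1 = ((s ^+ 2) ^+ m.+1 * (s ^+ 2) ^+ m.+1)^-1.
    by rewrite exprVn -exprD; congr ((_ ^+ _)^-1); lia.
  rewrite hs (invfM n.+2%:R) (exprMn _ (n.+2%:R^-1)) hs2; set w := _ ^+ m.+1.
  have w0 : w != 0 by rewrite expf_neq0// gt_eqF.
  by rewrite invfM mulrCA (mulrA w) divff// mul1r -mulrA mulVf// mulr1.
apply: (box_int_lower L_gt0 (bounded_bubble_bump s2 xr)) => //.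
- by move=> y; rewrite mulr_ge0 ?bubble_ge0// cutoff_ge0.
- by rewrite mulr_ge0// exprn_ge0// ?invr_ge0 ltW// mulr_gt0.
- by move: xr (le_trans sd dr) r0; lra.
- move=> y ys; rewrite bx ?(le_trans ys sd)// mulr1 /bubble.
  rewrite ler_pM2l ?exprn_gt0// /sg ler_pXn2r ?nnegrE ?invr_ge0//.
  + rewrite lef_pV2 ?posrE ?sg_den_gt0 ?mulr_gt0//.
    rewrite -[n.+2%:R]natr1 (mulrDl n.+1%:R) mul1r lerD2r.
    apply: (le_trans (sqnorm_le_norm _)); rewrite ler_pM2l// distrC.
    by rewrite ler_pXn2r ?nnegrE// ltW.
  + exact: (mulr_ge0 (ltW nn) (ltW s2)).
  + exact: (addr_ge0 (sqnorm_ge0 _) (ltW s2)).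
Qed.

(** For [u = bump x *: 1], constant near [x], [kernel_int_close] compares the mass with an integral
    that does not involve [e]; the limit is the scalar part of that integral. Passing through
    [corner] makes the limit and the rate common to all [x]. *)
Lemma bubble_mass_cvg : exists2 al, al != 0 & exists2 K, 0 <= K &
  forall x e, 0 < e -> `|x| <= r -> `|c0 * bubble_mass x e - al| <= K * e.
Proof.
have xr := norm_corner; set x := corner in xr.
have [d d0 [dr bx]] := bump_near x.
pose u (y : pt) : cl := bump x y *: 1.
have uC : Ck n setT u.
  exact: (Ck_scale openT (Ck_bump x) (Ck_cst n setT (1 : cl))).
have u0 : vanishes_beyond (2 * r) u.
  by move=> y ly; rewrite /u (bump_vanishes xr)// scale0r.
have lL : 2 * r < L by move: r0; lra.
have dlu0 y : `|y - x| < d -> dl u y = 0.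
  move=> yd; rewrite (dirac_lap_eq_on (v := fun _ => 1) m (@open_dist_lt R n x d)).
  - exact: dirac_lap_cst.
  - by move=> z; rewrite inE /= => /ltW zd; rewrite /u bx// scale1r.
  - by rewrite inE.
have [K K0 hK] := kernel_int_close lL uC u0 d0 dlu0.
set A := cl_int _ in hK; pose al := cl_coef A finset.set0.
have H e : 0 < e -> `|c0 * bubble_mass x e - al| <= K * e.
  move=> e0; apply: le_trans (hK e e0).
  apply: le_trans (cl_coef_le_norm (_ - _) finset.set0).
  have -> : cl_int (fun y => bubble x e y *: u y) = bubble_mass x e *: 1.
    rewrite -cl_int_scale_cst; last exact: bounded_bubble_bump.
    by congr (cl_int _); apply/funext => y; rewrite scalerA.
  have -> : cl_coef (A - c0 *: (bubble_mass x e *: 1)) finset.set0 = al - c0 * bubble_mass x e.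
    have one : cl_coef (1 : cl) finset.set0 = 1 by rewrite cl_coef_blade eqxx.
    by rewrite cl_coefD -scaleNr !cl_coefZ one mulr1 mulNr.
  by rewrite distrC.
exists al; last first.
  by exists K => // z e e0 zr; rewrite bubble_mass_corner//; exact: H.
apply/eqP => al0.
set q := (n.+2%:R^-1 : R) ^+ n.+1.
have q0 : 0 < `|c0| * q by rewrite mulr_gt0 ?normr_gt0 ?bubble_const_neq0// exprn_gt0.
(* If the limit were 0, the mass at [e = s^2] would satisfy [|c0| q <= K s^2]; this [s] makes the
   right side at most [|c0| q / 2]. *)
pose s := Num.min d (Num.min 1 (`|c0| * q / (2 * (K + 1)))).
have K1 : 0 < K + 1 by rewrite ltr_wpDl.
have s0 : 0 < s by rewrite !lt_min d0 ltr01 divr_gt0// mulr_gt0.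
have sd : s <= d by rewrite ge_min lexx.
have s1 : s <= 1 by rewrite !ge_min lexx !orbT.
have sK : s <= `|c0| * q / (2 * (K + 1)) by rewrite !ge_min lexx !orbT.
have := H (s ^+ 2); rewrite exprn_gt0// => /(_ isT); rewrite al0 subr0 normrM.
have mq : q <= bubble_mass x (s ^+ 2) by exact: (bubble_mass_lower xr s0 sd dr bx).
have mp : 0 <= bubble_mass x (s ^+ 2).
  by apply: (le_trans _ mq); rewrite exprn_ge0// invr_ge0.
rewrite (ger0_norm mp).
have : K * s ^+ 2 <= (K + 1) * s.
  rewrite expr2 mulrA ler_pM// ?mulr_ge0 ?(ltW s0)//.
  by rewrite -[leRHS]mulr1 ler_pM ?(ltW s0)// lerDl.
have : (K + 1) * s <= `|c0| * q / 2.
  rewrite -ler_pdivlMl// (le_trans sK)// le_eqVlt; apply/orP; left; apply/eqP.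
  by field; rewrite gt_eqF.
have : `|c0| * q <= `|c0| * bubble_mass x (s ^+ 2) by rewrite ler_wpM2l.
by move: q0; lra.
Qed.

(** Split [u] as [bump x *: u x] plus a remainder [g] with [g x = 0]. The first part yields the mass
    times [u x]; the second is small near [x] by continuity and is damped by the bubble
    elsewhere. *)
Lemma kernel_int_reproduces : exists2 al : R, al != 0 &
  forall u x d, Ck n setT u -> vanishes_beyond (2 * r) u -> `|x| <= r ->
  0 < d -> (forall y, `|y - x| < d -> dl u y = 0) ->
  cl_int (fun y => (paravector (x - y))^-1 * dl u y) = al *: u x.
Proof.
have [al al0 [K K0 hK]] := bubble_mass_cvg; exists al => // u x d uC u0 xr d0 dlu0.
have lL : 2 * r < L by move: r0; lra.
have [K1 K10 hK1] := kernel_int_close lL uC u0 d0 dlu0.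
have [d1 d10 [_ bx]] := bump_near x.
pose g (y : pt) : cl := u y - bump x y *: u x.
have gC : Ck 0 setT g.
  have uC0 := Ck_le (leq0n _) uC; have bC0 := Ck_le (leq0n _) (Ck_bump x).
  exact: (Ck_add openT uC0 (Ck_opp openT (Ck_scale openT bC0 (Ck_cst 0 setT (u x))))).
have g0 : vanishes_beyond (2 * r) g.
  by move=> y ly; rewrite /g u0// (bump_vanishes xr)// scale0r subr0.
have gx : g x = 0.
  by rewrite /g bx ?subrr ?normr0 ?(ltW d10)// scale1r subrr.
have [B hB] := Ck_vanishes_bounded gC g0.
have B0 : 0 <= B := le_trans (normr_ge0 _) (hB 0).
set A := cl_int _; apply/eqP; rewrite -subr_eq0; apply/eqP.
apply: (@norm_le_small R _ _ (`|al| + K + 1)) => h h0.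
have /cvgrPdist_le /(_ h h0) /nbhs_normP [d2 /= d20 gd2] := gC.1 x I.
pose d3 := Num.min d1 d2.
have d30 : 0 < d3 by rewrite lt_min d10.
set D := (d3 ^+ 2)^-1 ^+ n.+1.
have D0 : 0 <= D by rewrite exprn_ge0// invr_ge0 sqr_ge0.
have L0 : 0 <= (2 * L) ^+ n.+1 by rewrite exprn_ge0// ltW// mulr_gt0.
pose M := K1 + `|c0| * ((2 * L) ^+ n.+1 * (D * B)) + K * `|u x|.
have M0 : 0 <= M.
  exact: (addr_ge0 (addr_ge0 K10 (mulr_ge0 (normr_ge0 _) (mulr_ge0 L0 (mulr_ge0 D0 B0)))) (mulr_ge0 K0 (normr_ge0 _))).
(* [M] collects all the constants multiplying [e]; for this [e] they contribute at most [h], and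
   [e <= 1] is what [bubble_far] asks for. *)
pose e := Num.min 1 (h / (M + 1)).
have M1 : 0 < M + 1 by rewrite ltr_wpDl.
have e0 : 0 < e by rewrite lt_min ltr01 divr_gt0.
have e1 : e <= 1 by rewrite ge_min lexx.
have eM : e * M <= h.
  apply: (@le_trans _ _ (h / (M + 1) * (M + 1))); last by rewrite divfK// gt_eqF.
  by rewrite ler_pM ?(ltW e0)// ?ge_min ?lexx ?orbT// lerDl.
have mass0 := bubble_mass_ge0 e0 xr.
have bbb := bounded_bubble_bump e0 xr.
have bg : bounded_on (fun y => bubble x e y *: g y).
  apply: (@Ck_vanishes_bounded R n cl 0 (2 * r)).
    exact: (Ck_scale openT (Ck_bubble x 0 e0) gC).
  by move=> y ly; rewrite g0// scaler0.
have Eu : cl_int (fun y => bubble x e y *: u y) =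
    cl_int (fun y => bubble x e y *: g y) + bubble_mass x e *: u x.
  rewrite -cl_int_scale_cst// -cl_intD//.
    by congr (cl_int _); apply/funext => y; rewrite /g scalerBr scalerA subrK.
  by apply: bounded_on_scale => //; exact: bounded_on_cst.
have gI : `|cl_int (fun y => bubble x e y *: g y)| <=
    h * bubble_mass x e + (2 * L) ^+ n.+1 * (e * (D * B)).
  have hbb : bounded_on ((fun y => h * (bubble x e y * bump x y)) : pt -> R^o).
    exact: bounded_onZ.
  have cst : bounded_on ((fun y : pt => e * (D * B)) : pt -> R^o) by exact: bounded_on_cst.
  rewrite -(box_int_cst n L_gt0) -(box_intZ L_gt0 h bbb) -(box_intD L_gt0 hbb cst).
  apply: norm_cl_int_le => //; last exact: bounded_onD.
  move=> y; rewrite normrZ ger0_norm ?bubble_ge0//.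
  have [yd|dy] := ltP `|y - x| d3.
    have gy : `|g y| <= h.
      have := gd2 y; rewrite gx sub0r normrN; apply.
      by rewrite /= distrC (lt_le_trans yd)// ge_min lexx orbT.
    rewrite bx; last by rewrite (le_trans (ltW yd))// ge_min lexx.
    rewrite mulr1 [h * _]mulrC -[leLHS]addr0 lerD//.
      by rewrite ler_wpM2l// bubble_ge0.
    exact: (mulr_ge0 (ltW e0) (mulr_ge0 D0 B0)).
  rewrite -[leLHS]add0r lerD//.
    exact: (mulr_ge0 (ltW h0) (mulr_ge0 (bubble_ge0 x y e0) (cutoff_ge0 _ _ _ _ _))).
  rewrite mulrA; apply: ler_pM (bubble_ge0 x y e0) (normr_ge0 _) _ (hB y).
  by apply: bubble_far => //; rewrite e0.
have cm : `|c0| * bubble_mass x e <= `|al| + K.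
  rewrite -[bubble_mass x e]ger0_norm// -normrM -[c0 * _](subrK al).
  rewrite (le_trans (ler_normD _ _))// addrC lerD//.
  apply: (le_trans (hK x e e0 xr)); rewrite -[leRHS]mulr1; exact: ler_wpM2l.
have -> : A - al *: u x = (A - c0 *: cl_int (fun y => bubble x e y *: u y))
   + c0 *: cl_int (fun y => bubble x e y *: g y) + (c0 * bubble_mass x e - al) *: u x.
  by rewrite Eu scalerDr scalerBl scalerA; exact: sub_telescope.
apply: (@le_trans _ _ (K1 * e + `|c0| * (h * bubble_mass x e + (2 * L) ^+ n.+1 * (e * (D * B))) + K * e * `|u x|)).
  apply: (le_trans (ler_normD _ _)); apply: lerD; last first.
    by rewrite normrZ; apply: ler_wpM2r => //; exact: hK.
  apply: (le_trans (ler_normD _ _)); apply: lerD; first exact: hK1.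
  by rewrite normrZ; apply: ler_wpM2l.
apply: (@le_trans _ _ (h * (`|c0| * bubble_mass x e) + e * M)).
  by rewrite le_eqVlt; apply/orP; left; apply/eqP; rewrite /M; ring.
rewrite (mulrDr h _ 1) mulr1; apply: lerD eM; exact: ler_wpM2l (ltW h0) _ _ cm.
Qed.

End Reproduction.

(** * Geometric expansion of the kernel *)

Section Words.
Variables (R : realType) (n : nat).
Local Notation pt := 'rV[R]_n.+1.
Local Notation cl := (clifford R n).
Implicit Types (x y w : pt) (al : multiindex n).

Definition mi_pow w al : R := \prod_i w ord0 i ^+ al i.

Definition word_type k (s : seq 'I_n.+1) : {ffun 'I_n.+1 -> 'I_k.+1} :=
  [ffun i => inord (count_mem i s)].

Lemma count_mem_size (s : seq 'I_n.+1) : (\sum_i count_mem i s)%N = size s.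
Proof.
elim: s => [|j s IH] /=; first by rewrite big1.
rewrite big_split /= IH (bigD1 j)//= eqxx big1 => [|i ij]; last first.
  by rewrite eq_sym (negbTE ij).
by rewrite addn0.
Qed.

Lemma prod_word w (s : seq 'I_n.+1) :
  \prod_(j <- s) w ord0 j = \prod_i w ord0 i ^+ count_mem i s.
Proof.
elim: s => [|j s IH]; first by rewrite big_nil big1.
rewrite big_cons IH [RHS](bigD1 j)//= eqxx exprS -mulrA; congr (_ * _).
rewrite (bigD1 j)//=; congr (_ * _); apply: eq_bigr => i ij.
by rewrite eq_sym (negbTE ij) add0n.
Qed.

Lemma word_typeE k (s : k.-tuple 'I_n.+1) (g : {ffun 'I_n.+1 -> 'I_k.+1}) :
  has_multitype [ffun i => val (g i)] s = (word_type k s == g).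
Proof.
have cs i : (count_mem i s < k.+1)%N by rewrite ltnS -{2}(size_tuple s) count_size.
apply/forallP/eqP => [H|<- i]; last by rewrite !ffunE /= inordK.
apply/ffunP => i; rewrite ffunE; apply/val_inj => /=; rewrite inordK//.
by have /eqP := H i; rewrite ffunE.
Qed.

Lemma mi_deg_word_type k (s : k.-tuple 'I_n.+1) :
  mi_deg [ffun i => val (word_type k s i)] = k.
Proof.
rewrite -[RHS](size_tuple s) -count_mem_size; apply: eq_bigr => i _.
by rewrite !ffunE /= inordK// ltnS -{2}(size_tuple s) count_size.
Qed.

(** The scalar weight of a word depends only on its letter counts. Grouping words by these counts
    turns a noncommutative expansion into one indexed by multi-indices, whose inner sums are those
    of [P_] and [S_]. *)
Lemma sum_deg_words k w (F : seq 'I_n.+1 -> cl) :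
  \sum_(s : k.-tuple 'I_n.+1) (\prod_(j <- s) w ord0 j) *: F s =
  sum_deg k (fun al => mi_pow w al *:
    \sum_(s : (mi_deg al).-tuple 'I_n.+1 | has_multitype al s) F s).
Proof.
rewrite /sum_deg (partition_big (fun s : k.-tuple _ => word_type k s)
  (fun g => mi_deg [ffun i => val (g i)] == k)) /=; last first.
  by move=> s _; rewrite mi_deg_word_type.
apply: eq_bigr => g /eqP gk; set al := [ffun i => val (g i)].
(* The tuples in [P_] and [S_] have length [mi_deg al], equal to [k] only propositionally, hence the
   transport along an equality. *)
have tupE k1 k2 (E : k1 = k2) :
    \sum_(s : k1.-tuple 'I_n.+1 | has_multitype al s) F s =
    \sum_(s : k2.-tuple 'I_n.+1 | has_multitype al s) F s by case: _ / E.
rewrite (tupE _ _ gk) scaler_sumr.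
apply: eq_big => [s|s]; first by rewrite word_typeE.
move=> /eqP sg; congr (_ *: _); rewrite prod_word; apply: eq_bigr => i _.
congr (_ ^+ _); rewrite ffunE -sg ffunE /= inordK//.
by rewrite ltnS -{2}(size_tuple s) count_size.
Qed.

Lemma expr_sum_words k w (A : 'I_n.+1 -> cl) :
  (\sum_j w ord0 j *: A j) ^+ k =
  \sum_(s : k.-tuple 'I_n.+1) (\prod_(j <- s) w ord0 j) *: \prod_(j <- s) A j.
Proof.
elim: k => [|k IH].
  rewrite expr0 (big_pred1 [tuple]) => [|s]; last by rewrite (tuple0 s) /= eqxx.
  by rewrite !big_nil scale1r.
rewrite exprS IH.
rewrite (reindex (fun p : 'I_n.+1 * k.-tuple 'I_n.+1 => [tuple of p.1 :: p.2])) /=; last first.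
  exists (fun s : k.+1.-tuple 'I_n.+1 => (thead s, [tuple of behead s])).
    by move=> [i s] _; congr (_, _); apply/val_inj.
  by move=> s _; rewrite -tuple_eta.
rewrite -(pair_bigA _ (fun i (s : k.-tuple 'I_n.+1) => (\prod_(j <- i :: s) w ord0 j) *: \prod_(j <- i :: s) A j)) /=.
rewrite mulr_suml; apply: eq_bigr => i _; rewrite mulr_sumr; apply: eq_bigr => s _.
by rewrite !big_cons -scalerAl -scalerAr scalerA.
Qed.

(** The term of degree [k] in [q] of [(p - q)^-1], namely [p^-1 (q p^-1)^k]. The pole is expanded
    towards the outer shell with [p = y], towards the inner one with [p = x]. *)
Definition geo_term (p q : pt) k : cl :=
  paravector (para_inv p) * (paravector q * paravector (para_inv p)) ^+ k.

(** Each of the [k + 1] factors [y^-1] is expanded along the [cl_e], leaving [k] factors [x] between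
    them; this is why the [P_] start at degree 1. In [geo_term_S] the letters come from the [k]
    factors [y] instead. *)
Lemma geo_term_P x y k : geo_term y x k =
  sum_deg k.+1 (fun al => mi_pow (para_inv y) al *: P_ al x).
Proof.
rewrite -sum_deg_words /geo_term; set w := para_inv y.
rewrite (reindex (fun p : 'I_n.+1 * k.-tuple 'I_n.+1 => [tuple of p.1 :: p.2])) /=; last first.
  exists (fun s : k.+1.-tuple 'I_n.+1 => (thead s, [tuple of behead s])).
    by move=> [i s] _; congr (_, _); apply/val_inj.
  by move=> s _; rewrite -tuple_eta.
rewrite -(pair_bigA _ (fun i (s : k.-tuple 'I_n.+1) => (\prod_(j <- i :: s) w ord0 j) *: P_word x (i :: s))) /=.
have -> : paravector x * paravector w = \sum_j w ord0 j *: (paravector x * cl_e R j).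
  by rewrite {2}/paravector mulr_sumr; apply: eq_bigr => j _; rewrite -scalerAr.
rewrite expr_sum_words {1}/paravector mulr_suml; apply: eq_bigr => i _.
rewrite mulr_sumr; apply: eq_bigr => s _.
by rewrite !big_cons -scalerAl -scalerAr scalerA.
Qed.

Lemma geo_term_S x y k : x != 0 -> geo_term x y k =
  sum_deg k (fun be => mi_pow y be *: S_ be x).
Proof.
move=> x0; rewrite -sum_deg_words /geo_term para_invE//.
have -> : paravector y * (paravector x)^-1 = \sum_j y ord0 j *: (cl_e R j * (paravector x)^-1).
  by rewrite {1}/paravector mulr_suml; apply: eq_bigr => j _; rewrite -scalerAl.
by rewrite expr_sum_words mulr_sumr; apply: eq_bigr => s _; rewrite -scalerAr.
Qed.

End Words.

(** * Remainder and convergence of the geometric expansion *)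

Section GeometricExpansion.
Variables (R : realType) (n : nat).
Local Notation pt := 'rV[R]_n.+1.
Local Notation cl := (clifford R n).
Implicit Types (p q x y : pt) (h : cl).

Lemma geo_termZ (s : R) p q k : geo_term p (s *: q) k = s ^+ k *: geo_term p q k.
Proof. by rewrite /geo_term paravectorZ -scalerAl exprZn -scalerAr. Qed.

Lemma geo_sum p q N : p != 0 ->
  (paravector p - paravector q) * \sum_(k < N) geo_term p q k =
  1 - (paravector q * paravector (para_inv p)) ^+ N.
Proof.
move=> p0; rewrite mulr_sumr.
under eq_bigr => k _.
  rewrite /geo_term mulrA mulrBl {1}(para_invE p0) divrr ?paravector_unit//.
  rewrite mulrBl mul1r -exprS; over.
elim: N => [|N IH]; first by rewrite big_ord0 expr0 subrr.
by rewrite big_ord_recr /= IH addrA subrK.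
Qed.

Lemma paravectorB p q : paravector (p - q) = paravector p - paravector q.
Proof. by rewrite paravectorD paravectorN. Qed.

Lemma geo_remainder p q N h : p != 0 -> p != q ->
  (paravector (p - q))^-1 * h - \sum_(k < N) geo_term p q k * h =
  (paravector (p - q))^-1 * ((paravector q * paravector (para_inv p)) ^+ N * h).
Proof.
move=> p0 pq; have d0 : p - q != 0 by rewrite subr_eq0.
have u := paravector_unit d0.
apply: (mulrI u); rewrite mulrBr !mulrA (divrr u) !mul1r -mulr_suml mulrA.
by rewrite paravectorB geo_sum// mulrBl mul1r opprB addrC subrK.
Qed.

Lemma cl_sqn_geo_pow p q N h :
  cl_sqn ((paravector q * paravector (para_inv p)) ^+ N * h) =
  (sqnorm q / sqnorm p) ^+ N * cl_sqn h.
Proof.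
elim: N => [|N IH]; first by rewrite !expr0 !mul1r.
by rewrite !exprS -!mulrA !cl_sqn_paraM sqnorm_para_inv IH !mulrA.
Qed.

Lemma cl_sqn_geo_term p q k h : cl_sqn (geo_term p q k * h) =
  (sqnorm p)^-1 * ((sqnorm q / sqnorm p) ^+ k * cl_sqn h).
Proof. by rewrite /geo_term -mulrA cl_sqn_paraM sqnorm_para_inv cl_sqn_geo_pow. Qed.

Lemma geo_pow_le p q k (c : R) : sqnorm q <= c * sqnorm p -> 0 < sqnorm p ->
  (sqnorm q / sqnorm p) ^+ k <= c ^+ k.
Proof.
move=> qp p0; have d0 : 0 <= sqnorm q / sqnorm p by rewrite divr_ge0// sqnorm_ge0.
have dc : sqnorm q / sqnorm p <= c by rewrite ler_pdivrMr.
by rewrite lerXn2r// nnegrE// (le_trans d0).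
Qed.

Lemma sqrt_exp (c : R) k : 0 <= c -> Num.sqrt (c ^+ k) = Num.sqrt c ^+ k.
Proof.
move=> c0; elim: k => [|k IH]; first by rewrite !expr0 sqrtr1.
by rewrite !exprS sqrtrM// IH.
Qed.

Lemma norm_le_sqrt h (t : R) : cl_sqn h <= t -> `|h| <= Num.sqrt t.
Proof.
move=> ht; apply: (le_trans (norm_le_sqn h)); rewrite ler_sqrt//.
exact: (le_trans (cl_sqn_ge0 _) ht).
Qed.

(** The conditions on [p] and [q] are conditional on [h != 0] because [h] will be the value at [y]
    of a function supported in a shell, and they hold only for [y] in that shell. *)
Lemma norm_geo_term p q k h (c d b : R) : 0 <= c -> 0 < d -> cl_sqn h <= b ->
  (h != 0 -> d <= sqnorm p /\ sqnorm q <= c * sqnorm p) ->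
  `|geo_term p q k * h| <= Num.sqrt c ^+ k * Num.sqrt (d^-1 * b).
Proof.
move=> c0 d0 hb; have [->|h0] := eqVneq h 0.
  by rewrite mulr0 normr0 mulr_ge0// ?exprn_ge0 sqrtr_ge0.
move=> /(_ isT) [dp qp]; rewrite -sqrt_exp// -sqrtrM ?exprn_ge0//.
have p0 : 0 < sqnorm p by exact: lt_le_trans d0 dp.
apply: norm_le_sqrt; rewrite cl_sqn_geo_term mulrCA.
apply: ler_pM.
- by rewrite exprn_ge0// divr_ge0// sqnorm_ge0.
- by rewrite mulr_ge0 ?invr_ge0 ?sqnorm_ge0 ?cl_sqn_ge0.
- exact: geo_pow_le.
- by apply: ler_pM; rewrite ?invr_ge0 ?sqnorm_ge0 ?cl_sqn_ge0// lef_pV2 ?posrE.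
Qed.

Lemma norm_geo_remainder p q N h (c d b : R) : 0 <= c -> 0 < d -> cl_sqn h <= b ->
  (h != 0 -> [/\ d <= sqnorm p, sqnorm q <= c * sqnorm p & d <= sqnorm (p - q)]) ->
  `|(paravector (p - q))^-1 * h - \sum_(k < N) geo_term p q k * h|
    <= Num.sqrt c ^+ N * Num.sqrt (d^-1 * b).
Proof.
move=> c0 d0 hb; have [->|h0] := eqVneq h 0.
  rewrite mulr0 big1 ?subrr ?normr0 => [|k _]; last by rewrite mulr0.
  by rewrite mulr_ge0// ?exprn_ge0 sqrtr_ge0.
move=> /(_ isT) [dp qp dpq].
have p0 : 0 < sqnorm p by exact: lt_le_trans d0 dp.
have pq0 : 0 < sqnorm (p - q) by exact: lt_le_trans d0 dpq.
have pn0 : p != 0 by rewrite -sqnorm_eq0 gt_eqF.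
have pqn0 : p - q != 0 by rewrite -sqnorm_eq0 gt_eqF.
rewrite geo_remainder//; last by rewrite -subr_eq0.
rewrite -sqrt_exp// -sqrtrM ?exprn_ge0//.
apply: norm_le_sqrt; rewrite cl_sqn_invM// cl_sqn_geo_pow mulrCA.
apply: ler_pM.
- by rewrite exprn_ge0// divr_ge0// sqnorm_ge0.
- by rewrite mulr_ge0 ?invr_ge0 ?sqnorm_ge0 ?cl_sqn_ge0.
- exact: geo_pow_le.
- by apply: ler_pM; rewrite ?invr_ge0 ?sqnorm_ge0 ?cl_sqn_ge0// lef_pV2 ?posrE.
Qed.

(* [y = x + (y - x)] and [2 u v <= t u^2 + v^2 / t]; no square roots needed. *)
Lemma sqnorm_separated (a b : R) : 0 <= b -> b < a ->
  exists2 d, 0 < d & forall x y, sqnorm x <= b -> a <= sqnorm y -> d <= sqnorm (y - x).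
Proof.
move=> b0 ba; pose t := (a - b) / (2 * (b + 1)).
have b1 : 0 < b + 1 by rewrite ltr_wpDl.
have t0 : 0 < t by rewrite divr_gt0 ?subr_gt0// mulr_gt0.
have ti : 0 < 1 + t^-1 by rewrite addr_gt0// invr_gt0.
exists ((a - b) / 2 / (1 + t^-1)); first by rewrite !divr_gt0// subr_gt0.
move=> x y xb ya; rewrite ler_pdivrMr//.
have H : sqnorm y <= (1 + t) * sqnorm x + (1 + t^-1) * sqnorm (y - x).
  rewrite /sqnorm !mulr_sumr -big_split; apply: ler_sum => i _ /=.
  rewrite !mxE; set u := x ord0 i; set v := y ord0 i.
  have sq : 0 <= (t * u - (v - u)) ^+ 2 / t by rewrite divr_ge0 ?sqr_ge0// ltW.
  rewrite -subr_ge0; apply: le_trans sq _; rewrite le_eqVlt; apply/orP; left; apply/eqP.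
  by field; rewrite gt_eqF.
have H2 : (1 + t) * sqnorm x <= b + (a - b) / 2.
  apply: (@le_trans _ _ ((1 + t) * b)).
    by rewrite ler_wpM2l// addr_ge0// ltW.
  rewrite mulrDl mul1r lerD2l /t mulrAC ler_pdivrMr ?mulr_gt0//.
  have : 0 <= a - b by rewrite subr_ge0 ltW.
  move: b0; nra.
by rewrite mulrC; move: H H2 ya; lra.
Qed.

End GeometricExpansion.

(** * Uniqueness of power series coefficients *)

Section PowerSeriesIdentity.
Variables (R : realType) (V : normedModType R).

Lemma geometric_sum_le (q : R) N : 0 <= q -> q <= 1 / 2 -> \sum_(k < N) q ^+ k <= 2.
Proof.
move=> q0 q1; suff : (1 - q) * \sum_(k < N) q ^+ k <= 1.
  have S0 : 0 <= \sum_(k < N) q ^+ k by apply: sumr_ge0 => k _; rewrite exprn_ge0.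
  move: S0 q1; set S := \sum_(_ < _) _; nra.
have -> : (1 - q) * \sum_(k < N) q ^+ k = 1 - q ^+ N.
  elim: N => [|N IH]; first by rewrite big_ord0 mulr0 expr0 subrr.
  by rewrite big_ord_recr /= mulrDr IH exprS; ring.
by rewrite lerBlDr lerDl exprn_ge0.
Qed.

(** If the coefficients before [k] vanish, [s ^+ k *: t k] is the limit of the opposite of the tail,
    which is O(s^(k+1)); divide by [s ^+ k] and let [s] tend to 0. The condition [s * M <= 1 / 2]
    bounds the geometric sum of the tail by 2. *)
Lemma power_series_zero (t : nat -> V) (C M s0 : R) : 0 <= C -> 0 < M -> 0 < s0 ->
  (forall k, `|t k| <= M ^+ k * C) ->
  (forall s, 0 < s -> s < s0 -> (fun N => \sum_(k < N) s ^+ k *: t k) @ \oo --> (0 : V)) ->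
  forall k, t k = 0.
Proof.
move=> C0 M0 s00 tM ts k; elim/ltn_ind: k => k IH.
apply: (@norm_le_small R V _ (2 * (M ^+ k.+1 * C))) => h h0.
pose s := Num.min h (Num.min (s0 / 2) (1 / (2 * M))).
have s0' : 0 < s by rewrite !lt_min h0 !divr_gt0// mulr_gt0.
have sh : s <= h by rewrite ge_min lexx.
have ss0 : s < s0.
  apply: (@le_lt_trans _ _ (s0 / 2)); first by rewrite !ge_min lexx !orbT.
  by rewrite ltr_pdivrMr// ltr_pMr// ltr1n.
have sM : s * M <= 1 / 2.
  apply: (@le_trans _ _ (1 / (2 * M) * M)).
    by rewrite ler_pM2r// !ge_min lexx !orbT.
  by rewrite le_eqVlt; apply/orP; left; apply/eqP; field; rewrite gt_eqF.
have sM0 : 0 <= s * M by rewrite mulr_ge0// ltW.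
apply: (@le_trans _ _ (s * (2 * (M ^+ k.+1 * C)))); last first.
  by rewrite ler_wpM2r// !mulr_ge0// exprn_ge0// ltW.
suff : `|s ^+ k *: t k| <= s ^+ k.+1 * (2 * (M ^+ k.+1 * C)).
  rewrite normrZ ger0_norm ?exprn_ge0 ?(ltW s0')// exprSr -mulrA.
  by rewrite ler_pM2l// exprn_gt0.
have cv := ts s s0' ss0.
apply/ler_addgt0Pr => eta eta0.
have /cvgrPdist_le /(_ eta eta0) [N _ /(_ (k.+1 + N)%N) hN] := cv.
have := hN (leq_addl _ _); rewrite sub0r normrN /=.
move: hN => _; set S := \sum_(i < _) _ => hS.
rewrite -(subrK S (s ^+ k *: t k)) (le_trans (ler_normD _ _))// lerD//.
rewrite {hS}/S.
rewrite big_split_ord /= big_ord_recr /= big1 ?add0r => [|i _]; last first.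
  by rewrite IH ?scaler0//= ltn_ord.
rewrite opprD addrA subrr add0r normrN.
apply: (le_trans (ler_norm_sum _ _ _)).
apply: (@le_trans _ _ (\sum_(i < N) (s * M) ^+ k.+1 * C * (s * M) ^+ i)).
  apply: ler_sum => i _; rewrite normrZ ger0_norm ?exprn_ge0 ?(ltW s0')//.
  apply: (@le_trans _ _ (s ^+ (k.+1 + i) * (M ^+ (k.+1 + i) * C))).
    by rewrite ler_wpM2l// exprn_ge0// ltW.
  by rewrite !exprMn !exprD le_eqVlt; apply/orP; left; apply/eqP; ring.
rewrite -mulr_sumr; apply: (@le_trans _ _ ((s * M) ^+ k.+1 * C * 2)).
  by rewrite ler_wpM2l ?mulr_ge0 ?exprn_ge0// geometric_sum_le.
by rewrite exprMn le_eqVlt; apply/orP; left; apply/eqP; ring.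
Qed.

End PowerSeriesIdentity.

(** * Additivity of the operators, open sets and scaling *)

Section DiracLaplacianLinear.
Variables (R : realType) (n : nat).
Local Notation pt := 'rV[R]_n.+1.
Local Notation cl := (clifford R n).
Implicit Types (u v : pt -> cl) (Om : set pt).

Lemma partial_sub i Om u v : Ck 1 Om u -> Ck 1 Om v ->
  {in Om, partial i (fun y => u y - v y) =1 (fun y => partial i u y - partial i v y)}.
Proof.
move=> uC vC x /set_mem Ox; rewrite /partial.
rewrite -[LHS]/('D_(delta_mx ord0 i) (u - v) x) deriveB//.
  exact: (@Ck_derivable R n cl 0 Om u x i uC Ox).
exact: (@Ck_derivable R n cl 0 Om v x i vC Ox).
Qed.

Lemma laplacian_sub k Om u v : open Om -> Ck k.*2 Om u -> Ck k.*2 Om v ->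
  {in Om, iter k (@laplacian R n) (fun y => u y - v y) =1
    (fun y => iter k (@laplacian R n) u y - iter k (@laplacian R n) v y)}.
Proof.
move=> oO; elim: k => [|k IH] uC vC; first by [].
have uC' : Ck 2 Om (iter k (@laplacian R n) u).
  exact: (@Ck_iter_laplacian R n 2 k Om u oO uC).
have vC' : Ck 2 Om (iter k (@laplacian R n) v).
  exact: (@Ck_iter_laplacian R n 2 k Om v oO vC).
have IH' := IH (Ck_pred (Ck_pred uC)) (Ck_pred (Ck_pred vC)).
move=> x Ox; rewrite !iterS /laplacian -sumrB; apply: eq_bigr => i _.
set A := iter k _ u; set B := iter k _ v.
have E1 : {in Om, partial i (iter k (@laplacian R n) (fun y => u y - v y)) =1
    fun y => partial i A y - partial i B y}.
  move=> z Oz; rewrite (partial_eq_on i oO IH' Oz).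
  exact: (partial_sub i (Ck_pred uC') (Ck_pred vC') Oz).
rewrite (partial_eq_on i oO E1 Ox).
exact: (partial_sub i (Ck_partial i uC') (Ck_partial i vC') Ox).
Qed.

Lemma dirac_lap_sub m Om u v : open Om -> Ck m.*2.+1 Om u -> Ck m.*2.+1 Om v ->
  {in Om, dirac_lap m (fun y => u y - v y) =1 (fun y => dirac_lap m u y - dirac_lap m v y)}.
Proof.
move=> oO uC vC x Ox; rewrite /dirac_lap /dirac_op -sumrB; apply: eq_bigr => i _.
rewrite -mulrBr; congr (_ * _).
rewrite (partial_eq_on i oO (laplacian_sub oO (Ck_pred uC) (Ck_pred vC)) Ox).
exact: (partial_sub i (@Ck_iter_laplacian R n 1 m Om u oO uC)
  (@Ck_iter_laplacian R n 1 m Om v oO vC) Ox).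
Qed.

Lemma sqnorm_continuous : continuous (@sqnorm R n : pt -> R).
Proof. exact: (Ck_setT_continuous (@Ck_sqnorm R n 0 setT openT)). Qed.

Lemma open_sqnorm_lt a : open [set y : pt | sqnorm y < a].
Proof.
apply: (@open_comp _ _ (@sqnorm R n : pt -> R) [set t | t < a]); last exact: open_lt.
by move=> y _; exact: sqnorm_continuous.
Qed.

Lemma open_sqnorm_gt a : open [set y : pt | a < sqnorm y].
Proof.
apply: (@open_comp _ _ (@sqnorm R n : pt -> R) [set t | a < t]); last exact: open_gt.
by move=> y _; exact: sqnorm_continuous.
Qed.

Lemma open_contains_ball Om (x : pt) : open Om -> Om x ->
  exists2 d, 0 < d & forall y, `|y - x| < d -> Om y.
Proof.
move=> oO Ox; have /nbhs_normP [d /= d0 dO] : nbhs x Om by exact: open_nbhs_nbhs.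
by exists d => // y yd; apply: dO; rewrite /= distrC.
Qed.

Lemma sqnormN (x : pt) : sqnorm (- x) = sqnorm x.
Proof. by rewrite -scaleN1r sqnormZ sqrrN expr1n mul1r. Qed.

Lemma cl_sqn_le_norm (h : cl) B : `|h| <= B -> cl_sqn h <= ((#|{set 'I_n}|)%:R * B) ^+ 2.
Proof.
move=> hB; have B0 : 0 <= B := le_trans (normr_ge0 _) hB.
rewrite -[leLHS]sqr_sqrtr ?cl_sqn_ge0// ler_pXn2r ?nnegrE ?sqrtr_ge0 ?mulr_ge0//.
by rewrite (le_trans (sqn_le_norm h))// ler_wpM2l.
Qed.

Lemma para_invZ (k : R) (x : pt) : para_inv (k *: x) = k^-1 *: para_inv x.
Proof.
rewrite /para_inv sqnormZ; have -> : para_conj (k *: x) = k *: para_conj x.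
  by apply/rowP => i; rewrite !mxE; case: eqP => // _; rewrite mulrN.
rewrite !scalerA; congr (_ *: _).
have [->|k0] := eqVneq k 0; first by rewrite invr0 mulr0 mul0r.
rewrite invfM mulrAC; congr (_ * _).
by rewrite expr2 invfM -mulrA mulVf// mulr1.
Qed.

Lemma geo_term_scale_l (k : R) (p q : pt) j :
  geo_term (k *: p) q j = (k^-1) ^+ j.+1 *: geo_term p q j.
Proof.
rewrite /geo_term para_invZ paravectorZ -scalerAr exprZn -scalerAl -scalerAr.
by rewrite scalerA -exprS.
Qed.

End DiracLaplacianLinear.

(** * Termwise integration of the geometric expansion *)

Section IntegralExpansion.
Variables (R : realType) (n : nat) (L : R).
Hypothesis L_gt0 : 0 < L.
Local Notation pt := 'rV[R]_n.+1.
Local Notation cl := (clifford R n).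
Local Notation cl_int := (cl_int L).
Variables (p q : pt -> pt) (H : pt -> cl) (c d : R).
Hypotheses (Hb : bounded_on H) (c0 : 0 <= c) (d0 : 0 < d).
Hypothesis Hpq : forall y, H y != 0 ->
  d <= sqnorm (p y) /\ sqnorm (q y) <= c * sqnorm (p y).

(** For an outer shell [p] is the integration variable and [q] is constant; for an inner shell the
    roles are exchanged. *)
Lemma geo_term_bound : exists2 C, 0 <= C & forall k y,
  `|geo_term (p y) (q y) k * H y| <= Num.sqrt c ^+ k * C.
Proof.
have [B hB] := Hb; exists (Num.sqrt (d^-1 * ((#|{set 'I_n}|)%:R * B) ^+ 2)) => [|k y].
  exact: sqrtr_ge0.
exact: (norm_geo_term k c0 d0 (cl_sqn_le_norm (hB y)) (@Hpq y)).
Qed.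

Lemma bounded_geo_term k : bounded_on (fun y => geo_term (p y) (q y) k * H y).
Proof. by have [C _ hC] := geo_term_bound; exists (Num.sqrt c ^+ k * C). Qed.

(** Here [c] may exceed 1. Adding 1 to its square root makes the base positive, as
    [power_series_zero] requires. *)
Lemma geo_int_bound : exists2 C, 0 <= C & forall k,
  `|cl_int (fun y => geo_term (p y) (q y) k * H y)| <= (Num.sqrt c + 1) ^+ k * C.
Proof.
have [C C0 hC] := geo_term_bound.
have L0 : 0 <= (2 * L) ^+ n.+1 by rewrite exprn_ge0// ltW// mulr_gt0.
exists ((2 * L) ^+ n.+1 * C) => [|k]; first exact: mulr_ge0.
rewrite mulrCA; apply: (norm_cl_int_le_cst L_gt0) => y.
apply: (le_trans (hC k y)); apply: ler_wpM2r => //.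
by rewrite lerXn2r ?nnegrE ?addr_ge0 ?sqrtr_ge0// lerDl.
Qed.

Hypothesis c1 : c < 1.
Hypothesis Hsep : forall y, H y != 0 -> d <= sqnorm (p y - q y).

Lemma geo_remainder_bound : exists2 K, 0 <= K & forall N y,
  `|(paravector (p y - q y))^-1 * H y - \sum_(k < N) geo_term (p y) (q y) k * H y|
    <= Num.sqrt c ^+ N * K.
Proof.
have [B hB] := Hb; exists (Num.sqrt (d^-1 * ((#|{set 'I_n}|)%:R * B) ^+ 2)) => [|N y].
  exact: sqrtr_ge0.
apply: (norm_geo_remainder N c0 d0 (cl_sqn_le_norm (hB y))).
by move=> h0; have [h1 h2] := Hpq h0; split => //; exact: Hsep.
Qed.

Lemma geo_kernel_bounded : bounded_on (fun y => (paravector (p y - q y))^-1 * H y).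
Proof.
have [K K0 rem] := geo_remainder_bound; exists (Num.sqrt c ^+ 0 * K) => y.
by have := rem 0%N y; rewrite big_ord0 subr0.
Qed.

Lemma geo_int_flip : cl_int (fun y => (paravector (q y - p y))^-1 * H y) =
  - cl_int (fun y => (paravector (p y - q y))^-1 * H y).
Proof.
rewrite -(cl_intN L_gt0 geo_kernel_bounded); congr (cl_int _); apply/funext => y.
by rewrite -opprB paravectorN invrN mulNr.
Qed.

Lemma geo_int_cvg :
  (fun N => \sum_(k < N) cl_int (fun y => geo_term (p y) (q y) k * H y)) @ \oo
  --> cl_int (fun y => (paravector (p y - q y))^-1 * H y).
Proof.
have [K K0 rem] := geo_remainder_bound; have kb := geo_kernel_bounded.
have sb N : bounded_on (fun y => \sum_(k < N) geo_term (p y) (q y) k * H y).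
  by apply: bounded_on_sum => k _; exact: bounded_geo_term.
have L0 : 0 < (2 * L) ^+ n.+1 by rewrite exprn_gt0// mulr_gt0.
have main N : `|cl_int (fun y => (paravector (p y - q y))^-1 * H y)
    - \sum_(k < N) cl_int (fun y => geo_term (p y) (q y) k * H y)| <=
    ((2 * L) ^+ n.+1 * K) * Num.sqrt c ^+ N.
  rewrite -(cl_int_sum L_gt0); last by move=> k; exact: bounded_geo_term.
  rewrite -(cl_intB L_gt0 kb (sb N)) -mulrA; apply: (norm_cl_int_le_cst L_gt0) => y.
  by rewrite mulrC.
have sc : `|Num.sqrt c| < 1.
  by rewrite ger0_norm ?sqrtr_ge0// -sqrtr1 ltr_sqrt// ltr01.
have gc := cvg_geometric ((2 * L) ^+ n.+1 * K) sc.
apply/cvgrPdist_le => e e0.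
have /cvgrPdist_le /(_ e e0) := gc; apply: filterS => N.
rewrite sub0r normrN /geometric /= => hN; apply: (le_trans (main N)).
exact: (le_trans (ler_norm _) hN).
Qed.

End IntegralExpansion.

(** * Laurent expansion *)

Section Shells.
Variables (R : realType) (m : nat) (r : R).
Hypothesis r0 : 0 < r.
Local Notation n := m.*2.+1.
Local Notation pt := 'rV[R]_n.+1.
Local Notation cl := (clifford R n).
Local Notation L := (8 * r).
Local Notation dl := (dirac_lap m).
Local Notation cl_int := (cl_int L).
Local Notation pv := (@paravector R n).
Implicit Types (x y : pt) (a b : R).

Let L_gt0 : 0 < L. Proof. by rewrite mulr_gt0. Qed.

Definition punctured_ball : set pt := [set y | 0 < sqnorm y] `&` [set y | sqnorm y < r ^+ 2].

Lemma open_punctured_ball : open punctured_ball.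
Proof. by apply: openI; [exact: open_sqnorm_gt|exact: open_sqnorm_lt]. Qed.

Variable g : pt -> cl.
Hypothesis gC : Ck n punctured_ball g.
Hypothesis dlg0 : forall y, punctured_ball y -> dl g y = 0.

Definition radial_cutoff a b : pt -> R := cutoff n (0 : pt) a b.

Lemma radial_cutoff_in a b y : a < b -> sqnorm y <= a -> radial_cutoff a b y = 1.
Proof. by move=> ab ya; apply: cutoff_in => //; rewrite sub0r sqnormN. Qed.

Lemma radial_cutoff_out a b y : a < b -> b <= sqnorm y -> radial_cutoff a b y = 0.
Proof. by move=> ab ya; apply: cutoff_out => //; rewrite sub0r sqnormN. Qed.

Definition truncation a b y : cl := radial_cutoff a b y *: g y.

(* The image of the truncation under the operator, supported in the shell
   [a <= |y|^2 <= b] although the truncation itself is singular at the origin. *)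
Definition shell a b y : cl :=
  if (0 < sqnorm y) && (sqnorm y < r ^+ 2) then dl (truncation a b) y else 0.

Lemma shell_on a b y : punctured_ball y -> shell a b y = dl (truncation a b) y.
Proof. by case=> /= y0 yr; rewrite /shell y0 yr. Qed.

Lemma shell_off a b y : ~ punctured_ball y -> shell a b y = 0.
Proof.
move=> yO; rewrite /shell; have [/andP[y0 yr]|_] := boolP (_ && _); last exact: erefl.
by case: yO.
Qed.

Lemma shell_below a b y : a < b -> sqnorm y < a -> shell a b y = 0.
Proof.
move=> ab ya; rewrite /shell; case: ifP => // /andP[y0 yr].
have oO := openI open_punctured_ball (@open_sqnorm_lt R n a).
rewrite (dirac_lap_eq_on (v := g) m oO).
- exact: dlg0.
- move=> z /set_mem [_ /= za].
  by rewrite /truncation radial_cutoff_in ?scale1r// ltW.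
- by rewrite inE.
Qed.

Lemma shell_above a b y : a < b -> b < sqnorm y -> shell a b y = 0.
Proof.
move=> ab yb; rewrite /shell; case: ifP => // /andP[y0 yr].
rewrite (dirac_lap_eq_on (v := fun _ => 0) m (@open_sqnorm_gt R n b)).
- exact: dirac_lap_cst.
- move=> z /set_mem /= zb.
  by rewrite /truncation radial_cutoff_out ?scale0r// ltW.
- by rewrite inE.
Qed.

Definition admissible a b := [&& 0 < a, a < b & b < r ^+ 2].

Lemma admissible_above t : 0 < t -> t < r ^+ 2 ->
  admissible ((2 * t + r ^+ 2) / 3) ((t + 2 * r ^+ 2) / 3) /\ t < (2 * t + r ^+ 2) / 3.
Proof. by rewrite /admissible; move: (r ^+ 2) => u t0 tu; split; [apply/and3P; split|]; lra. Qed.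

Lemma admissible_below t : 0 < t -> t < r ^+ 2 -> admissible (t / 4) (t / 2) /\ t / 2 < t.
Proof. by rewrite /admissible; move: (r ^+ 2) => u t0 tu; split; [apply/and3P; split|]; lra. Qed.

Section Difference.
Variables (a b a' b' : R).
Hypotheses (ab : admissible a b) (ab' : admissible a' b').

(** Both truncations equal [g] near the origin, so their difference cancels the singularity and is
    of class C^(2m+1) on the whole space. *)
Definition truncation_diff y : cl := truncation a b y - truncation a' b' y.

Let lo := Num.min a a'.
Let hi := Num.max b b'.

Let lo0 : 0 < lo.
Proof. by case/and3P: ab => ? _ _; case/and3P: ab' => ? _ _; rewrite lt_min; apply/andP. Qed.

Let hir : hi < r ^+ 2.
Proof. by case/and3P: ab => _ _ ?; case/and3P: ab' => _ _ ?; rewrite gt_max; apply/andP. Qed.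

Lemma truncation_diff_below y : sqnorm y < lo -> truncation_diff y = 0.
Proof.
case/and3P: ab => _ ? _; case/and3P: ab' => _ ? _; rewrite lt_min => /andP[h1 h2].
by rewrite /truncation_diff /truncation !radial_cutoff_in ?subrr// ltW.
Qed.

Lemma truncation_diff_above y : hi < sqnorm y -> truncation_diff y = 0.
Proof.
case/and3P: ab => _ ? _; case/and3P: ab' => _ ? _; rewrite gt_max => /andP[h1 h2].
by rewrite /truncation_diff /truncation !radial_cutoff_out ?scale0r ?subrr// ltW.
Qed.

Lemma Ck_truncation c d : Ck n punctured_ball (truncation c d).
Proof. exact: (Ck_scale open_punctured_ball (Ck_cutoff n _ c d open_punctured_ball) gC). Qed.

Lemma Ck_truncation_diff : Ck n setT truncation_diff.
Proof.
have C1 : Ck n punctured_ball truncation_diff.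
  exact: (Ck_add open_punctured_ball (Ck_truncation a b)
    (Ck_opp open_punctured_ball (Ck_truncation a' b'))).
have C2 : Ck n [set y : pt | sqnorm y < lo] truncation_diff.
  apply: (Ck_eq (f := fun _ => 0) (@open_sqnorm_lt R n lo) _ (Ck_cst n _ _)).
  by move=> y /set_mem /= yl; rewrite truncation_diff_below.
have C3 : Ck n [set y : pt | hi < sqnorm y] truncation_diff.
  apply: (Ck_eq (f := fun _ => 0) (@open_sqnorm_gt R n hi) _ (Ck_cst n _ _)).
  by move=> y /set_mem /= yl; rewrite truncation_diff_above.
apply: (Ck_subset _ (Ck_setU (Ck_setU C1 C2) C3)) => y _.
have [yl|ly] := ltP (sqnorm y) lo; first by left; right.
have [yh|hy] := ltP hi (sqnorm y); first by right.
by left; left; split => /=; [exact: lt_le_trans lo0 ly|exact: le_lt_trans hy hir].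
Qed.

Lemma dirac_lap_truncation_diff y : dl truncation_diff y = shell a b y - shell a' b' y.
Proof.
have [yO|yO] := boolP ((0 < sqnorm y) && (sqnorm y < r ^+ 2)).
  have yB : punctured_ball y by case/andP: yO.
  have yB' : y \in punctured_ball by rewrite inE.
  rewrite (shell_on a b yB) (shell_on a' b' yB).
  exact: (dirac_lap_sub open_punctured_ball (Ck_truncation a b) (Ck_truncation a' b') yB').
have nB : ~ punctured_ball y by move=> [h1 h2]; move: yO; rewrite h1 h2.
rewrite (shell_off a b nB) (shell_off a' b' nB) subr0.
move: yO; rewrite negb_and -!leNgt => /orP[y0|yr].
  rewrite (dirac_lap_eq_on (v := fun _ => 0) m (@open_sqnorm_lt R n lo)).
  - exact: dirac_lap_cst.
  - by move=> z /set_mem /= zb; rewrite truncation_diff_below.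
  - by rewrite inE /=; exact: le_lt_trans y0 lo0.
rewrite (dirac_lap_eq_on (v := fun _ => 0) m (@open_sqnorm_gt R n hi)).
- exact: dirac_lap_cst.
- by move=> z /set_mem /= zb; rewrite truncation_diff_above.
- by rewrite inE /=; exact: lt_le_trans hir yr.
Qed.

Lemma truncation_diff_vanishes : vanishes_beyond (2 * r) truncation_diff.
Proof.
move=> y ly; apply: truncation_diff_above; apply: (lt_le_trans hir).
apply: (le_trans _ (norm_sqr_le_sqnorm y)); rewrite lerXn2r ?nnegrE ?(ltW r0)//.
by move: ly r0; lra.
Qed.

Lemma shell_diff_support y : shell a b y - shell a' b' y != 0 -> lo <= sqnorm y <= hi.
Proof.
case/and3P: ab => _ h1 _; case/and3P: ab' => _ h2 _.
apply: contraR; rewrite negb_and -!ltNge lt_min gt_max => /orP[]/andP[? ?].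
  by rewrite !shell_below// subrr.
by rewrite !shell_above// subrr.
Qed.

Lemma bounded_shell_diff : bounded_on (fun y => shell a b y - shell a' b' y).
Proof.
have : bounded_on (dl truncation_diff).
  apply: (@Ck_vanishes_bounded R n cl 0 (2 * r)).
    exact: (Ck_dirac_lap openT Ck_truncation_diff).
  exact: vanishes_beyond_dirac_lap truncation_diff_vanishes.
by move=> [B hB]; exists B => y; rewrite -dirac_lap_truncation_diff.
Qed.

Lemma kernel_int_shell_diff x d : 0 < d ->
  (forall y, `|y - x| < d -> truncation_diff y = 0) ->
  cl_int (fun y => (pv (x - y))^-1 * (shell a b y - shell a' b' y)) = 0.
Proof.
move=> d0 xd; rewrite -[RHS](kernel_int_eq0 r0 _ Ck_truncation_diff truncation_diff_vanishes d0 xd).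
  by congr (cl_int _); apply/funext => y; rewrite dirac_lap_truncation_diff.
by move: r0; lra.
Qed.

End Difference.

(** A single shell is not the image of a globally smooth function, but a difference of two is.
    Subtract a shell contained in [|y|^2 <= a / 2]: from [a] on the difference is the given shell,
    which vanishes below [a]. *)
Lemma bounded_shell a b : admissible a b -> bounded_on (shell a b).
Proof.
move=> ab; case/and3P: (ab) => a0 aLb br.
have ab' : admissible (a / 4) (a / 2).
  by apply/and3P; split; move: a0 aLb br; lra.
have [B hB] := bounded_shell_diff ab ab'.
exists B => y; have [ya|ay] := ltP (sqnorm y) a.
  by rewrite shell_below// normr0 (le_trans _ (hB 0)).
have := hB y; rewrite [shell (a / 4) _ _]shell_above ?subr0//; first by move: a0; lra.
by move: a0 ay; lra.
Qed.

Lemma shell_support a b y : admissible a b -> shell a b y != 0 -> a <= sqnorm y <= b.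
Proof.
case/and3P => _ aLb _; apply: contraR; rewrite negb_and -!ltNge => /orP[h|h].
  by rewrite shell_below.
by rewrite shell_above.
Qed.

Section Switch.
Variables (a b a' b' : R).
Hypotheses (ab : admissible a b) (ab' : admissible a' b').

Let lo := Num.min a a'.
Let hi := Num.max b b'.
Let H y := shell a b y - shell a' b' y.

Let lo0 : 0 < lo.
Proof. by case/and3P: ab => ? _ _; case/and3P: ab' => ? _ _; rewrite lt_min; apply/andP. Qed.

Let hi0 : 0 < hi.
Proof.
by case/and3P: ab => h1 h2 _; rewrite lt_max (lt_trans h1 h2).
Qed.

Let Hlo y : H y != 0 -> lo <= sqnorm y.
Proof. by move/(shell_diff_support ab ab') => /andP[]. Qed.

Let Hhi y : H y != 0 -> sqnorm y <= hi.
Proof. by move/(shell_diff_support ab ab') => /andP[]. Qed.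

Let Hb : bounded_on H. Proof. exact: bounded_shell_diff. Qed.

Lemma bounded_outer x k c d : admissible c d -> bounded_on (fun y => geo_term y x k * shell c d y).
Proof.
move=> cd; case/and3P: (cd) => c0 _ _.
apply: (bounded_geo_term (p := id) (q := fun _ => x) (c := sqnorm x / c) (d := c)).
- exact: bounded_shell.
- by rewrite divr_ge0 ?sqnorm_ge0// ltW.
- exact: c0.
- move=> y /(shell_support cd) /andP[cy _]; split => //.
  by rewrite mulrAC ler_pdivlMr// ler_wpM2l// sqnorm_ge0.
Qed.

Lemma bounded_inner x k c d : x != 0 -> admissible c d ->
  bounded_on (fun y => geo_term x y k * shell c d y).
Proof.
move=> x0 cd; case/and3P: (cd) => c0 cLd _.
have sx0 : 0 < sqnorm x by rewrite lt0r sqnorm_eq0 x0 sqnorm_ge0.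
apply: (bounded_geo_term (p := fun _ => x) (q := id) (c := d / sqnorm x) (d := sqnorm x)).
- exact: bounded_shell.
- by rewrite divr_ge0 ?sqnorm_ge0// ltW// (lt_trans c0).
- exact: sx0.
- move=> y /(shell_support cd) /andP[_ yd]; split => //.
  by rewrite divfK// gt_eqF.
Qed.

(* Both sides are coefficients of power series in [s] (with [s x] for [x]); the
   sum of the difference vanishes for small [s] by [kernel_int_shell_diff]. *)
Lemma outer_shell_indep x k :
  cl_int (fun y => geo_term y x k * shell a b y) =
  cl_int (fun y => geo_term y x k * shell a' b' y).
Proof.
apply/eqP; rewrite -subr_eq0 -(cl_intB L_gt0 (bounded_outer x k ab) (bounded_outer x k ab')).
have -> : (fun y => geo_term y x k * shell a b y - geo_term y x k * shell a' b' y) =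
    (fun y => geo_term y x k * H y) by apply/funext => y; rewrite mulrBr.
apply/eqP; pose t j := cl_int (fun y => geo_term y x j * H y).
have cx0 : 0 <= sqnorm x / lo by rewrite divr_ge0 ?sqnorm_ge0// ltW.
have Hpq y : H y != 0 -> lo <= sqnorm y /\ sqnorm x <= sqnorm x / lo * sqnorm y.
  move=> /Hlo ly; split => //.
  by rewrite mulrAC ler_pdivlMr// ler_wpM2l// sqnorm_ge0.
have [C C0 hC] := geo_int_bound L_gt0 (p := id) (q := fun _ => x) Hb cx0 lo0 Hpq.
(* With [s <= 1] this gives [|s x|^2 <= s (|x|^2 + 1) <= lo / 2], so [s x] lies strictly below both
   shells. *)
pose s0 := Num.min 1 (lo / (2 * (sqnorm x + 1))).
have x1 : 0 < sqnorm x + 1 by rewrite ltr_wpDl// sqnorm_ge0.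
have s00 : 0 < s0 by rewrite lt_min ltr01 divr_gt0// mulr_gt0.
have M0 : 0 < Num.sqrt (sqnorm x / lo) + 1 by rewrite ltr_wpDl// sqrtr_ge0.
apply: (@power_series_zero R _ t _ _ _ C0 M0 s00 hC) => s s_gt0 ss0.
have s1 : s <= 1 by apply: (le_trans (ltW ss0)); rewrite ge_min lexx.
have sl : s * (sqnorm x + 1) <= lo / 2.
  have : s <= lo / (2 * (sqnorm x + 1)).
    by apply: (le_trans (ltW ss0)); rewrite ge_min lexx orbT.
  by rewrite ler_pdivlMr ?mulr_gt0//; lra.
have sx : sqnorm (s *: x) <= lo / 2.
  apply: le_trans sl; rewrite sqnormZ expr2 -mulrA ler_pM2l//.
  have := sqnorm_ge0 x; move: s1; nra.
have lo2 : lo / 2 < lo by move: lo0; lra.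
have lo20 : 0 <= lo / 2 by rewrite divr_ge0// ltW.
have [d1 d10 sep] := sqnorm_separated n lo20 lo2.
pose d := Num.min lo d1.
have d0 : 0 < d by rewrite lt_min lo0.
have half0 : 0 <= (1 / 2 : R) by rewrite divr_ge0.
have half1 : (1 / 2 : R) < 1 by lra.
have Hpq' y : H y != 0 -> d <= sqnorm y /\ sqnorm (s *: x) <= 1 / 2 * sqnorm y.
  move=> /Hlo ly; split; first by rewrite ge_min ly.
  by apply: (le_trans sx); move: ly; lra.
have Hsep y : H y != 0 -> d <= sqnorm (y - s *: x).
  by move=> /Hlo ly; rewrite ge_min (sep _ _ sx ly) orbT.
have cv := geo_int_cvg L_gt0 (p := id) (q := fun _ => s *: x) Hb half0 d0 Hpq' half1 Hsep.
have K0 : cl_int (fun y => (pv (y - s *: x))^-1 * H y) = 0.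
  have [e e0 ex] : exists2 e, 0 < e & forall y, `|y - s *: x| < e -> sqnorm y < lo.
    apply: (@open_contains_ball R n [set y | sqnorm y < lo]); first exact: open_sqnorm_lt.
    exact: le_lt_trans sx lo2.
  have := kernel_int_shell_diff ab ab' e0 (fun y ye => truncation_diff_below ab ab' (ex y ye)).
  rewrite -/H (geo_int_flip L_gt0 (p := id) (q := fun _ => s *: x) Hb half0 d0 Hpq' Hsep).
  by move/eqP; rewrite oppr_eq0 => /eqP.
have -> : (fun N => \sum_(j < N) s ^+ j *: t j) =
    fun N => \sum_(j < N) cl_int (fun y => geo_term y (s *: x) j * H y).
  apply/funext => N; apply: eq_bigr => j _; rewrite -(cl_intZ L_gt0).
    by congr (cl_int _); apply/funext => y; rewrite geo_termZ scalerAl.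
  exact: (bounded_geo_term (p := id) (q := fun _ => x) Hb cx0 lo0 Hpq).
move: cv; rewrite K0; exact: id.
Qed.

(** The scaling parameter now enters as [p = s^-1 x], which lies beyond both shells for small [s].
    The terms are homogeneous of degree [- (k + 1)] in [x], so they acquire [s^(k+1)], and one
    factor [s] is divided out. *)
Lemma inner_shell_indep x k : x != 0 ->
  cl_int (fun y => geo_term x y k * shell a b y) =
  cl_int (fun y => geo_term x y k * shell a' b' y).
Proof.
move=> x0.
apply/eqP; rewrite -subr_eq0 -(cl_intB L_gt0 (bounded_inner k x0 ab) (bounded_inner k x0 ab')).
have -> : (fun y => geo_term x y k * shell a b y - geo_term x y k * shell a' b' y) =
    (fun y => geo_term x y k * H y) by apply/funext => y; rewrite mulrBr.
apply/eqP; pose t j := cl_int (fun y => geo_term x y j * H y).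
have sx0 : 0 < sqnorm x by rewrite lt0r sqnorm_eq0 x0 sqnorm_ge0.
have cx0 : 0 <= hi / sqnorm x by rewrite divr_ge0 ?sqnorm_ge0// ltW.
have Hpq y : H y != 0 -> sqnorm x <= sqnorm x /\ sqnorm y <= hi / sqnorm x * sqnorm x.
  by move=> /Hhi yh; split => //; rewrite divfK// gt_eqF.
have [C C0 hC] := geo_int_bound L_gt0 (p := fun _ => x) (q := id) Hb cx0 sx0 Hpq.
have h1 : 0 < hi + 1 by rewrite ltr_wpDl// ltW.
pose s0 := Num.min 1 (sqnorm x / (2 * (hi + 1))).
have s00 : 0 < s0 by rewrite lt_min ltr01 divr_gt0// mulr_gt0.
have M0 : 0 < Num.sqrt (hi / sqnorm x) + 1 by rewrite ltr_wpDl// sqrtr_ge0.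
apply: (@power_series_zero R _ t _ _ _ C0 M0 s00 hC) => s s_gt0 ss0.
have s1 : s <= 1 by apply: (le_trans (ltW ss0)); rewrite ge_min lexx.
have sl : 2 * (hi + 1) <= sqnorm (s^-1 *: x).
  have : s <= sqnorm x / (2 * (hi + 1)).
    by apply: (le_trans (ltW ss0)); rewrite ge_min lexx orbT.
  rewrite ler_pdivlMr ?mulr_gt0// => sh.
  rewrite sqnormZ exprVn [leRHS]mulrC ler_pdivlMr ?exprn_gt0//.
  by apply: le_trans sh; rewrite mulrC ler_wpM2r ?mulr_ge0 ?(ltW h1)// expr2 ler_piMl// ltW.
set p := s^-1 *: x in sl.
have hh1 : hi < hi + 1 by rewrite ltrDl.
have [d1 d10 sep] := sqnorm_separated n (ltW hi0) hh1.
pose d := Num.min 1 d1.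
have d0 : 0 < d by rewrite lt_min ltr01.
have half0 : 0 <= (1 / 2 : R) by rewrite divr_ge0.
have half1 : (1 / 2 : R) < 1 by lra.
have ph : hi + 1 <= sqnorm p by move: sl hi0; lra.
have Hpq' y : H y != 0 -> d <= sqnorm p /\ sqnorm y <= 1 / 2 * sqnorm p.
  move=> /Hhi yh; split; last by move: sl yh; lra.
  by rewrite ge_min (le_trans _ ph)// lerDr ltW.
have Hsep y : H y != 0 -> d <= sqnorm (p - y).
  by move=> /Hhi yh; rewrite ge_min (sep _ _ yh ph) orbT.
have cv := geo_int_cvg L_gt0 (p := fun _ => p) (q := id) Hb half0 d0 Hpq' half1 Hsep.
have K0 : cl_int (fun y => (pv (p - y))^-1 * H y) = 0.
  have [e e0 ex] : exists2 e, 0 < e & forall y, `|y - p| < e -> hi < sqnorm y.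
    apply: (@open_contains_ball R n [set y | hi < sqnorm y]); first exact: open_sqnorm_gt.
    exact: lt_le_trans hh1 ph.
  exact: (kernel_int_shell_diff ab ab' e0 (fun y ye => truncation_diff_above ab ab' (ex y ye))).
have -> : (fun N => \sum_(j < N) s ^+ j *: t j) = fun N =>
    s^-1 *: \sum_(j < N) cl_int (fun y => geo_term p y j * H y).
  apply/funext => N; rewrite scaler_sumr; apply: eq_bigr => j _.
  have -> : (fun y => geo_term p y j * H y) = (fun y => s ^+ j.+1 *: (geo_term x y j * H y)).
    apply/funext => y; rewrite geo_term_scale_l.
    rewrite invrK.
    by rewrite -scalerAl.
  rewrite cl_intZ//; last exact: (bounded_geo_term (p := fun _ => x) (q := id) Hb cx0 sx0 Hpq).
  by rewrite scalerA exprS mulrA mulVf ?mul1r// gt_eqF.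
by rewrite -[X in _ --> X](scaler0 _ s^-1) -[X in s^-1 *: X]K0; exact: (cvgZl_tmp cv).
Qed.

End Switch.

Lemma bounded_mi_pow (w : pt -> pt) (h : pt -> cl) al M : bounded_on h ->
  (forall y i, h y != 0 -> `|w y ord0 i| <= M) ->
  bounded_on (fun y => mi_pow (w y) al *: h y).
Proof.
move=> [B hB] wM; exists (`|\prod_i M ^+ al i| * B) => y.
have [->|h0] := eqVneq (h y) 0.
  by rewrite scaler0 normr0 mulr_ge0// (le_trans (normr_ge0 _) (hB 0)).
rewrite normrZ; apply: ler_pM (normr_ge0 _) (normr_ge0 _) _ (hB y).
rewrite !normr_prod; apply: ler_prod => i _; rewrite normr_ge0 !normrX /=.
have M0 : 0 <= M := le_trans (normr_ge0 _) (wM y i h0).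
by rewrite (ger0_norm M0) lerXn2r ?nnegrE// wM.
Qed.

(** The monomials are scalars and commute with [T al], so the functions of [x] leave the integral on
    the left and the coefficients remain on the right. *)
Lemma cl_int_sum_deg k (T : multiindex n -> cl) (w : pt -> pt) (h : pt -> cl) :
  (forall al, bounded_on (fun y => mi_pow (w y) al *: h y)) ->
  cl_int (fun y => sum_deg k (fun al => mi_pow (w y) al *: T al) * h y) =
  sum_deg k (fun al => T al * cl_int (fun y => mi_pow (w y) al *: h y)).
Proof.
move=> hb; have E y : sum_deg k (fun al => mi_pow (w y) al *: T al) * h y =
    \sum_(g : {ffun 'I_n.+1 -> 'I_k.+1} | mi_deg [ffun i => val (g i)] == k)
      (T [ffun i => val (g i)] * (mi_pow (w y) [ffun i => val (g i)] *: h y)).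
  by rewrite mulr_suml; apply: eq_bigr => i _; rewrite -scalerAl -scalerAr.
rewrite (funext E) (cl_int_sum L_gt0) => [|i].
  by apply: eq_bigr => i _; rewrite (cl_int_mull L_gt0).
have [B hB] := hb [ffun j => val (i j)].
exists ((#|{set 'I_n}|)%:R * (`|T [ffun j => val (i j)]| * B)) => y.
by rewrite (le_trans (cl_norm_mul _ _))// ler_wpM2l// ler_wpM2l.
Qed.

Theorem laurent_expansion_at_origin :
  exists C D : multiindex n -> cl, forall x, punctured_ball x ->
    let s : nat -> cl := fun N => \sum_(0 <= k < N) sum_deg k (fun be => S_ be x * D be) in
    let p : nat -> cl := fun N => \sum_(1 <= k < N) sum_deg k (fun al => P_ al x * C al) in
    [/\ cvgn s, cvgn p & g x = limn s + limn p].
Proof.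
have [kap kap0 repr] := kernel_int_reproduces m r0.
have r2 : 0 < r ^+ 2 by rewrite exprn_gt0.
(* A reference shell chosen before [x]: the coefficients [C] and [D] are its moments. *)
pose a0 := r ^+ 2 / 4; pose b0 := r ^+ 2 / 2.
have ab0 : admissible a0 b0 by apply/and3P; split; rewrite /a0 /b0; move: r2; lra.
have a0p : 0 < a0 by case/and3P: ab0.
pose h := shell a0 b0; have hb : bounded_on h := bounded_shell ab0.
have hlo y : h y != 0 -> a0 <= sqnorm y by move/(shell_support ab0)/andP => [].
have hhi y : h y != 0 -> sqnorm y <= b0 by move/(shell_support ab0)/andP => [].
have coordM (w : pt) M i : sqnorm w <= M -> `|w ord0 i| <= Num.sqrt M.
  move=> wM; rewrite -(sqrtr_sqr (w ord0 i)) ler_wsqrtr// (le_trans _ wM)//.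
  by rewrite /sqnorm (bigD1 i)//= lerDl sumr_ge0// => j _; rewrite sqr_ge0.
have bC al : bounded_on (fun y => mi_pow (para_inv y) al *: h y).
  apply: (@bounded_mi_pow _ _ _ (Num.sqrt a0^-1) hb) => y i hy; apply: coordM.
  by rewrite sqnorm_para_inv lef_pV2 ?posrE ?hlo// (lt_le_trans a0p (hlo y hy)).
have bD be : bounded_on (fun y => mi_pow y be *: h y).
  by apply: (@bounded_mi_pow id _ _ (Num.sqrt b0) hb) => y i hy; apply: coordM; exact: hhi.
pose C al : cl := - kap^-1 *: cl_int (fun y => mi_pow (para_inv y) al *: h y).
pose D be : cl := - kap^-1 *: cl_int (fun y => mi_pow y be *: h y).
exists C, D => x Bx s p; have /= [sx0 sxr] := Bx.
have x0 : x != 0 by rewrite -sqnorm_eq0 gt_eqF.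
set tau := sqnorm x in sx0 sxr.
(* Two shells adapted to [x]: one between [x] and the sphere, the other between the origin and
   [x]. *)
pose aR := (2 * tau + r ^+ 2) / 3; pose bR := (tau + 2 * r ^+ 2) / 3.
have [abR tR] : admissible aR bR /\ tau < aR := admissible_above sx0 sxr.
pose aI := tau / 4; pose bI := tau / 2.
have [abI tI] : admissible aI bI /\ bI < tau := admissible_below sx0 sxr.
have aR0 : 0 < aR by case/and3P: abR.
have bI0 : 0 < bI by rewrite divr_gt0.
have [d1 d10 sep1] := sqnorm_separated n (ltW sx0) tR.
have [d2 d20 sep2] := sqnorm_separated n (ltW bI0) tI.
have Rb := bounded_shell abR; have Ib := bounded_shell abI.
pose cR := tau / aR; pose cI := bI / tau.
have cR0 : 0 <= cR by rewrite divr_ge0// ltW.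
have cI0 : 0 <= cI by rewrite divr_ge0// ltW.
have cR1 : cR < 1 by rewrite ltr_pdivrMr// mul1r.
have cI1 : cI < 1 by rewrite ltr_pdivrMr// mul1r.
pose dR := Num.min aR d1; pose dI := Num.min tau d2.
have dR0 : 0 < dR by rewrite lt_min aR0.
have dI0 : 0 < dI by rewrite lt_min sx0.
have HR y : shell aR bR y != 0 -> dR <= sqnorm y /\ tau <= cR * sqnorm y.
  move=> /(shell_support abR) /andP[ya _]; split; first by rewrite ge_min ya.
  by rewrite /cR mulrAC ler_pdivlMr// ler_wpM2l// ltW.
have HI y : shell aI bI y != 0 -> dI <= sqnorm x /\ sqnorm y <= cI * sqnorm x.
  move=> /(shell_support abI) /andP[_ yb]; split; first by rewrite ge_min lexx.
  by rewrite /cI -/tau divfK// gt_eqF.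
have HRs y : shell aR bR y != 0 -> dR <= sqnorm (y - x).
  by move=> /(shell_support abR) /andP[ya _]; rewrite ge_min (sep1 x y) ?orbT.
have HIs y : shell aI bI y != 0 -> dI <= sqnorm (x - y).
  by move=> /(shell_support abI) /andP[_ yb]; rewrite ge_min (sep2 y x) ?orbT.
have cvR := geo_int_cvg L_gt0 (p := id) (q := fun _ => x) Rb cR0 dR0 HR cR1 HRs.
have cvI := geo_int_cvg L_gt0 (p := fun _ => x) (q := id) Ib cI0 dI0 HI cI1 HIs.
set AR := cl_int _ in cvR; set AI := cl_int _ in cvI.
have flip : cl_int (fun y => (pv (x - y))^-1 * shell aR bR y) = - AR.
  exact: (geo_int_flip L_gt0 (p := id) (q := fun _ => x) Rb cR0 dR0 HR HRs).
have bR' : bounded_on (fun y => (pv (x - y))^-1 * shell aR bR y).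
  have [B hB] := geo_kernel_bounded (p := id) (q := fun _ => x) Rb cR0 dR0 HR HRs.
  by exists B => y; rewrite -opprB paravectorN invrN mulNr normrN; exact: hB.
have bI' := geo_kernel_bounded (p := fun _ => x) (q := id) Ib cI0 dI0 HI HIs.
have xr : `|x| <= r.
  have : `|x| ^+ 2 <= r ^+ 2 by apply: (le_trans (norm_sqr_le_sqnorm x)); exact: ltW.
  by rewrite ler_pXn2r ?nnegrE ?normr_ge0 ?(ltW r0).
have [e e0 xe] : exists2 e, 0 < e & forall y, `|y - x| < e -> bI < sqnorm y /\ sqnorm y < aR.
  apply: (@open_contains_ball R n ([set y | bI < sqnorm y] `&` [set y | sqnorm y < aR])).
    by apply: openI; [exact: open_sqnorm_gt|exact: open_sqnorm_lt].
  by split.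
have aIb : aI < bI by case/and3P: abI.
have aRb : aR < bR by case/and3P: abR.
(* At [x] the outer cutoff is 1 and the inner one 0. Both signs are negative: the outer kernel is
   expanded as [- (y - x)^-1], and the inner truncation is subtracted. This is the origin of
   [- kap^-1] in [C] and [D]. *)
have main : kap *: g x = - AR - AI.
  have := repr _ x e (Ck_truncation_diff abR abI) (truncation_diff_vanishes abR abI) xr e0.
  have -> : truncation_diff aR bR aI bI x = g x.
    rewrite /truncation_diff /truncation radial_cutoff_in ?(ltW tR)//.
    by rewrite radial_cutoff_out ?(ltW tI)// scale1r scale0r subr0.
  move=> <-; last first.
    move=> y /xe [y1 y2]; rewrite dirac_lap_truncation_diff//.
    by rewrite shell_below// shell_above// subrr.
  have -> : (fun y => (pv (x - y))^-1 * dl (truncation_diff aR bR aI bI) y) =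
      (fun y => (pv (x - y))^-1 * shell aR bR y - (pv (x - y))^-1 * shell aI bI y).
    by apply/funext => y; rewrite (dirac_lap_truncation_diff abR abI y) mulrBr.
  apply: (etrans (cl_intB L_gt0 bR' bI')).
  exact: (congr1 (fun z : cl => z - AI) flip).
have sE : s = fun N => - kap^-1 *: \sum_(k < N) cl_int (fun y => geo_term x y k * shell aI bI y).
  apply/funext => N; rewrite /s big_mkord scaler_sumr; apply: eq_bigr => k _.
  rewrite (inner_shell_indep abI ab0 k x0) -/h.
  have -> : (fun y => geo_term x y k * h y) =
      fun y => sum_deg k (fun be => mi_pow y be *: S_ be x) * h y.
    by apply/funext => y; rewrite geo_term_S.
  rewrite (cl_int_sum_deg k (fun be => S_ be x) (w := id) bD) scaler_sumr.
  by apply: eq_bigr => i _; rewrite -scalerAr.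
(* The sum [p] starts at degree 1, and its degree [k + 1] comes from the k-th geometric term, hence
   the shift of [N] by one. *)
have pE : (fun N => p N.+1) =
    fun N => - kap^-1 *: \sum_(k < N) cl_int (fun y => geo_term y x k * shell aR bR y).
  apply/funext => N; rewrite /p big_add1 big_mkord scaler_sumr; apply: eq_bigr => k _.
  rewrite (outer_shell_indep abR ab0) -/h.
  have -> : (fun y => geo_term y x k * h y) =
      fun y => sum_deg k.+1 (fun al => mi_pow (para_inv y) al *: P_ al x) * h y.
    by apply/funext => y; rewrite geo_term_P.
  rewrite (cl_int_sum_deg k.+1 (fun al => P_ al x) bC) scaler_sumr.
  by apply: eq_bigr => i _; rewrite -scalerAr.
have cs : s @ \oo --> - kap^-1 *: AI by rewrite sE; exact: cvgZl_tmp cvI.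
have cp : p @ \oo --> - kap^-1 *: AR.
  have cpS : (fun N => p N.+1) @ \oo --> - kap^-1 *: AR by rewrite pE; exact: cvgZl_tmp cvR.
  by move: cpS; rewrite (cvg_shiftS p).
split; [exact: cvgP cs|exact: cvgP cp|].
rewrite (cvg_lim _ cs)// (cvg_lim _ cp)// -scalerDr scaleNr -scalerN opprD addrC -main.
by rewrite scalerA mulVf// scale1r.
Qed.

End Shells.

(** * Reduction to a ball centred at the origin *)

Section Translation.
Variables (R : realType) (n : nat).
Local Notation pt := 'rV[R]_n.+1.
Local Notation cl := (clifford R n).
Variable a : pt.

(** The codomain is arbitrary so that sets, being predicates, are translated as well: [translate Om]
    is [Om - a]. *)
Definition translate (T : Type) (f : pt -> T) : pt -> T := fun y => f (y + a).

Lemma difference_translate (V : normedModType R) (f : pt -> V) (x v : pt) :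
  (fun h : R => h^-1 *: ((translate f \o shift x) (h *: v) - translate f x)) =
  (fun h : R => h^-1 *: ((f \o shift (x + a)) (h *: v) - f (x + a))).
Proof. by apply/funext => h; rewrite /translate /= addrA. Qed.

Lemma derive_translate (V : normedModType R) (f : pt -> V) (x v : pt) :
  'D_v (translate f) x = 'D_v f (x + a).
Proof. by rewrite /derive difference_translate. Qed.

Lemma derivable_translate (V : normedModType R) (f : pt -> V) (x v : pt) :
  derivable f (x + a) v -> derivable (translate f) x v.
Proof. by rewrite /derivable difference_translate. Qed.

Lemma continuous_translate (V : normedModType R) (f : pt -> V) (x : pt) :
  {for x + a, continuous f} -> {for x, continuous (translate f)}.
Proof.
move=> cf; have ca : {for x, continuous (fun y : pt => y + a)}.
  exact: (cvgD (@cvg_id _ (nbhs x)) (cvg_cst a)).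
exact: (@continuous_comp _ _ _ (fun y : pt => y + a) f x ca cf).
Qed.

Lemma Ck_translate (V : normedModType R) k Om (f : pt -> V) :
  Ck k Om f -> Ck k (translate Om) (translate f).
Proof.
elim: k f => [|k IH] f [cf df]; split => //.
- by move=> x Ox; apply: continuous_translate; exact: cf.
- by move=> x Ox; apply: continuous_translate; exact: cf.
- move=> i; have [d c] := df i; split.
    by move=> x Ox; apply: derivable_translate; exact: d.
  by rewrite (funext (fun x => derive_translate f x _)); exact: IH c.
Qed.

Lemma partial_translate i (u : pt -> cl) : partial i (translate u) = translate (partial i u).
Proof. by apply/funext => x; exact: derive_translate. Qed.

Lemma dirac_lap_translate m (u : pt -> cl) :
  dirac_lap m (translate u) = translate (dirac_lap m u).
Proof.
have lapE w : laplacian (translate w) = translate (laplacian w).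
  by apply/funext => x; apply: eq_bigr => i _; rewrite !partial_translate.
have itE k : iter k (@laplacian R n) (translate u) = translate (iter k (@laplacian R n) u).
  by elim: k => [|k IH]; rewrite ?iterS ?IH ?lapE.
apply/funext => x; rewrite /dirac_lap itE; apply: eq_bigr => i _.
by rewrite partial_translate.
Qed.

Lemma punctured_ball_translate r y : 0 < r ->
  (euclid_ball a r `\ a) (y + a) <-> 0 < sqnorm y /\ sqnorm y < r ^+ 2.
Proof.
move=> r0; rewrite /euclid_ball /= addrK.
have -> : (Num.sqrt (sqnorm y) < r) = (sqnorm y < r ^+ 2).
  by rewrite -[in LHS](ger0_norm (ltW r0)) -sqrtr_sqr ltr_sqrt// exprn_gt0.
rewrite lt0r sqnorm_ge0 sqnorm_eq0 andbT; split=> [[h1 h2]|[h1 h2]]; split => //.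
  by apply/eqP => y0; apply: h2; rewrite y0 add0r.
by move=> /eqP; rewrite -subr_eq0 addrK (negbTE h1).
Qed.

End Translation.

Theorem mainTheorem3 (R : realType) (m : nat) (a : 'rV[R]_m.*2.+2) (r : R)
    (f : 'rV[R]_m.*2.+2 -> clifford R m.*2.+1) :
  0 < r ->
  holomorphic_cliffordian (euclid_ball a r `\ a) f ->
  exists C D : multiindex m.*2.+1 -> clifford R m.*2.+1,
  forall x : 'rV[R]_m.*2.+2, (euclid_ball a r `\ a) x ->
    let s : nat -> clifford R m.*2.+1 := fun N => \sum_(0 <= k < N)
                sum_deg k (fun be => S_ be (x - a) * D be) in
    let p : nat -> clifford R m.*2.+1 := fun N => \sum_(1 <= k < N)
                sum_deg k (fun al => P_ al (x - a) * C al) in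
    [/\ cvgn s, cvgn p & f x = limn s + limn p].
Proof.
move=> r0 [fC f0].
have BE y : (euclid_ball a r `\ a) (y + a) <-> punctured_ball r y :=
  punctured_ball_translate a y r0.
have gC : Ck m.*2.+1 (punctured_ball r) (translate a f).
  have := Ck_translate a ((class_C_Ck _ _ _).1 fC).
  by apply: Ck_subset => y /BE.
have g0 y : punctured_ball r y -> dirac_lap m (translate a f) y = 0.
  by move=> /BE yB; rewrite dirac_lap_translate; exact: f0.
have [C [D CD]] := laurent_expansion_at_origin r0 gC g0.
exists C, D => x xB s p.
have xaB : punctured_ball r (x - a) by apply/BE; rewrite subrK.
have := CD _ xaB; rewrite /translate subrK; exact: id.
Qed.
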